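(* Let $d\ge 3$ be a fixed integer. There are constants $C_d>0$ and $n_d$ depending only on $d$ such that the following holds for all $n\ge n_d$ and all $0\le\varepsilon\le 1$. Suppose that $G\in\mathcal D_{n,d}$ satisfies $n^2\mu(G)\le (d-1)\pi^2+\varepsilon$, or that $G\in\mathcal R_{n,d}$ satisfies $n^2\mu(G)\le c_d\pi^2+\varepsilon$, where $c_d=d-1$ if $d$ is odd and $c_d=2(d-2)$ if $d$ is even. Then $$\frac{3n}{d+1}-C_d(\varepsilon+n^{-1})^{1/3}n\ \le\ \operatorname{diam}(G)\ \le\ 3\left\lfloor\frac{n}{d+1}\right\rfloor-1.$$
   Context: All graphs are finite, simple and undirected. For a connected graph $G$, $\mu(G)$ is the algebraic connectivity, i.e. the second smallest eigenvalue of the Laplacian $\mathsf D(G)-\mathsf A(G)$, and $\operatorname{diam}(G)$ is the diameter. $\mathcal D_{n,d}$ is the class of connected graphs of order $n$ with minimum degree at least $d$, and $\mathcal R_{n,d}$ is the class of connected $d$-regular graphs of order $n$. *)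

(* Defs.v *)
From mathcomp Require Import all_boot all_order all_algebra.
From mathcomp Require Import polyrcf.
From mathcomp Require Import all_classical all_reals all_analysis.

Set Implicit Arguments.
Unset Strict Implicit.
Unset Printing Implicit Defensive.

Import Order.TTheory GRing.Theory Num.Theory.

Local Open Scope ring_scope.

Record sgraph (V : finType) := SGraph {
  adj :> rel V;
  adj_sym : symmetric adj;
  adj_irr : irreflexive adj }.

Section Graph.
Variables (V : finType) (G : sgraph V).

Definition degree (v : V) : nat := #|[set w | adj G v w]|.

Definition connected_graph : Prop :=
  (0 < #|V|)%N /\ forall x y : V, connect (adj G) x y.

Definition walk (k : nat) (x y : V) : bool :=
  [exists p : k.-tuple V, path (adj G) x p && (last x p == y)].

(* [find] returns the least k < #|V| such that there is a walk of length k;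
   it returns the junk value #|V| when y cannot be reached from x. *)
Definition dist (x y : V) : nat :=
  find (fun k => walk k x y) (iota 0 #|V|).

Definition diam : nat := (\max_(x : V) \max_(y : V) dist x y)%N.

Definition class_D (n d : nat) : Prop :=
  [/\ #|V| = n, connected_graph & forall v : V, (d <= degree v)%N].

Definition class_R (n d : nat) : Prop :=
  [/\ #|V| = n, connected_graph & forall v : V, degree v = d].

(* Rows and columns are indexed by the enumeration of the vertices. *)
Definition adj_mx (R : realType) : 'M[R]_#|V| :=
  \matrix_(i, j) (adj G (enum_val i) (enum_val j))%:R.

Definition deg_mx (R : realType) : 'M[R]_#|V| :=
  diag_mx (\row_i (degree (enum_val i))%:R).

Definition laplacian (R : realType) : 'M[R]_#|V| := deg_mx R - adj_mx R.

End Graph.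

(* Real eigenvalues in nondecreasing order, each repeated according to its
   algebraic multiplicity ([rootsR] lists the distinct real roots in
   increasing order). *)
Definition eigenvalues (R : realType) (n : nat) (A : 'M[R]_n) : seq R :=
  flatten [seq nseq (mup x (char_poly A)) x | x <- rootsR (char_poly A)].

(* The second smallest eigenvalue, counting multiplicity; the default value
   is reached only for a graph with fewer than two vertices. *)
Definition alg_connectivity (R : realType) (V : finType) (G : sgraph V) : R :=
  nth 0 (eigenvalues (laplacian G R)) 1.

Definition c_ (d : nat) : nat := if odd d then d.-1 else (2 * (d - 2))%N.

(* Main.v *)
(* Let x_0 <= ... <= x_{n-1} be the sorted entries of an eigenvector for mu and M_k = -(x_0 + ... +
x_{k-1}). Summing the eigenvalue equation over the first k vertices shows that the flux through the
k-th cut (the sum of x_j - x_i over the edges ij with i < k <= j) equals mu M_k. Let c be d - 1 in the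
minimum degree case and 2(d - 2) in the regular case with d even. A local analysis of the cuts shows
that, wherever the flux is at most c T, either x (in the even regular case, the mean of two consecutive
entries) gains at most T (s - kap) over some bounded number s of ranks, with a fixed slack kap > 0, or
the next d + 1 ranks lie between two minimal cuts (of size 1, resp. 2) in such a way that they cost
three edges of every path through them.

Since sum x_k^2 = sum M_k (x_k - x_{k-1}), the local estimate with T = mu M_b / c gives, up to boundary
errors, sum x_k^2 <= (mu / c) (sum M_k^2 - kap sum_{slack b} M_b^2). The sharp discrete Wirtinger
inequality, in Picone form with s_k = sin (k pi / n), bounds sum x_k^2 = sum (M_{k+1} - M_k)^2 below by
(2 - 2 cos (pi / n)) sum M_k^2 plus a defect that measures how far M / s is from a constant. Hence both the
defect and the slack weight are O(eps + 1/n) relative to sum M_k^2, so M is comparable to s and the q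
slack places, which carry weight at least of order q^3 / n^3, satisfy q^3 = O((eps + 1/n) n^3). All
other ranks are covered by blocks of d + 1 vertices, each adding 3 to the diameter. *)

Require Import Defs.
From mathcomp Require Import all_boot all_order all_algebra.
From mathcomp Require Import spectral complex polyrcf zify ring lra.
From mathcomp Require Import all_classical all_reals all_analysis.

Set Implicit Arguments.
Unset Strict Implicit.
Unset Printing Implicit Defensive.

Import Order.TTheory GRing.Theory Num.Theory.
Local Open Scope ring_scope.

(** * Cuts of a ranked graph *)

(** Since M changes by at most the range B of x per rank, dividing x by T makes every flux near a
    rank at most c, and the spectral bound becomes a graph problem with fixed constants in a window
    of bounded length. Three obstacles shape the local analysis. A window may start one rank late,
    behind a vertex at which a whole large cut ends. The extra rank is affordable because a full
    window is never followed by a late one, so a late start is charged to the preceding slack place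
    or to the very beginning; the local lemmas therefore record the type of their start. For even d
    every cut of a regular graph has even size, so a minimal cut has two edges with possibly
    different ends; no single entry of x is then controlled, which is why means of two entries
    appear. Finally, cut fluxes alone do not decide how two edges share the flow, so the eigenvalue
    equation is also used at single vertices, up to a drift mu B / T that the large parameter L
    keeps below kap. Regular graphs of odd degree need no separate treatment, because there c_d = d
    - 1. *)

Lemma sum_top_le (R : realFieldType) (P : nat -> bool) (y : nat -> R) (N m K : nat) :
  {homo y : i j / (i <= j)%N >-> i <= j} -> 0 <= y K ->
  (m <= \sum_(K <= j < N) P j)%N ->
  \sum_(0 <= t < m) y (K + t)%N <= \sum_(K <= j < N) (P j)%:R * y j.
Proof.
move=> ymono; have [l] := ubnP (N - K)%N; elim: l K m => // l IHl K m lNK yK0.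
have pos K' : (K <= K')%N -> 0 <= \sum_(K' <= j < N) (P j)%:R * y j.
  move=> KK'; rewrite big_nat sumr_ge0 // => j /andP[K'j _].
  by rewrite mulr_ge0 // (le_trans yK0) // ymono // (leq_trans KK').
have [NK|KN] := leqP N K.
  by rewrite big_geq // leqn0 => /eqP ->; rewrite big_geq // pos.
case: m => [_|m]; first by rewrite big_geq // pos.
have yS : 0 <= y K.+1 by rewrite (le_trans yK0) // ymono.
rewrite [X in (_ <= X)%N]big_ltn // [leRHS]big_ltn //.
have lNK' : (N - K.+1 < l)%N by lia.
case: (P K) => /=.
  rewrite add1n ltnS => h; rewrite big_nat_recl // addn0 mul1r lerD2l.
  by under eq_bigr do rewrite addnS -addSn; apply: IHl.
rewrite add0n mul0r add0r => h; apply: le_trans (IHl _ _ lNK' yS h).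
by apply: ler_sum => t _; rewrite ymono // leq_add2r.
Qed.

(** The selected indices are distinct, so the sum is least when they are the ones nearest to [K].
    This is [sum_top_le] read downwards. *)
Lemma sum_bot_le (R : realFieldType) (P : nat -> bool) (y : nat -> R) (m K : nat) :
  {in [pred i | (i < K)%N] &, {homo y : i j / (i <= j)%N >-> j <= i}} ->
  (forall i, (i < K)%N -> 0 <= y i) ->
  (m <= \sum_(0 <= j < K) P j)%N ->
  \sum_(0 <= t < m) y (K - t.+1)%N <= \sum_(0 <= j < K) (P j)%:R * y j.
Proof.
elim: K m => [|K IHK] m ymono y0 hm.
  by move: hm; rewrite big_geq // leqn0 => /eqP ->; rewrite !big_geq.
have pos : 0 <= \sum_(0 <= j < K) (P j)%:R * y j.
  by rewrite big_nat sumr_ge0 // => j /andP[_ jK]; rewrite mulr_ge0 // y0 // ltnW.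
move: hm; rewrite !big_nat_recr //=.
case: m => [_|m]; first by rewrite big_geq // addr_ge0 // mulr_ge0 // y0.
have IH m' : (m' <= \sum_(0 <= j < K) P j)%N ->
    \sum_(0 <= t < m') y (K - t.+1)%N <= \sum_(0 <= j < K) (P j)%:R * y j.
  apply: IHK => [i j /= iK jK ij|i iK]; first by apply: ymono => //=; rewrite inE ltnW.
  by rewrite y0 // ltnW.
case: (P K) => /=.
  rewrite addn1 ltnS => h; rewrite mul1r big_nat_recl // subSS subn0 [leRHS]addrC lerD2l.
  by under eq_bigr do rewrite subSS; apply: IH.
rewrite addn0 mul0r addr0 => h; apply: le_trans (IH _ h).
have mK : (m.+1 <= K)%N.
  apply: leq_trans h _; apply: (leq_trans (n := \sum_(0 <= j < K) 1)).
    by apply: leq_sum => j _; case: (P j).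
  by rewrite sum_nat_const_nat muln1 subn0.
rewrite big_nat [leRHS]big_nat; apply: ler_sum => t /andP[_ tm].
by apply: ymono; rewrite ?inE; lia.
Qed.

Section Cuts.
Variables (R : realFieldType) (n : nat) (A : rel nat) (x : nat -> R).

Definition nbrs (a b z : nat) : nat := (\sum_(a <= j < b) A z j)%N.
Definition upsum (K z : nat) : R := \sum_(K <= j < n) (A z j)%:R * (x j - x z).
Definition dnsum (K z : nat) : R := \sum_(0 <= j < K) (A z j)%:R * (x z - x j).
Definition cutflux (K : nat) : R := \sum_(0 <= z < K) upsum K z.
Definition cutsize (K : nat) : nat := (\sum_(0 <= z < K) nbrs K n z)%N.
(** Monotonicity is asked on all of [nat], so that comparing two entries never needs a bound on the
    ranks; [rankval] provides it by repeating the last entry. *)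
Definition ranked : Prop :=
  [/\ symmetric A, irreflexive A, forall i j, A i j -> (j < n)%N
    & {homo x : i j / (i <= j)%N >-> i <= j}].

End Cuts.

Section Basic.
Variables (R : realFieldType) (n : nat) (A : rel nat) (x : nat -> R).
Hypothesis rk : ranked n A x.

Local Notation nb := (nbrs A).
Local Notation up := (upsum n A x).
Local Notation dn := (dnsum A x).
Local Notation flux := (cutflux n A x).
Local Notation ecut := (cutsize n A).

Let Asym : symmetric A. Proof. by case: rk. Qed.
Let Airr : irreflexive A. Proof. by case: rk. Qed.
Let xmono : {homo x : i j / (i <= j)%N >-> i <= j}. Proof. by case: rk. Qed.

Lemma nb_cat b a c z : (a <= b)%N -> (b <= c)%N -> nb a c z = (nb a b z + nb b c z)%N.
Proof. exact: big_cat_nat. Qed.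

Lemma nb_le a b z : (nb a b z <= b - a)%N.
Proof.
apply: (leq_trans (n := \sum_(a <= j < b) 1)).
  by apply: leq_sum => j _; case: (A z j).
by rewrite sum_nat_const_nat muln1.
Qed.

Lemma nb1 a z : nb a a.+1 z = A z a.
Proof. by rewrite /nb big_nat1. Qed.

Lemma nb_recl a b z : (a < b)%N -> nb a b z = (A z a + nb a.+1 b z)%N.
Proof. by move=> ab; rewrite /nb big_ltn. Qed.

Lemma nb_recr a b z : (a <= b)%N -> nb a b.+1 z = (nb a b z + A z b)%N.
Proof. by move=> ab; rewrite /nb big_nat_recr. Qed.

Lemma nb_le_self a b z : (a <= z < b)%N -> (nb a b z <= (b - a).-1)%N.
Proof.
move=> /andP[az zb]; rewrite (@nb_cat z) //; last exact: ltnW.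
rewrite (nb_recl _ zb) Airr add0n.
have := nb_le a z z; have := nb_le z.+1 b z; lia.
Qed.

Lemma nb_gt0 a b z : (0 < nb a b z)%N -> exists2 j, (a <= j < b)%N & A z j.
Proof.
rewrite lt0n /nb sum_nat_seq_neq0 => /hasP[j]; rewrite mem_index_iota => jab /=.
by case Azj : (A z j) => // _; exists j.
Qed.

Lemma le_nb a b z j : (a <= j < b)%N -> A z j -> (0 < nb a b z)%N.
Proof.
move=> /andP[aj jb] Azj; rewrite (@nb_cat j) ?(ltnW jb) // (nb_recl _ jb) Azj; lia.
Qed.

Lemma xle i j : (i <= j)%N -> x i <= x j. Proof. exact: xmono. Qed.

Lemma up_ge m K z : (z <= K)%N -> (m <= nb K n z)%N ->
  \sum_(0 <= t < m) (x (K + t)%N - x z) <= up K z.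
Proof.
move=> zK hm; apply: (@sum_top_le _ (A z) (fun j => x j - x z)) => //.
  by move=> i j ij; rewrite lerD2r xle.
by rewrite subr_ge0 xle.
Qed.

Lemma up_ge0 K z : (z <= K)%N -> 0 <= up K z.
Proof. by move=> zK; apply: le_trans (up_ge (m := 0) zK _) => //; rewrite big_geq. Qed.

Lemma dn_ge m K z : (K <= z)%N -> (m <= nb 0 K z)%N ->
  \sum_(0 <= t < m) (x z - x (K - t.+1)%N) <= dn K z.
Proof.
move=> Kz hm; apply: (@sum_bot_le _ (A z) (fun j => x z - x j)) => //.
  by move=> i j _ _ ij; rewrite lerD2l lerN2 xle.
by move=> i iK; rewrite subr_ge0 xle // ltnW // (leq_trans iK).
Qed.

Lemma dn_ge0 K z : (K <= z)%N -> 0 <= dn K z.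
Proof. by move=> zK; apply: le_trans (dn_ge (m := 0) zK _) => //; rewrite big_geq. Qed.

Lemma flux_dn K : flux K = \sum_(K <= z < n) dn K z.
Proof.
rewrite /flux /up /dn exchange_big_nat /=.
by apply: eq_bigr => z _; apply: eq_bigr => j _; rewrite Asym.
Qed.

Lemma ecut_dn K : ecut K = (\sum_(K <= z < n) nb 0 K z)%N.
Proof.
rewrite /cutsize /nbrs exchange_big_nat /=.
by apply: eq_bigr => z _; apply: eq_bigr => j _; rewrite Asym.
Qed.

Lemma flux_ge_up a K : (a <= K)%N -> \sum_(a <= z < K) up K z <= flux K.
Proof.
move=> aK; rewrite /flux (@big_cat_nat _ _ _ a 0 K) //= lerDr.
by rewrite big_nat sumr_ge0 // => z /andP[_ za]; rewrite up_ge0 //; lia.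
Qed.

Lemma flux_ge_dn b K : (K <= b)%N -> (b <= n)%N -> \sum_(K <= z < b) dn K z <= flux K.
Proof.
move=> Kb bn; rewrite flux_dn (@big_cat_nat _ _ _ b K n) //= lerDl.
by rewrite big_nat sumr_ge0 // => z /andP[bz _]; rewrite dn_ge0 //; lia.
Qed.

(** Every crossing edge is shortened until it starts at [K.-1], the highest rank below the cut; only
    the number of edges into each upper end then matters. *)
Lemma flux_ge_nb K : \sum_(K <= z < n) (nb 0 K z)%:R * (x z - x K.-1) <= flux K.
Proof.
rewrite flux_dn big_nat [leRHS]big_nat; apply: ler_sum => z /andP[Kz zn].
rewrite /dn /nb natr_sum mulr_suml big_nat [leRHS]big_nat.
by apply: ler_sum => j /andP[_ jK]; rewrite ler_wpM2l // lerD2l lerN2 xle //; lia.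
Qed.

(** All edges of the cut span the step from rank [K.-1] to rank [K]. *)
Lemma ecut_gap K : (ecut K)%:R * (x K - x K.-1) <= flux K.
Proof.
apply: le_trans (flux_ge_nb K); rewrite ecut_dn natr_sum mulr_suml.
rewrite big_nat [leRHS]big_nat; apply: ler_sum => z /andP[Kz zn].
by rewrite ler_wpM2l // lerD2r xle.
Qed.

(** Moving rank [K] below the cut trades its lower edges for its upper ones. *)
Lemma ecutS K : (K < n)%N -> (ecut K.+1 + nb 0 K K = ecut K + nb K.+1 n K)%N.
Proof.
move=> Kn; rewrite -[ecut K.+1]/(\sum_(0 <= z < K.+1) nb K.+1 n z)%N big_nat_recr //=.
rewrite -[ecut K]/(\sum_(0 <= z < K) nb K n z)%N [in RHS](eq_bigr (fun z => (A z K + nb K.+1 n z)%N)); last first.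
  by move=> z _; rewrite nb_recl.
rewrite big_split /=; suff -> : (\sum_(0 <= i < K) A i K = nb 0 K K)%N by lia.
by apply: eq_bigr => j _; rewrite Asym.
Qed.

Lemma up_ge_nb K z : (z <= K)%N -> (nb K n z)%:R * (x K - x z) <= up K z.
Proof.
move=> zK; rewrite /up /nb natr_sum mulr_suml big_nat [leRHS]big_nat.
by apply: ler_sum => j /andP[Kj _]; rewrite ler_wpM2l // lerD2r xle.
Qed.

End Basic.

Lemma big_split2 (T : Type) (idx : T) (op : Monoid.com_law idx) (F : nat -> T) (a b i j : nat) :
  (a <= i < b)%N -> (a <= j < b)%N -> i != j ->
  \big[op/idx]_(a <= z < b) F z
  = op (op (F i) (F j)) (\big[op/idx]_(a <= z < b | (z != i) && (z != j)) F z).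
Proof.
move=> iab jab ij; rewrite (bigD1_seq i) ?mem_index_iota ?iota_uniq //= -Monoid.mulmA.
congr (op _ _); rewrite (bigID (pred1 j)) /=; congr (op _ _).
rewrite (eq_bigl (pred1 j)); last first.
  by move=> z /=; case: (eqVneq z j) => [->|]; rewrite ?andbF // eq_sym ij.
by rewrite -big_filter filter_pred1_uniq ?iota_uniq ?mem_index_iota // big_seq1.
Qed.

Lemma sum_split2 (M : nmodType) (F : nat -> M) (a b i j : nat) :
  (a <= i < b)%N -> (a <= j < b)%N -> i != j ->
  \sum_(a <= z < b) F z
  = F i + F j + \sum_(a <= z < b | (z != i) && (z != j)) F z.
Proof. exact: big_split2. Qed.

Lemma sum_split2n (F : nat -> nat) (a b i j : nat) :
  (a <= i < b)%N -> (a <= j < b)%N -> i != j ->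
  (\sum_(a <= z < b) F z
  = F i + F j + \sum_(a <= z < b | (z != i) && (z != j)) F z)%N.
Proof. exact: big_split2. Qed.

Lemma sum_neq_nat (a b z : nat) : (a <= z < b)%N ->
  (\sum_(a <= j < b) (j != z) = (b - a).-1)%N.
Proof.
move=> zab; have : (\sum_(a <= j < b) (j != z) + \sum_(a <= j < b) (j == z) = b - a)%N.
  rewrite -big_split /= (eq_bigr (fun=> 1%N)) ?sum_nat_const_nat ?muln1 //.
  by move=> j _; case: (j == z).
suff -> : (\sum_(a <= j < b) (j == z) = 1)%N by lia.
rewrite (bigD1_seq z) ?mem_index_iota ?iota_uniq //= eqxx big1 // => j.
by move/negPf ->.
Qed.

Lemma sum_nat3 (R : realFieldType) (F : nat -> R) :
  \sum_(0 <= t < 3) F t = F 0%N + F 1%N + F 2%N.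
Proof. by rewrite /index_iota /= !big_cons big_nil addr0 ?addrA. Qed.

Lemma sum_nat2 (R : realFieldType) (F : nat -> R) :
  \sum_(0 <= t < 2) F t = F 0%N + F 1%N.
Proof. by rewrite /index_iota /= !big_cons big_nil addr0 ?addrA. Qed.

Lemma sum_nat4 (R : realFieldType) (F : nat -> R) :
  \sum_(0 <= t < 4) F t = F 0%N + F 1%N + F 2%N + F 3%N.
Proof. by rewrite /index_iota /= !big_cons big_nil addr0 ?addrA. Qed.

(** * A two-edge cut with two different upper ends *)

Section Pair.
Variables (R : realFieldType) (n : nat) (A : rel nat) (x : nat -> R).
Hypothesis rk : ranked n A x.

Local Notation nb := (nbrs A).
Local Notation up := (upsum n A x).
Local Notation dn := (dnsum A x).
Local Notation flux := (cutflux n A x).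

Let Asym : symmetric A. Proof. by case: rk. Qed.
Let Airr : irreflexive A. Proof. by case: rk. Qed.
Let xle := xle rk.

(** Minus the Laplacian of [x] at [z], hence [- mu * x z] for the eigenvector. With this sign it is
    the surplus of the upward over the downward flow at [z]. *)
Definition kirch (z : nat) : R := \sum_(0 <= j < n) (A z j)%:R * (x j - x z).

Lemma kirchE K z : (K <= n)%N -> kirch z = up K z - dn K z.
Proof.
move=> Kn; rewrite /kirch (@big_cat_nat _ _ _ K) //= /upsum /dnsum addrC; congr (_ + _).
by rewrite -sumrN; apply: eq_bigr => j _; rewrite -mulrN opprB.
Qed.

Lemma sum_top_far (z : nat) (w : nat -> R) (K : nat) :
  {homo w : i j / (i <= j)%N >-> i <= j} -> 0 <= w K ->
  (1 <= nb K n z)%N ->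
  w K + ((nb K n z)%:R - 1) * w K.+1 <= \sum_(K <= j < n) (A z j)%:R * w j.
Proof.
move=> wm w0 f1; apply: le_trans (@sum_top_le _ (A z) w n _ K wm w0 (leqnn _)).
rewrite -/(nb K n z); case: (nb K n z) f1 => // m _.
rewrite big_nat_recl // addn0 lerD2l -addn1 natrD addrK.
have -> : m%:R * w K.+1 = \sum_(0 <= t < m) w K.+1.
  by rewrite sumr_const_nat subn0 mulr_natl.
by apply: ler_sum => t _; apply: wm; rewrite addnS ltnS leq_addr.
Qed.

Lemma up_shift (yb : R) (a z : nat) :
  up a z = \sum_(a <= j < n) (A z j)%:R * (x j - yb) - (nb a n z)%:R * (x z - yb).
Proof.
by rewrite /upsum /nbrs natr_sum mulr_suml -sumrB; apply: eq_bigr => j _; ring.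
Qed.

Variables (d k K j2 : nat) (del : R).
Hypothesis d4 : (4 <= d)%N.
Hypothesis KE : (K + 1 = k + d)%N.
Hypothesis Kn : (K < n)%N.
Hypothesis degd : forall z, (z < n)%N -> nb 0 n z = d.
Hypothesis j2r : (k < j2 < K)%N.
Hypothesis low1 : nb 0 k k = 1%N.
Hypothesis low2 : nb 0 k j2 = 1%N.
Hypothesis low0 : forall z, (k <= z < n)%N -> z != k -> z != j2 -> nb 0 k z = 0%N.
Hypothesis fluxk : flux k <= 2 * (d%:R - 2).
Hypothesis fluxK : flux K <= 2 * (d%:R - 2).
Hypothesis kir1 : kirch k <= del.
Hypothesis kir2 : kirch j2 <= del.

Let kK : (k <= k < K)%N. Proof. by clear -j2r; lia. Qed.
Let jK : (k <= j2 < K)%N. Proof. by clear -j2r; lia. Qed.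
Let kj : k != j2. Proof. by clear -j2r; lia. Qed.
Let kn : (k <= k < n)%N. Proof. by clear -j2r Kn; lia. Qed.
Let jn : (k <= j2 < n)%N. Proof. by clear -j2r Kn; lia. Qed.
Let kKw : (k <= K)%N. Proof. by clear -j2r; lia. Qed.
Let Knw : (K <= n)%N. Proof. exact: ltnW. Qed.
Let Kk : (K - k = d.-1)%N. Proof. by clear -KE d4; lia. Qed.

Local Notation mu j := (A k j + A j2 j)%N.
Local Notation rest z := ((z != k) && (z != j2)).

Lemma nb_split3 z : (nb 0 k z + nb k K z + nb K n z = nb 0 n z)%N.
Proof.
by rewrite (@nb_cat A K 0 n) ?(@nb_cat A k 0 K).
Qed.

(** The window from [k] to [K] has d - 1 vertices. Apart from [z] and the pair, d - 4 of them can be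
    neighbours of [z], and no neighbour lies below [k]; the remaining edges of [z] must pass [K]. *)
Lemma far_rest z : (k <= z < K)%N -> rest z -> (4 - mu z <= nb K n z)%N.
Proof.
move=> zK /andP[zk zj2].
have zn : (k <= z < n)%N by clear -zK Kn; lia.
have := nb_split3 z; rewrite (degd (proj2 (andP zn))) low0 //.
have : (nb k K z <= mu z + (d - 4))%N.
  rewrite /nbrs (@sum_split2n (fun j => A z j : nat) k K k j2 kK jK kj).
  rewrite ![A z _]Asym leq_add2l.
  have := sum_neq_nat zK; rewrite (@sum_split2n (fun j => (j != z) : nat) k K k j2 kK jK kj).
  rewrite !(eq_sym _ z) (negPf zk) (negPf zj2) /= Kk => e.
  have le : (\sum_(k <= j < K | (j != k) && (j != j2)) A z j <=
     \sum_(k <= j < K | (j != k) && (j != j2)) (j != z))%N.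
    by apply: leq_sum => j _; case: (eqVneq j z) => [->|]; rewrite ?Airr // leq_b1.
  apply: leq_trans le _; clear -e d4; lia.
clear -d4; lia.
Qed.

(** The tight case is a vertex joined to both members of the pair: its two edges from the pair and
    its two edges past [K] together reach from [yb] to [x K] and [x K.+1], wherever [z] itself
    lies. *)
Lemma term_rest (yb : R) z : (k <= z < K)%N -> rest z ->
  x K + x K.+1 - 2 * yb - (2 - (mu z)%:R) * (x K.+1 - yb)
  <= (mu z)%:R * (x z - yb) + up K z.
Proof.
move=> zK rz; have far := far_rest zK rz.
have zleK : (z <= K)%N by clear -zK; lia.
have mono2 : x K.+1 <= x (K + 2)%N by apply: xle; rewrite addn2.
have mono3 : x K.+1 <= x (K + 3)%N by apply: xle; rewrite addn3 ltnS ltnW.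
have monoz : x z <= x K by apply: xle.
have mono1 : x K <= x K.+1 by apply: xle.
have mu2 : (mu z <= 2)%N by case: (A k z); case: (A j2 z).
case: (mu z) mu2 far => [|[|[|//]]] _ far.
- have := up_ge rk zleK far; rewrite subn0 sum_nat4 addn0 addn1.
  lra.
- have := up_ge rk zleK far; rewrite subSS subn0 sum_nat3 addn0 addn1.
  lra.
- have := up_ge rk zleK far; rewrite !subSS subn0 sum_nat2 addn0 addn1.
  lra.
Qed.

Lemma pair_nb_up z : (z < n)%N -> nb 0 k z = 1%N -> (nb k n z = d.-1)%N.
Proof.
move=> zn l1; have := degd zn; rewrite (@nb_cat A k 0 n) //; last exact: leq_trans kKw Knw.
by rewrite l1 add1n => <-.
Qed.

Lemma pair_far z : (k <= z < K)%N -> nb 0 k z = 1%N -> (1 <= nb K n z)%N.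
Proof.
move=> zK l1; have zn : (z < n)%N by clear -zK Kn; lia.
have := nb_split3 z; rewrite (degd zn) l1; have := nb_le_self rk zK; rewrite Kk.
clear -d4; lia.
Qed.

Lemma pair_count :
  (\sum_(k <= z < K | rest z) mu z + 2 * A k j2 + nb K n k + nb K n j2 = 2 * d.-1)%N.
Proof.
have e2 : (nb k K k + nb k K j2 = \sum_(k <= j < K) mu j)%N by rewrite /nbrs -big_split.
rewrite (@sum_split2n (fun j => mu j) k K k j2 kK jK kj) !Airr [A j2 k]Asym in e2.
have e4 z : nb k n z = (nb k K z + nb K n z)%N by apply: nb_cat.
have := pair_nb_up (proj2 (andP kn)) low1; have := pair_nb_up (proj2 (andP jn)) low2.
rewrite !e4; move: e2; clear; lia.
Qed.

Lemma rest_card : (\sum_(k <= z < K | rest z) 1 = d - 3)%N.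
Proof.
have : (\sum_(k <= z < K) 1 = d.-1)%N by rewrite sum_nat_const_nat muln1 Kk.
rewrite (@sum_split2n (fun=> 1%N) k K k j2 kK jK kj); clear -d4; lia.
Qed.

(** At each member of the pair the upward flow is the downward flow plus at most [del], and the two
    downward flows are part of the flux through [k]. Both members have d - 1 upper edges, so
    measuring from their mean makes their own entries cancel. *)
Lemma pair_fluxin (yb := (x k + x j2) / 2) :
  \sum_(k <= j < n) (mu j)%:R * (x j - yb) <= 2 * (d%:R - 2) + 2 * del.
Proof.
have fd : dn k k + dn k j2 <= flux k.
  rewrite (flux_dn rk) (@sum_split2 _ _ k n k j2 kn jn kj).
  rewrite lerDl big_nat_cond sumr_ge0 // => z /andP[/andP[kz _] _].
  exact: (dn_ge0 rk).
have := kirchE k (leq_trans kKw Knw); have := kirchE j2 (leq_trans kKw Knw).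
rewrite !(up_shift yb) (pair_nb_up (proj2 (andP kn)) low1).
rewrite (pair_nb_up (proj2 (andP jn)) low2) => e1 e2.
under eq_bigr do rewrite natrD mulrDl.
have yE : x j2 - yb = - (x k - yb) by rewrite /yb; lra.
rewrite big_split /=; rewrite yE in e1; move: kir1 kir2 fluxk => h1 h2 h3.
lra.
Qed.

(** The flow out of the pair is added to the flux through [K]. Each other vertex of the window
    contributes through [term_rest], and [pair_count] counts the edges from the pair into the rest
    of the window. *)
Lemma pair_bound :
  (d%:R - 1) * (x K + x K.+1 - (x k + x j2)) <=
  4 * (d%:R - 2) + 2 * (x K.+1 - x K) + 2 * del.
Proof.
set yb := (x k + x j2) / 2.
pose w j := x j - yb.
have wm : {homo w : i j / (i <= j)%N >-> i <= j} by move=> i j ij; rewrite lerD2r xle.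
have wj20 : 0 <= w j2.
  have := @xle k j2 (proj1 (andP jK)); rewrite /w /yb; lra.
have wk : w k = - w j2 by rewrite /w /yb; lra.
have wK : w j2 <= w K by apply: wm; apply: ltnW; case/andP: jK.
have w01 : w K <= w K.+1 by apply: wm.
have w0 : 0 <= w K by apply: le_trans wK.
have f1 := pair_far kK low1; have f2 := pair_far jK low2.
have F1 := sum_top_far (z := k) wm w0 f1.
have F2 := sum_top_far (z := j2) wm w0 f2.
have fluxlo : \sum_(k <= z < K) up K z <= 2 * (d%:R - 2).
  exact: le_trans (flux_ge_up rk kKw) fluxK.
have fin2 : \sum_(k <= j < n) (mu j)%:R * w j <= 2 * (d%:R - 2) + 2 * del.
  exact: pair_fluxin.
have split1 : \sum_(k <= j < n) (mu j)%:R * w j =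
   \sum_(k <= z < K | rest z) (mu z)%:R * w z
   + (\sum_(K <= j < n) (A k j)%:R * w j + \sum_(K <= j < n) (A j2 j)%:R * w j).
  rewrite (@big_cat_nat _ _ _ K) //=; congr (_ + _).
    rewrite (@sum_split2 _ _ k K k j2 kK jK kj).
    by rewrite !Airr [A j2 k]Asym add0n addn0 wk mulrN addNr add0r.
  by rewrite -big_split /=; apply: eq_bigr => j _; rewrite natrD mulrDl.
rewrite split1 in fin2.
have upw a z : up a z = \sum_(a <= j < n) (A z j)%:R * w j - (nb a n z)%:R * w z.
  exact: up_shift.
rewrite (@sum_split2 _ _ k K k j2 kK jK kj) !upw wk in fluxlo.
have cnt := pair_count.
have main : \sum_(k <= z < K | rest z) (w K - w K.+1 + (mu z)%:R * w K.+1)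
   <= \sum_(k <= z < K | rest z) ((mu z)%:R * w z + up K z).
  rewrite big_nat_cond [leRHS]big_nat_cond; apply: ler_sum => z /andP[zK rz].
  have := term_rest yb zK rz; rewrite /w; lra.
have mainL : \sum_(k <= z < K | rest z) (w K - w K.+1 + (mu z)%:R * w K.+1)
   = (d%:R - 3) * (w K - w K.+1) + (\sum_(k <= z < K | rest z) mu z)%:R * w K.+1.
  rewrite natr_sum mulr_suml.
  have -> : (d%:R - 3) * (w K - w K.+1) = \sum_(k <= z < K | rest z) (w K - w K.+1).
    rewrite -[3]/(3%:R) -natrB; last exact: ltnW.
    by rewrite -rest_card natr_sum mulr_suml; apply: eq_bigr => z _; rewrite mul1r.
  by rewrite -big_split.
rewrite mainL [leRHS]big_split /= in main.
move: (\sum_(k <= z < K | rest z) mu z)%N cnt main => S cnt main.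
move: (nb K n k) (nb K n j2) f1 f2 F1 F2 fluxlo cnt => g1 g2 f1 f2 F1 F2 fluxlo cnt.
set E := (A k j2 : nat) in cnt.
have cntR : S%:R = 2 * (d%:R - 1) - 2 * E%:R - g1%:R - g2%:R :> R.
  have -> : d%:R - 1 = d.-1%:R :> R.
    by rewrite -[1]/(1%:R) -natrB ?subn1 //; clear -d4; lia.
  have : (S + 2 * E + g1 + g2)%N%:R = (2 * d.-1)%N%:R :> R by rewrite cnt.
  rewrite !natrD; lra.
have E1 : 0 <= (E%:R : R) <= 1 by rewrite ler0n lern1 leq_b1.
have g1R : 1 <= g1%:R :> R by rewrite ler1n.
have g2R : 1 <= g2%:R :> R by rewrite ler1n.
rewrite cntR in main.
have wd : x K + x K.+1 - (x k + x j2) = w K + w K.+1 by rewrite /w /yb; lra.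
rewrite wd; have -> : x K.+1 - x K = w K.+1 - w K by rewrite /w; ring.
move: (\sum_(k <= i < K | rest i) _) main fin2 fluxlo => T2.
move: (\sum_(k <= i < K | rest i) _) => T3.
move: (\sum_(K <= j < n) _) F1 => P1 F1; move: (\sum_(K <= j < n) _) F2 => P2 F2.
move: (w K) (w K.+1) (w j2) wj20 wK w01 w0 F1 F2 => wk0 wk1 wj wj20 wK w01 w0 F1 F2.
move: (E%:R : R) (g1%:R : R) (g2%:R : R) E1 g1R g2R F1 F2 => E' g1' g2' E1 g1R g2R F1 F2.
have p1 : 0 <= (g2' - 1) * (wk0 - wj) by rewrite mulr_ge0 // subr_ge0.
have p2 : 0 <= (g1' + g2' - 2 * E') * (wk1 - wk0) by rewrite mulr_ge0 ?subr_ge0 //; lra.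
have p3 : 0 <= (1 - E') * wk0 by rewrite mulr_ge0 ?subr_ge0 //; lra.
have p4 : 0 <= (g1' - 1) * wk0 by rewrite mulr_ge0 ?subr_ge0 //; lra.
have p5 : 0 <= (g1' - 1) * wj by rewrite mulr_ge0 ?subr_ge0 //; lra.
move=> main fin2 fluxlo.
lra.
Qed.

End Pair.

(** * Weighing the two cuts that bound a window *)

Section Windows.
Variables (R : realFieldType) (n : nat) (A : rel nat) (x : nat -> R).
Hypothesis rk : ranked n A x.

Local Notation nb := (nbrs A).
Local Notation up := (upsum n A x).
Local Notation flux := (cutflux n A x).

Let Alt : forall i j, A i j -> (j < n)%N. Proof. by case: rk. Qed.
Let xle := xle rk.

Lemma up_ge_last m K z : (z <= K)%N -> (m < nb K n z)%N ->
  x (K + m)%N - x z <= up K z.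
Proof.
move=> zK hm; apply: le_trans (up_ge rk zK hm).
rewrite big_nat_recr //= lerDr big_nat sumr_ge0 // => t _.
by rewrite subr_ge0 xle // (leq_trans zK) // leq_addr.
Qed.

Lemma up_ge_nbr m K z j : (z <= K)%N -> (K <= j)%N -> A z j -> (m < nb K n z)%N ->
  \sum_(0 <= t < m) (x (K + t)%N - x z) + (x j - x z) <= up K z.
Proof.
move=> zK Kj zj hm; have jn := Alt zj.
have jin : j \in index_iota K n by rewrite mem_index_iota Kj jn.
pose P i := A z i && (i != j).
have -> : up K z = \sum_(K <= i < n) (P i)%:R * (x i - x z) + (x j - x z).
  rewrite /upsum !(bigD1_seq j) ?iota_uniq //= zj /P eqxx andbF mul0r mul1r add0r addrC.
  by congr (_ + _); apply: eq_bigr => i /negPf ->; rewrite andbT.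
rewrite lerD2r; apply: (@sum_top_le _ P (fun j => x j - x z)).
- by move=> i i' ii'; rewrite lerD2r xle.
- by rewrite subr_ge0 xle.
move: hm; rewrite /nbrs !(bigD1_seq j) ?iota_uniq //= zj /P eqxx andbF add1n add0n ltnS.
by move=> h; apply: leq_trans h _; apply: leq_sum => i ->; rewrite andbT.
Qed.

(** The flux behind [k] gets weight r + 1 and the flux at [K] weight 1. With [B z = 1] and
    [p z = 0], a vertex sends at least r + 1 edges past [K]; the two contributions then add up to r
    + 1 times the whole rise, whatever the position of [z]. In the applications [p] counts the edges
    that jump over [k], and the subtracted sum pays for them. Windows of length d allow r = 0,
    windows of length d - 1 allow r = 1. *)
Lemma window_bound (r k K : nat) (B p : nat -> nat) (F1 F2 : R) :
  (r <= 1)%N -> (k < K)%N -> (K <= n)%N ->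
  (forall z, (k < z < K)%N -> (p z <= B z <= (p z).+1)%N) ->
  (forall z, (k < z < K)%N -> (2 + r <= nb K n z + B z)%N) ->
  \sum_(k.+1 <= z < n) (B z)%:R * (x z - x k) <= F1 -> flux K <= F2 ->
  ((r.+1)%:R * (\sum_(k.+1 <= z < n) B z)%N%:R - (r.+2)%:R * (\sum_(k.+1 <= z < K) p z)%N%:R)
    * (x K - x k) <= (r.+1)%:R * F1 + F2.
Proof.
move=> r1 kK Kn pB far h1 h2.
have h2' : \sum_(k.+1 <= z < K) up K z <= F2 by apply: le_trans (flux_ge_up rk _) h2.
apply: le_trans (lerD (ler_wpM2l (ler0n _ _) h1) h2').
rewrite !(@big_cat_nat _ _ _ K k.+1 n) //= natrD !natr_sum.
have VK : 0 <= x K - x k by rewrite subr_ge0 xle // ltnW.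
have tail : (\sum_(K <= i < n) (B i)%:R) * (x K - x k) <=
   \sum_(K <= z < n) (B z)%:R * (x z - x k).
  rewrite mulr_suml big_nat [leRHS]big_nat; apply: ler_sum => z /andP[Kz _].
  by rewrite ler_wpM2l // lerD2r xle.
have mid : (r.+1)%:R * (\sum_(k.+1 <= i < K) (B i)%:R) * (x K - x k)
    - (r.+2)%:R * (\sum_(k.+1 <= i < K) (p i)%:R) * (x K - x k)
  <= (r.+1)%:R * (\sum_(k.+1 <= z < K) (B z)%:R * (x z - x k)) + \sum_(k.+1 <= z < K) up K z.
  rewrite -!mulrA !mulr_suml !mulr_sumr -sumrB -big_split /= [leLHS]big_nat [leRHS]big_nat.
  apply: ler_sum => z zK /=.
  have far' := far z zK; have pB' := pB z zK.
  have zK' : (z <= K)%N by clear -zK; lia.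
  have kz : (k <= z)%N by clear -zK; lia.
  have a1 : x k <= x z by apply: xle.
  have a2 : x z <= x K by apply: xle.
  have upz := up_ge_nb rk zK'.
  move: (B z) (p z) pB' far' => b q pB' far'.
  have u0 : 0 <= up K z := up_ge0 rk zK'.
  have [b3|b3] := leqP b (r.+1); last first.
    have : ((r.+1 * b)%N <= (r.+2 * q)%N)%N by clear -r1 b3 pB'; nia.
    rewrite -(ler_nat R) !natrM => c.
    have p1 : 0 <= (r.+1)%:R * b%:R * (x z - x k) by rewrite !mulr_ge0 // subr_ge0.
    have p2 : 0 <= ((r.+2)%:R * q%:R - (r.+1)%:R * b%:R) * (x K - x k).
      by rewrite mulr_ge0 // subr_ge0.
    lra.
  have fb : ((2 + r - b)%N <= nb K n z)%N by clear -far'; lia.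
  have upz' : ((2 + r - b)%N)%:R * (x K - x z) <= up K z.
    by apply: le_trans upz; rewrite ler_wpM2r ?subr_ge0 // ler_nat.
  have qe : q%:R <= b%:R :> R by rewrite ler_nat; case/andP: pB'.
  case: r r1 b3 far fb upz' pB' far' => [|[|//]] _ b3 _ _ upz' pB' _.
    case: b b3 upz' pB' qe => [|[|//]] _ upz' pB' qe.
      have : 0 <= q%:R * (x K - x k) by rewrite mulr_ge0.
      move: u0; rewrite mul0r mulr0; lra.
    have : 0 <= q%:R * (x K - x k) by rewrite mulr_ge0.
    move: upz'; rewrite (_ : 2 + 0 - 1 = 1)%N //; lra.
  case: b b3 upz' pB' qe => [|[|[|//]]] _ upz' pB' qe.
  - have : 0 <= q%:R * (x K - x k) by rewrite mulr_ge0.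
    move: u0; rewrite mul0r mulr0; lra.
  - have : 0 <= q%:R * (x K - x k) by rewrite mulr_ge0.
    move: upz'; rewrite (_ : 2 + 1 - 1 = 2)%N //; lra.
  - have q1 : 0 <= q%:R - 1 :> R by rewrite subr_ge0 ler1n; clear -pB'; lia.
    have : 0 <= (q%:R - 1) * (x K - x k) by rewrite mulr_ge0.
    move: upz'; rewrite (_ : 2 + 1 - 2 = 1)%N //; lra.
have := ler_wpM2l (ler0n R r.+1) tail; move: mid.
move: (\sum_(k.+1 <= z < K) up K z) => S1.
move: (\sum_(k.+1 <= z < K) (B z)%:R * (x z - x k)) => S2.
move: (\sum_(K <= z < n) (B z)%:R * (x z - x k)) => S3.
move: (\sum_(k.+1 <= i < K) (B i)%:R) (\sum_(K <= i < n) (B i)%:R) => S4 S5.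
move: (\sum_(k.+1 <= i < K) (p i)%:R) (r.+1%:R) (r.+2%:R) => S6 r1' r2' mid tl.
lra.
Qed.

End Windows.

(** * Minimum degree at least d *)

Lemma sum_ge2 (f : nat -> nat) (a b i j : nat) :
  (a <= i < b)%N -> (a <= j < b)%N -> i != j -> (f i + f j <= \sum_(a <= z < b) f z)%N.
Proof. by move=> hi hj hij; rewrite (sum_split2n f hi hj hij) leq_addr. Qed.

Lemma sum_ge1 (f : nat -> nat) (a b i : nat) :
  (a <= i < b)%N -> (f i <= \sum_(a <= z < b) f z)%N.
Proof. by move=> hi; rewrite (bigD1_seq i) ?mem_index_iota ?iota_uniq //= leq_addr. Qed.

(* Exactly what makes every path from below [k] to [k'] or above use at least three edges. *)
Definition good (A : rel nat) (k k' : nat) : Prop :=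
  (forall u v, (u < k)%N -> (k' <= v)%N -> ~~ A u v) /\
  (forall u y x' w, (u < k)%N -> (k <= y < k')%N -> (k <= x' < k')%N -> (k' <= w)%N ->
     A u y -> A x' w -> (y != x') && ~~ A y x').

Section MinDegree.
Variables (R : realFieldType) (n : nat) (A : rel nat) (x : nat -> R).
Hypothesis rk : ranked n A x.

Local Notation nb := (nbrs A).
Local Notation flux := (cutflux n A x).
Local Notation ecut := (cutsize n A).

Let Airr : irreflexive A. Proof. by case: rk. Qed.
Let xle := xle rk.

Variables (d : nat).
Hypothesis d3 : (3 <= d)%N.
Hypothesis degd : forall z, (z < n)%N -> (d <= nb 0 n z)%N.
Hypothesis conn : forall k, (0 < k < n)%N -> (0 < ecut k)%N.

Local Notation c := (d%:R - 1 : R).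

Lemma nb_self_split k : (k < n)%N -> nb 0 n k = (nb 0 k k + nb k.+1 n k)%N.
Proof.
move=> kn; rewrite (@nb_cat A k 0 n) //; last exact: ltnW.
by rewrite (nb_recl _ _ kn) Airr.
Qed.

Lemma sum_nbS k : (\sum_(k.+1 <= z < n) nb 0 k.+1 z = ecut k.+1)%N.
Proof. by rewrite (ecut_dn rk). Qed.

(** A small cut at [k] forces a large one behind it: rank [k] exchanges its lower edges for enough
    upper ones to reach degree d, and both its lower edges and those jumping over it belong to the
    small cut. This is the count [EP]. *)
Lemma window_D k : (k + d < n)%N -> (ecut k <= d)%N ->
  flux k.+1 <= c -> flux (k + d) <= c ->
  (d%:R - (ecut k)%:R) * (x (k + d)%N - x k) <= 2 * c.
Proof.
move=> kdn ed f1 f2.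
have kn : (k < n)%N by clear -kdn; lia.
have kK : (k < k + d)%N by clear -d3; lia.
have h1 : \sum_(k.+1 <= z < n) (nb 0 k.+1 z)%:R * (x z - x k) <= c.
  by apply: le_trans f1; apply: (flux_ge_nb rk).
set E := ecut k.+1; set P := (\sum_(k.+1 <= z < k + d) nb 0 k z)%N.
have EP : (d + 2 * P <= E + ecut k)%N.
  have e1 := ecutS rk kn; have e2 := nb_self_split kn; have e3 := degd kn.
  have e4 : (nb 0 k k + P <= ecut k)%N.
    rewrite (ecut_dn rk) big_ltn // leq_add2l /P (@big_cat_nat _ _ _ (k + d)%N k.+1 n) //=; last exact: ltnW.
    by rewrite leq_addr.
  by rewrite /E; clear -e1 e2 e3 e4; lia.
have hp z : (k < z < k + d)%N -> (nb 0 k z <= nb 0 k.+1 z <= (nb 0 k z).+1)%N.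
  by move=> _; rewrite nb_recr //; clear; case: (A z k); lia.
have hf z : (k < z < k + d)%N -> (2 + 0 <= nb (k + d) n z + nb 0 k.+1 z)%N.
  move=> zr; have zn : (z < n)%N by clear -zr kdn; lia.
  have e1 := degd zn.
  have e2 : (nb 0 n z = nb 0 k.+1 z + nb k.+1 (k + d) z + nb (k + d) n z)%N.
    rewrite -!nb_cat //; try (clear -kdn; lia); clear -kK; lia.
  have e3 := @nb_le_self _ _ _ _ rk k.+1 (k + d) z zr.
  rewrite addn0; clear -e1 e2 e3 d3; lia.
have W := window_bound rk (r := 0) isT kK (ltnW kdn) hp hf h1 f2.
rewrite sum_nbS -/E -/P in W.
have EPR : d%:R - (ecut k)%:R <= E%:R - 2 * P%:R :> R.
  by have := EP; rewrite -(ler_nat R) !natrD; lra.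
have V0 : 0 <= x (k + d)%N - x k by rewrite subr_ge0 xle // leq_addr.
have := ler_wpM2r V0 EPR; lra.
Qed.

(** The step into rank [k], at most [c] divided by the cut size, is added to [window_D]. A single
    edge lets d + 1 ranks gain d + 1, exactly the critical rate; every size from 2 to d - 2 loses at
    least one half. *)
Lemma dip_D k : (0 < k)%N -> (k + d < n)%N -> (ecut k <= d - 2)%N ->
  flux k <= c -> flux k.+1 <= c -> flux (k + d) <= c ->
  x (k + d)%N - x k.-1 <= d%:R + (if ecut k == 1%N then 1 else 1 / 2).
Proof.
move=> k0 kdn e2 f0 f1 f2.
have e1 : (0 < ecut k)%N by apply: conn; clear -k0 kdn; lia.
have W := window_D kdn (leq_trans e2 (leq_subr _ _)) f1 f2.
have G := le_trans (ecut_gap rk k) f0.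
case: eqVneq => [ek|ek].
  rewrite ek in W G; have d3R : 3 <= d%:R :> R by rewrite (ler_nat _ 3).
  have : (x (k + d)%N - x k) <= 2.
    rewrite -(@ler_pM2l _ (d%:R - 1)); last lra.
    lra.
  lra.
have e2' : (2 <= ecut k)%N by clear -e1 ek; case: (ecut k) e1 ek => [|[]].
have d4 : (4 <= d)%N by clear -e2 e2'; lia.
have d4R : 4 <= d%:R :> R by rewrite (ler_nat _ 4).
have eR : 2 <= (ecut k)%:R :> R by rewrite (ler_nat _ 2).
have eR2 : (ecut k)%:R <= d%:R - 2 :> R.
  have : (ecut k + 2 <= d)%N by clear -e2 d4; lia.
  by rewrite -(ler_nat R) natrD; lra.
move: (ecut k)%:R eR eR2 W G => e eR eR2 W G.
set u := x k - x k.-1 in G *; set v := x (k + d)%N - x k in W *.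
have -> : x (k + d)%N - x k.-1 = u + v by rewrite /u /v; ring.
(* The bound c / e + 2c / (d - e) is convex in e, so its extreme values on [2, d - 2] are at the
   ends; this product expresses that. *)
have p1 : 0 <= (e - 2) * (d%:R - 2 - e) by rewrite mulr_ge0 ?subr_ge0 //; lra.
have p2 : (d%:R - e) * (e * u) <= (d%:R - e) * c by rewrite ler_wpM2l //; lra.
have p3 : e * ((d%:R - e) * v) <= e * (2 * c) by rewrite ler_wpM2l //; lra.
have ed : 0 < e * (d%:R - e) by rewrite mulr_gt0 //; lra.
rewrite -(@ler_pM2l _ (e * (d%:R - e))) //.
have p4 : 0 <= (d%:R + 1/2) * ((e - 2) * (d%:R - 2 - e)) by rewrite mulr_ge0 ?subr_ge0 //; lra.
have p5 : 0 <= c * (d%:R - 2 - e) by rewrite mulr_ge0 ?subr_ge0 //; lra.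
lra.
Qed.

End MinDegree.

(** * Places without slack in minimum degree d *)

Section MinDegreeLocal.
Variables (R : realFieldType) (n : nat) (A : rel nat) (x : nat -> R).
Hypothesis rk : ranked n A x.

Local Notation nb := (nbrs A).
Local Notation up := (upsum n A x).
Local Notation flux := (cutflux n A x).
Local Notation ecut := (cutsize n A).

Let Asym : symmetric A. Proof. by case: rk. Qed.
Let Airr : irreflexive A. Proof. by case: rk. Qed.
Let Alt : forall i j, A i j -> (j < n)%N. Proof. by case: rk. Qed.
Let xle := xle rk.

Variables (d : nat).
Hypothesis d3 : (3 <= d)%N.
Hypothesis degd : forall z, (z < n)%N -> (d <= nb 0 n z)%N.
Hypothesis conn : forall k, (0 < k < n)%N -> (0 < ecut k)%N.

Local Notation c := (d%:R - 1 : R).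

Lemma low_unique k z y : ecut k = 1%N -> (k <= z < n)%N -> (k <= y < n)%N ->
  (0 < nb 0 k z)%N -> (0 < nb 0 k y)%N -> y = z.
Proof.
move=> ek hz hy lz ly; apply/eqP; apply: contraT => yz.
have := sum_ge2 (nb 0 k) hy hz yz; rewrite -(ecut_dn rk) ek; clear -lz ly; lia.
Qed.

Lemma up_unique k z y : ecut k = 1%N -> (z < k)%N -> (y < k)%N ->
  (0 < nb k n z)%N -> (0 < nb k n y)%N -> y = z.
Proof.
move=> ek hz hy lz ly; apply/eqP; apply: contraT => yz.
have := @sum_ge2 (nb k n) 0 k y z hy hz yz; rewrite -/(ecut k) ek; clear -lz ly; lia.
Qed.

(** Two non-adjacent vertices of the window each have at most d - 1 neighbours inside, so each needs
    an edge leaving it. Only one edge leaves below and one above; hence the two vertices are exactly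
    the entry and the exit, and they are not adjacent. *)
Lemma good_or_complete k k' : (k' = k + d.+1)%N -> (k' <= n)%N ->
  ecut k = 1%N -> ecut k' = 1%N ->
  good A k k' \/
  (forall z z', (k <= z < k')%N -> (k <= z' < k')%N -> z != z' -> A z z').
Proof.
move=> k'E k'n ek ek'.
have kk' : (k <= k')%N by rewrite k'E leq_addr.
have [/allP h|/allPn[z zW /allPn[z' z'W]]] := boolP (all (fun z => all (fun z' =>
   (z != z') ==> A z z') (index_iota k k')) (index_iota k k')).
  right=> z z' hz hz'; have := h z; rewrite mem_index_iota hz => /(_ isT) /allP /(_ z').
  by rewrite mem_index_iota hz' => /(_ isT) /implyP.
rewrite negb_imply => /andP[zz' nA]; left.
rewrite mem_index_iota in zW; rewrite mem_index_iota in z'W.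
have ext u v : (k <= u < k')%N -> (k <= v < k')%N -> u != v -> ~~ A u v ->
    (0 < nb 0 k u + nb k' n u)%N.
  move=> hu hv uv nAuv.
  have un : (u < n)%N by clear -hu k'n; lia.
  have e1 := degd un.
  rewrite (@nb_cat A k' 0 n) // (@nb_cat A k 0 k') // in e1.
  have e2 : (nb k k' u <= d.-1)%N.
    rewrite /nbrs (sum_split2n _ hu hv uv) Airr (negPf nAuv) !add0n.
    have := sum_split2n (fun=> 1%N) hu hv uv; rewrite sum_nat_const_nat muln1 => e.
    apply: (@leq_trans (\sum_(k <= i < k' | (i != u) && (i != v)) 1)).
      by apply: leq_sum => i _; exact: leq_b1.
    by clear -e k'E; lia.
  by clear -e1 e2 d3; lia.
have Lk := ecut_dn rk k; rewrite ek in Lk.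
wlog lz : z z' zW z'W zz' nA / (0 < nb 0 k z)%N.
  move=> wl; have ez := ext z z' zW z'W zz' nA.
  have ez' : (0 < nb 0 k z' + nb k' n z')%N by apply: (ext z' z); rewrite // ?[A z' z]Asym // eq_sym.
  have [lz|lz] := posnP (nb 0 k z); last exact: (wl z z').
  apply: (wl z' z) => //; rewrite ?[A z' z]Asym // 1?eq_sym //.
  have [lz'|//] := posnP (nb 0 k z'); rewrite lz in ez; rewrite lz' in ez'.
  have := @up_unique k' z z' ek' _ _ ez ez' => e; move: zz'.
  by rewrite e ?eqxx; case/andP: zW; case/andP: z'W.
have zn : (k <= z < n)%N by clear -zW k'n; lia.
have z'n : (k <= z' < n)%N by clear -z'W k'n; lia.
have lz' : nb 0 k z' = 0%N.
  apply/eqP; rewrite -leqn0 leqNgt; apply/negP => h; move: zz'.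
  by rewrite (low_unique ek zn z'n lz h) eqxx.
have uz' : (0 < nb k' n z')%N.
  by have := ext z' z z'W zW; rewrite lz' eq_sym Asym; apply.
split=> [u v uk k'v|u y x' w uk yW x'W k'w Auy Ax'w].
  apply/negP => Auv; have vn := Alt Auv.
  have : (0 < nb 0 k v)%N by apply: (@le_nb _ 0 k v u) => //; rewrite Asym.
  move=> h; have := low_unique ek zn _ lz h.
  rewrite vn (leq_trans kk' k'v) => /(_ isT) e; move: k'v; rewrite e.
  by clear -zW; lia.
have -> : y = z.
  apply: (low_unique ek zn _ lz); first by clear -yW k'n; lia.
  by apply: (@le_nb _ 0 k y u) => //; rewrite Asym.
have -> : x' = z'.
  apply: (up_unique ek' _ _ uz'); first by case/andP: z'W.
    by case/andP: x'W.
  by apply: (@le_nb _ k' n x' w) => //; rewrite k'w (Alt Ax'w).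
by rewrite zz' nA.
Qed.

(** Each interior vertex is joined to both ends and carries the whole rise, split between the fluxes
    at [k.+1] and [k + d]; the edge joining the ends counts in both. The rise stays below 2 by 4 /
    (d + 1), which a place without slack does not allow. *)
Lemma complete_bound k : (k + d < n)%N ->
  (forall z z', (k <= z < k + d.+1)%N -> (k <= z' < k + d.+1)%N -> z != z' -> A z z') ->
  flux k.+1 <= c -> flux (k + d) <= c ->
  (d%:R + 1) * (x (k + d)%N - x k) <= 2 * c.
Proof.
move=> kdn cpl f1 f2.
have kd : (k < k + d)%N by clear -d3; lia.
have h1 : \sum_(k.+1 <= z < k + d) (x z - x k) + (x (k + d)%N - x k) <= c.
  apply: le_trans f1.
  have := @flux_ge_up _ _ _ _ rk k k.+1 (leqnSn k); rewrite big_nat1; apply: le_trans.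
  rewrite -big_nat_recr //= /upsum (@big_cat_nat _ _ _ (k + d).+1 k.+1 n) //=; last exact: ltnW.
  rewrite -[leLHS]addr0 lerD //.
    rewrite big_nat [leRHS]big_nat; apply: ler_sum => z zr.
    by rewrite cpl ?mul1r //; clear -zr; lia.
  rewrite big_nat sumr_ge0 // => z /andP[zr _]; rewrite mulr_ge0 // subr_ge0 xle //.
  by clear -zr; lia.
have h2 : (x (k + d)%N - x k) + \sum_(k.+1 <= z < k + d) (x (k + d)%N - x z) <= c.
  apply: le_trans f2; have := flux_ge_up rk (ltnW kd); apply: le_trans.
  have -> : x (k + d)%N - x k + \sum_(k.+1 <= z < k + d) (x (k + d)%N - x z)
    = \sum_(k <= z < k + d) (x (k + d)%N - x z) by rewrite [RHS]big_ltn.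
  rewrite big_nat [leRHS]big_nat.
  apply: ler_sum => z zr; have zK : (z <= k + d)%N by clear -zr; lia.
  rewrite -{1}[(k + d)%N]addn0; apply: (up_ge_last rk) zK _.
  apply: (@le_nb _ _ _ _ (k + d)%N); first by rewrite leqnn.
  by rewrite cpl //; clear -zr; lia.
have : \sum_(k.+1 <= z < k + d) (x z - x k) + \sum_(k.+1 <= z < k + d) (x (k + d)%N - x z)
   = (d%:R - 1) * (x (k + d)%N - x k).
  rewrite -big_split /= (eq_bigr (fun=> x (k + d)%N - x k)); last by move=> z _; ring.
  rewrite sumr_const_nat (_ : k + d - k.+1 = d.-1)%N; last by clear -d3; lia.
  rewrite -[LHS]mulr_natl; congr (_ * _).
  by rewrite -[1]/(1%:R) -natrB ?subn1 //; clear -d3; lia.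
move: h1 h2; move: (\sum_(k.+1 <= z < k + d) (x z - x k)) (\sum_(k.+1 <= z < k + d) (x (k + d)%N - x z)) => S1 S2 h1 h2 e.
lra.
Qed.

Variables (kap : R).
Hypothesis kap0 : 0 < kap.
Hypothesis kapd : d%:R ^+ 2 * kap <= 1 / 8.

Let d3R : 3 <= d%:R :> R. Proof. by rewrite (ler_nat _ 3). Qed.
Let kapd1 : d%:R * kap <= 1 / 24.
Proof.
rewrite -(@ler_pM2l _ 3) //.
have : 0 <= (d%:R - 3) * (d%:R * kap) by rewrite !mulr_ge0 ?subr_ge0 // ltW.
move: kapd; rewrite expr2; lra.
Qed.

Definition stuckD (b S : nat) := forall s, (0 < s <= S)%N -> x b + s%:R - kap < x (b + s)%N.

(* [lra] slows down in large contexts: [lin] keeps only the hypotheses moved to the goal. *)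
Ltac lin := clear -rk Asym Airr Alt xle d3 degd conn kap0 kapd d3R kapd1 R n A x d kap; lra.

(** [dip_D] excludes the sizes from 2 to d - 2. In a larger cut an edge ending at [b.+1] costs about
    1 and any other about 2, so a flux of d - 1 forces exactly d - 1 edges, all ending at [b.+1].
    This second shape is the late start. *)
Lemma stuck_cut b S : (d + 3 <= S)%N -> stuckD b S -> (b + d + 3 < n)%N ->
  (forall k, (b < k <= b + d + 3)%N -> flux k <= c) ->
  ecut b.+1 = 1%N \/
  [/\ ecut b.+1 = d.-1, nb 0 b.+1 b.+1 = d.-1, ecut b.+2 = 1%N & x b.+1 <= x b + 1].
Proof.
move=> dS st bn fl; have D3 := d3R.
have [el|eg] := leqP (ecut b.+1) (d - 2).
  left; have := @dip_D _ _ _ _ rk _ d3 degd conn b.+1 isT _ el.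
  rewrite /= => D; have {}D := D ltac:(clear -bn; lia) (fl b.+1 ltac:(clear -d3; lia))
     (fl b.+2 ltac:(clear -d3; lia)) (fl (b.+1 + d)%N ltac:(clear -d3; lia)).
  move: D; case: eqVneq => // _ D; exfalso; move: D.
  have := st d.+1 ltac:(clear -dS; lia); rewrite addnS -natr1 addSn.
  have := kapd1; have := ler_wpM2r (ltW kap0) d3R; lra.
right.
have nk : (b.+1 < n)%N by clear -bn; lia.
have s1 := st 1%N ltac:(clear -dS; lia); rewrite addn1 in s1.
have s2 := st 2%N ltac:(clear -dS; lia); rewrite addn2 in s2.
have fk := fl b.+1 ltac:(clear; lia).
set e := ecut b.+1 in eg *; set a := nb 0 b.+1 b.+1.
have ea : (a + \sum_(b.+2 <= z < n) nb 0 b.+1 z = e)%N.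
  by rewrite /e (ecut_dn rk) [in RHS]big_ltn.
have lo : a%:R * (x b.+1 - x b) + (\sum_(b.+2 <= z < n) nb 0 b.+1 z)%N%:R * (x b.+2 - x b) <= c.
  apply: le_trans fk; apply: le_trans (flux_ge_nb rk _); rewrite [leRHS]big_ltn //= lerD2l.
  rewrite natr_sum mulr_suml [leLHS]big_nat [leRHS]big_nat; apply: ler_sum => z zr.
  by rewrite ler_wpM2l // lerD2r xle //; case/andP: zr.
move: (\sum_(b.+2 <= z < n) nb 0 b.+1 z)%N ea lo => q ea lo.
have eaR : a%:R + q%:R = e%:R :> R by rewrite -natrD ea.
have k3 := ler_wpM2r (ltW kap0) d3R.
have egR : d%:R - 1 <= e%:R :> R.
  have : (d <= e + 1)%N by clear -eg d3; lia.
  by rewrite -(ler_nat R) natrD; lra.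
have q0 : 0 <= q%:R :> R by []. have a0 : 0 <= a%:R :> R by [].
have p1 : 0 <= a%:R * (x b.+1 - x b - (1 - kap)) by rewrite mulr_ge0 ?subr_ge0 //; lra.
have p2 : 0 <= q%:R * (x b.+2 - x b - (2 - kap)) by rewrite mulr_ge0 ?subr_ge0 //; lra.
have tot : e%:R * (1 - kap) + q%:R <= c by rewrite -eaR; lra.
have k1 := kapd1.
have p3 : 0 <= (e%:R - (d%:R - 1)) * (1 - kap) by rewrite mulr_ge0 ?subr_ge0 //; lra.
have qlt : q%:R < 1 :> R.
  have h : q%:R <= d%:R * kap - kap by lra.
  have := kap0; lra.
have qz : q = 0%N by apply/eqP; rewrite -leqn0 -ltnS -(ltr_nat R).
have elt : e%:R < d%:R :> R.
  rewrite ltNge; apply/negP => de.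
  have k0 := kap0; have : 0 <= (e%:R - d%:R) * (1 - kap).
    by rewrite mulr_ge0 ?subr_ge0 //; move: k1 k3 D3; lin.
  by move: tot q0 k1 k0 k3 D3; lin.
have eE : e = d.-1 by move: elt; rewrite ltr_nat; clear -eg d3; lia.
have aE : a = d.-1 by rewrite -eE -ea qz addn0.
have xb1 : x b.+1 <= x b + 1.
  move: lo; rewrite qz mul0r addr0 aE.
  have -> : d.-1%:R = c :> R by rewrite -[1]/(1%:R) -natrB ?subn1 //; clear -d3; lia.
  rewrite -subr_ge0 -{1}[c]mulr1 -mulrBr pmulr_rge0; last by move: D3; lin.
  lin.
split=> //.
set u := ecut b.+2.
(* All edges of the previous cut end at [b.+1], so this vertex alone feeds the next cut. *)
have uE : u = nb b.+2 n b.+1 by have := ecutS rk nk; rewrite -/e -/a eE aE -/u; clear; lia.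
have u1 : (0 < u)%N by apply: conn; clear -bn; lia.
apply/eqP; apply: contraT => u1'.
have u2 : (2 <= u)%N by clear -u1 u1'; lia.
have [el|eg'] := leqP u (d - 2).
  have := @dip_D _ _ _ _ rk _ d3 degd conn b.+2 isT _ el.
  rewrite /= => D; have {}D := D ltac:(clear -bn; lia) (fl b.+2 ltac:(clear -d3; lia))
     (fl b.+3 ltac:(clear -d3; lia)) (fl (b.+2 + d)%N ltac:(clear -d3; lia)).
  exfalso; move: D; rewrite -/u (negPf u1').
  have := st d.+2 ltac:(clear -dS; lia); rewrite 2!addnS !addSn -2!natr1; lra.
have f2 : up b.+2 b.+1 <= c.
  apply: le_trans (fl b.+2 ltac:(clear -d3; lia)).
  by have := @flux_ge_up _ _ _ _ rk b.+1 b.+2 (leqnSn _); rewrite big_nat1.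
have dn2 : (d - 2 < nb b.+2 n b.+1)%N by rewrite -uE.
have := up_ge rk (leqnSn b.+1) dn2; rewrite big_nat_recl // addn0 => g.
have g2 : (d%:R - 2) * (3 - kap - 1) <= \sum_(0 <= i < d - 2) (x (b.+2 + i.+1)%N - x b.+1).
  have -> : (d%:R - 2) * (3 - kap - 1) = \sum_(0 <= i < d - 2) (3 - kap - 1).
    rewrite sumr_const_nat subn0 -[RHS]mulr_natl; congr (_ * _).
    by rewrite -[2]/(2%:R) -natrB //; clear -d3; lia.
  apply: ler_sum => i _.
  have s3 := st 3%N ltac:(clear -dS; lia); rewrite addn3 in s3.
  have := @xle b.+3 (b.+2 + i.+1)%N ltac:(clear; lia).
  lra.
have : 0 <= (d%:R - 3) * (1 - kap) by rewrite mulr_ge0 ?subr_ge0 //; lra.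
lra.
Qed.

End MinDegreeLocal.

Section MinDegreeLocal.
Variables (R : realFieldType) (n : nat) (A : rel nat) (x : nat -> R).
Hypothesis rk : ranked n A x.

Local Notation nb := (nbrs A).
Local Notation up := (upsum n A x).
Local Notation dn := (dnsum A x).
Local Notation flux := (cutflux n A x).
Local Notation ecut := (cutsize n A).

Let Asym : symmetric A. Proof. by case: rk. Qed.
Let xle := xle rk.

Variables (d : nat).
Hypothesis d3 : (3 <= d)%N.
Hypothesis degd : forall z, (z < n)%N -> (d <= nb 0 n z)%N.
Hypothesis conn : forall k, (0 < k < n)%N -> (0 < ecut k)%N.

Local Notation c := (d%:R - 1 : R).

Variables (kap : R).
Hypothesis kap0 : 0 < kap.
Hypothesis kapd : d%:R ^+ 2 * kap <= 1 / 8.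

Let d3R : 3 <= d%:R :> R. Proof. by rewrite (ler_nat _ 3). Qed.
Let kapd1 : d%:R * kap <= 1 / 24.
Proof.
rewrite -(@ler_pM2l _ 3) //.
have : 0 <= (d%:R - 3) * (d%:R * kap) by rewrite !mulr_ge0 ?subr_ge0 // ltW.
move: kapd; rewrite expr2; lra.
Qed.

Local Notation stuckD := (stuckD x kap).

Ltac lin := clear -rk Asym xle d3 degd conn kap0 kapd d3R kapd1 R n A x d kap; lra.

(** A late shape at the end of the window would lift rank [b.+3] almost to the top of the window,
    leaving only two low vertices; the edges they must send across this jump exceed the flux. *)
Lemma no_late_after_dip b S : (2 * d + 4 <= S)%N -> stuckD b S -> (b + 2 * d + 5 < n)%N ->
  (forall k, (b < k <= b + 2 * d + 5)%N -> flux k <= c) ->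
  ecut b.+1 = 1%N ->
  nb 0 (b + d).+2 (b + d).+2 = d.-1 -> False.
Proof.
move=> dS st bn fl eb low; have D3 := d3R.
have bd := @dip_D _ _ _ _ rk _ d3 degd conn b.+1 isT.
have s1 := st d.+1 ltac:(clear -dS; lia); rewrite addnS -natr1 in s1.
have s2 := st d.+2 ltac:(clear -dS; lia); rewrite 2!addnS -addn2 natrD in s2.
set q := (b + d).+2 in low s2; set b' := (b + d).+1 in s1.
have qn : (q < n)%N by rewrite /q; clear -bn; lia.
have k1 := kapd1; have k3 := ler_wpM2r (ltW kap0) d3R.
have gap : x b.+1 <= x b + c.
  have := ecut_gap rk b.+1; rewrite eb /= mul1r => h.
  have := fl b.+1 ltac:(clear; lia); lra.
have dnq : dn q q <= c.
  apply: le_trans (fl q ltac:(rewrite /q; clear; lia)).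
  have := @flux_ge_dn _ _ _ _ rk q.+1 q (leqnSn _) qn; by rewrite big_nat1.
have xb' : x b' <= x b + d%:R + 1.
  have := bd ltac:(clear -bn; lia); rewrite eb eqxx /= addSn => D.
  have {}D := D ltac:(clear -d3; lia) (fl b.+1 ltac:(clear -d3; lia)) (fl b.+2 ltac:(clear -d3; lia)) (fl (b.+1 + d)%N ltac:(clear -d3; lia)).
  by rewrite /b'; move: D; lra.
(* The d - 1 lower edges of [q] reach at least as far down as [b.+3]. All but the longest already
   cost about 1 each, because [b'] is at least that far below [q], so little flux is left for the
   longest. *)
have H : x b + d%:R + 1 - d%:R * kap <= x b.+3.
  have h := @dn_ge _ _ _ _ rk (d.-2.+1) q q (leqnn _).
  have e1 : (d.-2.+1 = d.-1)%N by clear -d3; lia.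
  rewrite e1 low leqnn -e1 in h; have {}h := h isT.
  rewrite big_nat_recr //= (_ : q - d.-2.+1 = b.+3)%N in h; last by rewrite /q; clear -d3; lia.
  have g2 : (d%:R - 2) * (x q - x b') <= \sum_(0 <= i < d.-2) (x q - x (q - i.+1)%N).
    have -> : (d%:R - 2) * (x q - x b') = \sum_(0 <= i < d.-2) (x q - x b').
      rewrite sumr_const_nat subn0 -[RHS]mulr_natl; congr (_ * _).
      by rewrite -[2]/(2%:R) -natrB ?subn2 //; clear -d3; lia.
    apply: ler_sum => i _; rewrite lerD2l lerN2 xle //; rewrite /q /b'; clear; lia.
  have : 0 <= (d%:R - 2) * (x q - x b' - (1 - kap)) by rewrite mulr_ge0 ?subr_ge0 //; move: D3 s2 xb' s1; lin.
  move: h g2; move: (\sum_(0 <= i < d.-2) _) => S1; lra.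
set p := b.+1 in gap *; set t := b.+2.
have pn : (p < n)%N by rewrite /p; clear -bn; lia.
have tn : (t < n)%N by rewrite /t; clear -bn; lia.
have pH : 2 - d%:R * kap <= x b.+3 - x p by lra.
have lowpt : (nb 0 p p + nb 0 p t <= 1)%N.
  have := @sum_ge2 (nb 0 p) p n p t; rewrite -(ecut_dn rk) eb; apply.
  - by rewrite leqnn.
  - by rewrite tn /p /t leqnSn.
  - by rewrite /p /t; clear; lia.
have cntp : (d <= nb 0 p p + A p t + nb b.+3 n p)%N.
  have := degd pn; rewrite (nb_self_split rk pn) (@nb_cat A b.+3 p.+1 n) //.
  by rewrite nb1 addnA.
have cntt : (d <= nb 0 p t + A p t + nb b.+3 n t)%N.
  have := degd tn; rewrite (nb_self_split rk tn) (@nb_cat A p 0 t) ?leqnSn //.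
  by rewrite (nb1 A p) [A t p]Asym.
have upp : up b.+3 p <= c /\ up b.+3 p + up b.+3 t <= c.
  have f3 := le_trans (@flux_ge_up _ _ _ _ rk p b.+3 ltac:(rewrite /p; clear; lia)) (fl b.+3 ltac:(clear -d3; lia)).
  rewrite big_ltn // big_ltn // big_geq // addr0 in f3.
  have := @up_ge0 _ _ _ _ rk b.+3 t (leqnSn _) => u0.
  by split=> //; move: f3 u0; lin.
have up1 := up_ge_nb rk (K := b.+3) (z := p) ltac:(rewrite /p; clear; lia).
have up2 := up_ge_nb rk (K := b.+3) (z := t) ltac:(rewrite /t; clear; lia).
have fp : (A p t)%:R * (x t - x p) + up b.+3 p <= c.
  have f2 := le_trans (@flux_ge_up _ _ _ _ rk p t (leqnSn _)) (fl t ltac:(rewrite /t; clear -d3; lia)).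
  rewrite big_nat1 in f2; apply: le_trans f2.
  by rewrite [leRHS]/upsum [leRHS]big_ltn.
have xt : x t <= x b.+3 by apply: xle.
have xp : x p <= x b.+3 by apply: xle; rewrite /p; clear; lia.
have [d4|d4] := leqP 4 d.
  have d4R : 4 <= d%:R :> R by rewrite (ler_nat _ 4).
  have aR : d%:R - 2 <= (nb b.+3 n p)%:R :> R.
    have : (d <= nb b.+3 n p + 2)%N by have := leq_b1 (A p t); clear -cntp lowpt; lia.
    by rewrite -(ler_nat R) natrD; lin.
  have p1 : 0 <= ((nb b.+3 n p)%:R - (d%:R - 2)) * (x b.+3 - x p) by rewrite mulr_ge0 ?subr_ge0.
  have p2 : 0 <= (d%:R - 2) * (x b.+3 - x p - (2 - d%:R * kap)) by rewrite mulr_ge0 ?subr_ge0 //; move: d4R; lin.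
  case: upp => upp _; move: kapd; rewrite expr2.
  have : 0 <= d%:R * kap by rewrite mulr_ge0 // ltW.
  by move: p1 p2 upp up1 k1 k3 d4R; lin.
(* For d = 3 the edges of [p] over the jump need not exceed the flux, so the case depends on whether
   [p] and [t] are adjacent, and [t] has to be counted as well. *)
have dE : d = 3%N by clear -d3 d4; lia.
have dR : d%:R = 3 :> R by rewrite dE.
suff : 1 <= 0 :> R by rewrite ler10.
rewrite dR in upp fp pH k1; case: upp => up_a up_b.
move: cntp cntt lowpt fp; rewrite dE; case: (A p t) => /= cntp cntt lowpt fp.
  have [l0|l0] := posnP (nb 0 p p).
    have c2 : 2 <= (nb b.+3 n p)%:R :> R by rewrite (ler_nat _ 2); clear -cntp l0; lia.
    have p1 : 0 <= ((nb b.+3 n p)%:R - 2) * (x b.+3 - x p) by rewrite mulr_ge0 ?subr_ge0.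
    by move: p1 up1 up_a fp xt c2 pH k1; lin.
  have c1 : 1 <= (nb b.+3 n p)%:R :> R by rewrite (ler_nat _ 1); clear -cntp lowpt; lia.
  have c2 : 2 <= (nb b.+3 n t)%:R :> R by rewrite (ler_nat _ 2); clear -cntt lowpt l0; lia.
  have p1 : 0 <= ((nb b.+3 n p)%:R - 1) * (x b.+3 - x p) by rewrite mulr_ge0 ?subr_ge0.
  have p2 : 0 <= ((nb b.+3 n t)%:R - 2) * (x b.+3 - x t) by rewrite mulr_ge0 ?subr_ge0.
  by move: p1 p2 up1 up2 up_a up_b fp xt c1 c2 pH k1; lin.
have c2 : 2 <= (nb b.+3 n p)%:R :> R by rewrite (ler_nat _ 2); clear -cntp lowpt; lia.
have p1 : 0 <= ((nb b.+3 n p)%:R - 2) * (x b.+3 - x p) by rewrite mulr_ge0 ?subr_ge0.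
by move: p1 up1 up_a c2 pH k1; lin.
Qed.

End MinDegreeLocal.

Section MinDegreeLocal.
Variables (R : realFieldType) (n : nat) (A : rel nat) (x : nat -> R).
Hypothesis rk : ranked n A x.

Local Notation nb := (nbrs A).
Local Notation flux := (cutflux n A x).
Local Notation ecut := (cutsize n A).

Let xle := xle rk.

Variables (d : nat).
Hypothesis d3 : (3 <= d)%N.
Hypothesis degd : forall z, (z < n)%N -> (d <= nb 0 n z)%N.
Hypothesis conn : forall k, (0 < k < n)%N -> (0 < ecut k)%N.

Local Notation c := (d%:R - 1 : R).

Variables (kap : R).
Hypothesis kap0 : 0 < kap.
Hypothesis kapd : d%:R ^+ 2 * kap <= 1 / 8.

Let d3R : 3 <= d%:R :> R. Proof. by rewrite (ler_nat _ 3). Qed.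
Let kapd1 : d%:R * kap <= 1 / 24.
Proof.
rewrite -(@ler_pM2l _ 3) //.
have : 0 <= (d%:R - 3) * (d%:R * kap) by rewrite !mulr_ge0 ?subr_ge0 // ltW.
move: kapd; rewrite expr2; lra.
Qed.

Local Notation stuckD := (stuckD x kap).

Lemma full_D b S : (2 * d + 4 <= S)%N -> stuckD b S -> (b + 2 * d + 5 < n)%N ->
  (forall k, (b < k <= b + 2 * d + 5)%N -> flux k <= c) ->
  ecut b.+1 = 1%N ->
  [/\ ecut (b + d).+2 = 1%N, good A b.+1 (b + d).+2 & x (b + d).+1 <= x b + d%:R + 1].
Proof.
move=> dS st bn fl eb; have D3 := d3R; have k1 := kapd1.
have xb' : x (b + d).+1 <= x b + d%:R + 1.
  have := @dip_D _ _ _ _ rk _ d3 degd conn b.+1 isT ltac:(clear -bn; lia).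
  rewrite eb eqxx /= addSn => D.
  have {}D := D ltac:(clear -d3; lia) (fl b.+1 ltac:(clear -d3; lia)) (fl b.+2 ltac:(clear -d3; lia)) (fl (b + d).+1 ltac:(clear -d3; lia)).
  by lra.
have st' : stuckD (b + d).+1 (d + 3).
  move=> s sr; have := st (d.+1 + s)%N ltac:(clear -sr dS; lia).
  rewrite natrD -natr1 addnA addnS; lra.
have eb' : ecut (b + d).+2 = 1%N.
  have [//|[_ low _ _]] := stuck_cut rk d3 degd conn kap0 kapd (leqnn _) st' ltac:(clear -bn; lia)
    (fun k hk => fl k ltac:(clear -hk; lia)).
  by case: (no_late_after_dip rk d3 degd conn kap0 kapd dS st bn fl eb low).
split=> //.
have kE : (b + d).+2 = (b.+1 + d.+1)%N by rewrite addSn addnS.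
have [//|cpl] := good_or_complete rk d3 degd kE ltac:(clear -bn; lia) eb eb'.
exfalso; rewrite kE in cpl.
have cb := @complete_bound _ _ _ _ rk _ d3 b.+1 ltac:(clear -bn; lia) cpl
  (fl b.+2 ltac:(clear -d3; lia)) (fl (b.+1 + d)%N ltac:(clear -d3; lia)).
have gap := le_trans (ecut_gap rk b.+1) (fl b.+1 ltac:(clear -d3; lia)).
rewrite eb mul1r /= addSn in gap cb.
have s1 := st d.+1 ltac:(clear -dS; lia); rewrite addnS -natr1 in s1.
have p1 : 0 <= (d%:R + 1) * (c + x b - x b.+1) by rewrite mulr_ge0 ?subr_ge0 //; lra.
have p2 : 0 <= (d%:R + 1) * (x (b + d).+1 - (x b + (d%:R + 1) - kap)) by rewrite mulr_ge0 ?subr_ge0 //; lra.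
suff : 1 <= 0 :> R by rewrite ler10.
have := kap0; have := ler_wpM2r (ltW kap0) d3R; lra.
Qed.

(** The third case is the late window, one rank longer. Both windows end at a cut of size one, so a
    late start never follows a full window. *)
Lemma local_D b S : (2 * d + 5 <= S)%N -> (b + 2 * d + 6 < n)%N ->
  (forall k, (b < k <= b + 2 * d + 6)%N -> flux k <= c) ->
  [\/ exists2 s, (0 < s <= S)%N & x (b + s)%N <= x b + s%:R - kap,
      [/\ ecut b.+1 = 1%N, ecut (b + d).+2 = 1%N, good A b.+1 (b + d).+2
        & x (b + d).+1 <= x b + d%:R + 1]
    | [/\ ecut b.+1 <> 1%N, ecut (b + d).+3 = 1%N, good A b.+2 (b + d).+3
        & x (b + d).+2 <= x b + d%:R + 2]].
Proof.
move=> dS bn fl.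
have [/hasP[s]|/hasPn st0] :=
  boolP (has (fun s => x (b + s)%N <= x b + s%:R - kap) (index_iota 1 S.+1)).
  by rewrite mem_index_iota ltnS => hs le; constructor 1; exists s.
have st : stuckD b S.
  by move=> s hs; rewrite ltNge st0 // mem_index_iota ltnS.
have fl' k : (b < k <= b + 2 * d + 5)%N -> flux k <= c.
  by move=> hk; apply: fl; clear -hk; lia.
have dS' : (2 * d + 4 <= S)%N by clear -dS; lia.
have bn' : (b + 2 * d + 5 < n)%N by clear -bn; lia.
have [eb|[eb low eb1 xb1]] := stuck_cut rk d3 degd conn kap0 kapd (b := b) (S := S)
    ltac:(clear -dS; lia) st ltac:(clear -bn; lia) (fun k hk => fl k ltac:(clear -hk; lia)).
  by have [? ? ?] := full_D dS' st bn' fl' eb; constructor 2.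
constructor 3.
have st' : stuckD b.+1 (2 * d + 4).
  move=> s hs; have := st s.+1 ltac:(clear -hs dS; lia).
  rewrite addSnnS -natr1; lra.
have [] := full_D (leqnn _) st' ltac:(clear -bn; lia) (fun k hk => fl k ltac:(clear -hk; lia)) eb1.
rewrite addSn => e1 e2 e3; split => //; last by lra.
by rewrite eb; clear -d3; lia.
Qed.

End MinDegreeLocal.

(** * Regular graphs of even degree *)

Section RegularLocal.
Variables (R : realFieldType) (n : nat) (A : rel nat) (x : nat -> R).
Hypothesis rk : ranked n A x.

Local Notation nb := (nbrs A).
Local Notation up := (upsum n A x).
Local Notation dn := (dnsum A x).
Local Notation flux := (cutflux n A x).
Local Notation ecut := (cutsize n A).
Local Notation kirch := (kirch n A x).

Let Asym : symmetric A. Proof. by case: rk. Qed.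
Let Airr : irreflexive A. Proof. by case: rk. Qed.
Let xle := xle rk.

Variables (d : nat).
Hypothesis d4 : (4 <= d)%N.
Hypothesis degd : forall z, (z < n)%N -> nb 0 n z = d.

Local Notation c := (2 * (d%:R - 2) : R).

Lemma nb_self k : (k < n)%N -> (nb 0 k k + nb k.+1 n k = d)%N.
Proof. by move=> kn; rewrite -(nb_self_split rk kn) degd. Qed.

Lemma ecut_next k : (k < n)%N -> (ecut k.+1 + 2 * nb 0 k k = ecut k + d)%N.
Proof. move=> kn; have := ecutS rk kn; have := nb_self kn; clear; lia. Qed.

Lemma ecut_prev k : (k < n)%N -> (ecut k + 2 * nb k.+1 n k = ecut k.+1 + d)%N.
Proof. move=> kn; have := ecutS rk kn; have := nb_self kn; clear; lia. Qed.

(** Moving one vertex across changes the cut by d minus twice its lower degree. This is what makes 2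
    the smallest possible cut and doubles the critical flux. *)
Lemma ecut_even k : ~~ odd d -> (k <= n)%N -> ~~ odd (ecut k).
Proof.
move=> dev; elim: k => [|k IHk] kn; first by rewrite /cutsize big_geq.
have := congr1 odd (ecut_next kn); rewrite mul2n !oddD odd_double (negPf dev) !addbF.
by move=> ->; apply: IHk; apply: ltnW.
Qed.

Lemma flux_split K m : flux K = \sum_(K <= z < n) (nb 0 K z)%:R * (x z - m)
   - \sum_(0 <= z < K) (nb K n z)%:R * (x z - m).
Proof.
have e1 : \sum_(0 <= z < K) \sum_(K <= j < n) (A z j)%:R * (x j - m) =
    \sum_(K <= z < n) (nb 0 K z)%:R * (x z - m).
  rewrite exchange_big_nat /=; apply: eq_bigr => z _; rewrite /nbrs natr_sum mulr_suml.
  by apply: eq_bigr => j _; rewrite Asym.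
rewrite -e1 -sumrB; apply: eq_bigr => z _; rewrite /nbrs natr_sum mulr_suml -sumrB.
by apply: eq_bigr => j _; ring.
Qed.

(** A common base point cancels in every edge difference. Measured from [m], the lower ends lie at
    least [gam] below, except rank [b.+1], which lies [gam] above. *)
Lemma flux_low b (m := (x b + x b.+1) / 2) (gam := (x b.+1 - x b) / 2) :
  \sum_(b.+2 <= z < n) (nb 0 b.+2 z)%:R * (x z - m) <=
  flux b.+2 + (2 * (nb b.+2 n b.+1)%:R - (ecut b.+2)%:R) * gam.
Proof.
rewrite (flux_split _ m) -[leLHS]addr0 -addrA lerD2l.
have -> : ecut b.+2 = (\sum_(0 <= z < b.+1) nb b.+2 n z + nb b.+2 n b.+1)%N.
  by rewrite /cutsize big_nat_recr.
rewrite [X in - X + _]big_nat_recr //= natrD natr_sum.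
have : \sum_(0 <= z < b.+1) (nb b.+2 n z)%:R * (x z - m) <=
    (\sum_(0 <= z < b.+1) (nb b.+2 n z)%:R) * (- gam).
  rewrite mulr_suml [leLHS]big_nat [leRHS]big_nat; apply: ler_sum => z /andP[_ zb].
  have h := @xle z b zb; apply: ler_wpM2l => //; rewrite /m /gam; lra.
rewrite (_ : x b.+1 - m = gam); last by rewrite /m /gam; lra.
move: (\sum_(0 <= z < b.+1) _) (\sum_(0 <= z < b.+1) _) => S1 S2; lra.
Qed.

Lemma flux_ge_const K m y : (forall z, (K <= z < n)%N -> y <= x z - m) ->
  (ecut K)%:R * y <= \sum_(K <= z < n) (nb 0 K z)%:R * (x z - m).
Proof.
move=> h; rewrite (ecut_dn rk) natr_sum mulr_suml [leLHS]big_nat [leRHS]big_nat.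
by apply: ler_sum => z zr; rewrite ler_wpM2l // h.
Qed.

Lemma up_kirch m z : (z < n)%N -> (m < nb z.+1 n z)%N ->
  x (z.+1 + m)%N - x z <= dn z z + kirch z.
Proof.
move=> zn hm; apply: le_trans (up_ge_last rk (leqnSn z) hm) _.
by rewrite (kirchE A x z zn) /dnsum big_nat_recr //= Airr mul0r addr0; lra.
Qed.

Lemma dn_low0 z K : nb 0 K z = 0%N -> dn K z = 0.
Proof.
move=> h; rewrite /dnsum big_nat big1 // => j jz.
case Azj : (A z j); last by rewrite mul0r.
by have := @le_nb _ 0 K z j jz Azj; rewrite h.
Qed.

(** All d edges of [z] go up, and with no downward flow their total rise is at most [del]; even the
    farthest end, at rank [z + d] or beyond, is hardly higher. *)
Lemma plateau z del : (z < n)%N -> nb 0 z z = 0%N -> kirch z <= del ->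
  x (z + d)%N <= x z + del.
Proof.
move=> zn h kz; have e := nb_self zn.
have := @up_kirch d.-1 z zn; rewrite dn_low0 // add0r addSnnS prednK; last by clear -d4; lia.
by move=> /(_ ltac:(clear -e h d4; lia)); move: kz; lra.
Qed.

Lemma cut2_cases k : ecut k = 2%N -> (k < n)%N ->
  [\/ nb 0 k k = 0%N,
      nb 0 k k = 2%N /\ (forall z, (k < z < n)%N -> nb 0 k z = 0%N)
    | nb 0 k k = 1%N /\ exists y, [/\ (k < y < n)%N, nb 0 k y = 1%N
        & forall z, (k <= z < n)%N -> z != k -> z != y -> nb 0 k z = 0%N]].
Proof.
rewrite (ecut_dn rk) => e kn; rewrite big_ltn // in e.
have [a0|a0] := posnP (nb 0 k k); first by constructor 1.
have [a1|a1] := leqP (nb 0 k k) 1.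
  have {a0 a1} a : nb 0 k k = 1%N by clear -a0 a1; lia.
  constructor 3; split=> //; rewrite a in e.
  have {}e : (\sum_(k.+1 <= j < n) nb 0 k j = 1)%N by clear -e; lia.
  have : (0 < \sum_(k.+1 <= j < n) nb 0 k j)%N by rewrite e.
  rewrite lt0n sum_nat_seq_neq0 => /hasP[y]; rewrite mem_index_iota => yr /= y0.
  rewrite (bigD1_seq y) ?mem_index_iota ?iota_uniq //= in e.
  exists y; split=> //; first by clear -e y0; lia.
  move=> z zr zk zy; apply/eqP; rewrite -leqn0.
  have : (\sum_(k.+1 <= i < n | i != y) nb 0 k i = 0)%N by clear -e y0; lia.
  move/eqP; rewrite sum_nat_seq_eq0 => /allP /(_ z).
  rewrite mem_index_iota zy /=; case: (nb 0 k z) => // w; apply.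
  by clear -zr zk; lia.
constructor 2; split; first by clear -e a1; lia.
move=> z zr; have := sum_ge1 (nb 0 k) zr; clear -e a1; lia.
Qed.

Lemma wide_bound k : (k + d.-1 < n)%N -> flux k.+1 <= c -> flux (k + d.-1)%N <= c ->
  (2 * d%:R - (ecut k)%:R - (nb 0 k k)%:R) * (x (k + d.-1)%N - x k) <= 3 * c.
Proof.
move=> kn f1 f2.
have k0 : (k < n)%N by clear -kn; lia.
have kK : (k < k + d.-1)%N by clear -d4; lia.
have h1 : \sum_(k.+1 <= z < n) (nb 0 k.+1 z)%:R * (x z - x k) <= c.
  by apply: le_trans f1; apply: (flux_ge_nb rk).
have hp z : (k < z < k + d.-1)%N -> (nb 0 k z <= nb 0 k.+1 z <= (nb 0 k z).+1)%N.
  by move=> _; rewrite nb_recr //; clear; case: (A z k); lia.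
have hf z : (k < z < k + d.-1)%N -> (2 + 1 <= nb (k + d.-1) n z + nb 0 k.+1 z)%N.
  move=> zr; have zn : (z < n)%N by clear -zr kn; lia.
  have := degd zn; rewrite (@nb_cat A k.+1 0 n) // (@nb_cat A (k + d.-1) k.+1 n) //; last exact: ltnW.
  have := @nb_le_self _ _ _ _ rk k.+1 (k + d.-1) z zr.
  clear -d4; lia.
have W := window_bound rk (r := 1) isT kK (ltnW kn) hp hf h1 f2.
rewrite (sum_nbS rk) in W.
set P := (\sum_(k.+1 <= z < k + d.-1) nb 0 k z)%N in W.
have e4 : (nb 0 k k + P <= ecut k)%N.
  rewrite (ecut_dn rk) big_ltn // leq_add2l /P (@big_cat_nat _ _ _ (k + d.-1)%N k.+1 n) //=; last exact: ltnW.
  by rewrite leq_addr.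
have e1 := ecut_next k0.
have eR : 2 * d%:R - (ecut k)%:R - (nb 0 k k)%:R <= 2 * (ecut k.+1)%:R - 3 * P%:R :> R.
  have : (d + d + (P + P + P) <= ecut k.+1 + ecut k.+1 + ecut k + nb 0 k k)%N by clear -e1 e4; lia.
  by rewrite -(ler_nat R) !natrD; lra.
have V0 : 0 <= x (k + d.-1)%N - x k by rewrite subr_ge0 xle // leq_addr.
have := ler_wpM2r V0 eR; lra.
Qed.

(** Only [k] receives an edge from below in this window, so the upward flow at [k], bounded by its
    downward flow plus [del], can replace the flux through [k.+1] in [window_bound]. *)
Lemma single_bound k del : (k + d.-1 < n)%N -> nb 0 k k = 1%N ->
  (forall z, (k < z < k + d.-1)%N -> nb 0 k z = 0%N) ->
  kirch k <= del -> flux (k + d.-1)%N <= c ->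
  (d%:R - 1) * (x (k + d.-1)%N - x k) <= dn k k + del + (d%:R - 2).
Proof.
move=> kn low1 low0 kir f2.
have k0 : (k < n)%N by clear -kn; lia.
have kK : (k < k + d.-1)%N by clear -d4; lia.
have h1 : \sum_(k.+1 <= z < n) (A k z)%:R * (x z - x k) <= dn k k + del.
  rewrite -/(up k.+1 k); have := kirchE A x k k0.
  by rewrite /dnsum big_nat_recr //= Airr mul0r addr0 => e; move: kir; rewrite e; lra.
have hp z : (k < z < k + d.-1)%N -> (0 <= A k z <= 1)%N by move=> _; case: (A k z).
have hf z : (k < z < k + d.-1)%N -> (2 + 1 <= nb (k + d.-1) n z + A k z)%N.
  move=> zr; have zn : (z < n)%N by clear -zr kn; lia.
  have := degd zn; rewrite (@nb_cat A k 0 n) //; last exact: ltnW.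
  rewrite low0 // add0n (nb_recl _ _ k0) (@nb_cat A (k + d.-1) k.+1 n) //; last exact: ltnW.
  have := @nb_le_self _ _ _ _ rk k.+1 (k + d.-1) z zr.
  rewrite [A z k]Asym; clear -d4; lia.
have W := window_bound rk (r := 1) (p := fun=> 0%N) (B := fun z => A k z : nat) isT kK (ltnW kn) hp hf h1 f2.
have zP : (\sum_(k.+1 <= z < k + d.-1) 0 = 0)%N by rewrite big1.
rewrite zP mulr0 subr0 -/(nb k.+1 n k) in W.
have e : nb k.+1 n k = d.-1 by have := nb_self k0; rewrite low1; clear; lia.
have eR : (nb k.+1 n k)%:R = d%:R - 1 :> R.
  by rewrite e -[1]/(1%:R) -natrB ?subn1 //; clear -d4; lia.
by rewrite eR in W; lra.
Qed.

(** Twice the flux behind [k] plus the flux at [K]. The edges of [k] past [K] are thereby counted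
    three times, which pays for the interior vertices not joined to [k]: there are equally many of
    them ([cnt]). The conditional term credits an edge that ends at [K.+2], farther than the count
    assumes; [after_U] depends on it. *)
Lemma U_bound k K (z0 : nat) : (K + 1 = k + d)%N -> (K.+2 < n)%N -> nb 0 k k = 2%N ->
  (forall z, (k < z < n)%N -> nb 0 k z = 0%N) ->
  flux k.+1 <= c -> flux K <= c ->
  (d%:R - 2) * (x K + x K.+1 - 2 * x k) +
     (if (k < z0 < K)%N && A z0 K.+2 then x K.+2 - x K.+1 else 0) <= 3 * c.
Proof.
move=> KE Kn low1 low0 f1 f2.
have k0 : (k < n)%N by clear -KE Kn d4; lia.
have kK : (k < K)%N by clear -KE d4; lia.
have Knw : (K <= n)%N by clear -Kn; lia.
have e : nb k.+1 n k = (d - 2)%N by have := nb_self k0; rewrite low1; clear; lia.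
have h1 : \sum_(k.+1 <= z < K) (A k z)%:R * (x z - x k) + (nb K n k)%:R * (x K - x k) <= c.
  apply: le_trans f1; have := @flux_ge_up _ _ _ _ rk k k.+1 (leqnSn k).
  rewrite big_nat1; apply: le_trans; rewrite /upsum (@big_cat_nat _ _ _ K k.+1 n) //= lerD2l.
  exact: (up_ge_nb rk (ltnW kK)).
have h2 : up K k + \sum_(k.+1 <= z < K) up K z <= c.
  by apply: le_trans f2; rewrite -big_ltn //; apply: (flux_ge_up rk (ltnW kK)).
have h3 := up_ge_nb rk (ltnW kK).
have cnt : (nb K n k)%:R = \sum_(k.+1 <= z < K) (1 - (A k z)%:R) :> R.
  rewrite sumrB sumr_const_nat -natr_sum -/(nb k.+1 K k).
  have := @nb_cat A K k.+1 n k kK Knw; rewrite e => /(congr1 (fun m => m%:R : R)).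
  rewrite natrD (_ : K - k.+1 = d - 2)%N; last by clear -KE d4; lia.
  by move=> ->; ring.
have K1 : x K <= x K.+1 by apply: xle.
have K2 : x K.+1 <= x K.+2 by apply: xle.
have kKx : x k <= x K by apply: xle; apply: ltnW.
have far z : (k < z < K)%N -> (3 <= nb K n z + A k z)%N.
  move=> zr; have zn : (z < n)%N by clear -zr Knw; lia.
  have := degd zn; rewrite (@nb_cat A k 0 n) //; last exact: ltnW.
  rewrite low0 ?add0n; last by clear -zr zn; lia.
  rewrite (nb_recl _ _ k0) (@nb_cat A K k.+1 n) // [A z k]Asym.
  have := @nb_le_self _ _ _ _ rk k.+1 K z zr.
  by clear -KE d4; lia.
pose bonus z := if (z == z0) && A z0 K.+2 then x K.+2 - x K.+1 else 0 : R.
have pt z : (k < z < K)%N ->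
   2 * (x K - x k) + (x K.+1 - x K) + bonus z <=
   2 * ((A k z)%:R * (x z - x k)) + up K z + 3 * ((1 - (A k z)%:R) * (x K - x k)).
  move=> zr; have zK : (z <= K)%N by clear -zr; lia.
  have fz := far z zr.
  have zx : x z <= x K by apply: xle.
  have bz : 0 <= bonus z by rewrite /bonus; case: ifP => // _; rewrite subr_ge0.
  case Akz : (A k z) fz => fz; rewrite /= ?mul1r ?mul0r ?mulr0 ?subrr ?subr0 ?mul0r ?mulr0 ?mul1r.
    have f1' : (1 < nb K n z)%N by clear -fz; lia.
    have := up_ge rk zK f1'; rewrite big_ltn // big_nat1 addn0 addn1.
    rewrite /bonus; case: eqP => [<-|_] /=; last by lra.
    case Ar : (A z K.+2); last by lra.
    have := up_ge_nbr rk zK (leqW (leqnSn K)) Ar f1'; rewrite big_nat1 addn0; lra.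
  have f1' : (2 < nb K n z)%N by clear -fz; lia.
  have := up_ge rk zK f1'; rewrite big_ltn // big_ltn // big_nat1 addn0 addn1 addn2.
  rewrite /bonus; case: ifP => _; lra.
have cS : (K - k.+1 = d - 2)%N by clear -KE d4; lia.
have LH : \sum_(k.+1 <= z < K) (2 * (x K - x k) + (x K.+1 - x K) + bonus z) =
   (d%:R - 2) * (2 * (x K - x k) + (x K.+1 - x K)) +
     (if (k < z0 < K)%N && A z0 K.+2 then x K.+2 - x K.+1 else 0).
  rewrite big_split /=; congr (_ + _).
    rewrite sumr_const_nat cS -[LHS]mulr_natl; congr (_ * _).
    by rewrite -[2]/(2%:R) -natrB //; clear -d4; lia.
  have [zr|zr] := boolP (k < z0 < K)%N.
    rewrite (bigD1_seq z0) ?mem_index_iota ?iota_uniq //= big1_seq ?addr0.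
      by rewrite /bonus eqxx.
    by move=> z /andP[/negPf zz _]; rewrite /bonus zz.
  rewrite big_nat big1 // => z zr'; rewrite /bonus; case: eqP => // e0.
  by rewrite -e0 zr' in zr.
have RH : \sum_(k.+1 <= z < K) (2 * ((A k z)%:R * (x z - x k)) + up K z + 3 * ((1 - (A k z)%:R) * (x K - x k)))
   = 2 * \sum_(k.+1 <= z < K) (A k z)%:R * (x z - x k) + \sum_(k.+1 <= z < K) up K z
     + 3 * ((nb K n k)%:R * (x K - x k)).
  by rewrite !big_split /= -!mulr_sumr -mulr_suml -cnt.
have main := ler_sum_nat pt.
rewrite LH RH in main.
have e2 : (d%:R - 2) * (x K + x K.+1 - 2 * x k) = (d%:R - 2) * (2 * (x K - x k) + (x K.+1 - x K)).
  by ring.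
rewrite e2; move: (if _ then _ else _) main => bo main.
move: h1 h2 h3; move: main; move: (\sum_(_ <= _ < _) _) (\sum_(_ <= _ < _) _) ((nb K n k)%:R * _) (up K k) ((d%:R - 2) * (_ + _)) => S1 S2 S3 S4 S5 main h1 h2 h3.
lra.
Qed.

End RegularLocal.

(** * Where the two edges of a minimal cut may end *)

Section RegularCut2.
Variables (R : realFieldType) (n : nat) (A : rel nat) (x : nat -> R).
Hypothesis rk : ranked n A x.

Local Notation nb := (nbrs A).
Local Notation dn := (dnsum A x).
Local Notation flux := (cutflux n A x).
Local Notation ecut := (cutsize n A).
Local Notation kirch := (kirch n A x).

Let Asym : symmetric A. Proof. by case: rk. Qed.
Let Alt : forall i j, A i j -> (j < n)%N. Proof. by case: rk. Qed.
Let xle := xle rk.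

Variables (d : nat).
Hypothesis d4 : (4 <= d)%N.
Hypothesis degd : forall z, (z < n)%N -> nb 0 n z = d.

Local Notation c := (2 * (d%:R - 2) : R).

Let d4R : 4 <= d%:R :> R. Proof. by rewrite (ler_nat _ 4). Qed.

Lemma gap_le2 k : (d - 2 <= ecut k)%N -> flux k <= c -> x k - x k.-1 <= 2.
Proof.
move=> e f; have D := d4R; have g := le_trans (ecut_gap rk k) f.
have g0 : 0 <= x k - x k.-1 by rewrite subr_ge0 xle // leq_pred.
have eR : d%:R - 2 <= (ecut k)%:R :> R.
  have : (d <= ecut k + 2)%N by clear -e; lia.
  by rewrite -(ler_nat R) natrD; lra.
rewrite -(@ler_pM2l _ (d%:R - 2)); last by lra.
by have := ler_wpM2r g0 eR; lra.
Qed.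

Lemma dn_ge1 K z : (K <= z)%N -> (0 < nb 0 K z)%N -> x z - x K.-1 <= dn K z.
Proof.
by move=> Kz h; have := dn_ge rk Kz h; rewrite big_nat1 subn1.
Qed.

Lemma two_dn k y z : (k <= y < n)%N -> (k <= z < n)%N -> y != z -> flux k <= c ->
  dn k y + dn k z <= c.
Proof.
move=> yr zr yz f; apply: le_trans f; rewrite (flux_dn rk) (sum_split2 _ yr zr yz).
rewrite lerDl big_nat_cond sumr_ge0 // => t /andP[/andP[kt _] _].
exact: (dn_ge0 rk).
Qed.

(** The edge landing beyond the window spans its whole rise, leaving less flux for the edge into
    [j.+1]. Up to [del], d ranks then gain less than d - 1, by an amount of order 1 / d. *)
Lemma cut2_out j y del : (j + d < n)%N -> nb 0 j.+1 j.+1 = 1%N ->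
  (j + d <= y < n)%N -> (0 < nb 0 j.+1 y)%N ->
  (forall z, (j.+1 <= z < n)%N -> z != j.+1 -> z != y -> nb 0 j.+1 z = 0%N) ->
  kirch j.+1 <= del -> flux j.+1 <= c -> flux (j + d)%N <= c ->
  (2 * d%:R - 1) * (x (j + d)%N - x j) <= (2 * d%:R + 1) * (d%:R - 2) + del.
Proof.
move=> jn low1 yr lowy low0 kir f1 f2; have D := d4R.
have kd : (j.+1 + d.-1 = j + d)%N by clear -d4; lia.
have sb := @single_bound _ _ _ _ rk _ d4 degd j.+1 del.
rewrite kd in sb; have {}sb := sb jn low1 _ kir f2.
have {}sb : (d%:R - 1) * (x (j + d)%N - x j.+1) <= dn j.+1 j.+1 + del + (d%:R - 2).
  by apply: sb => z zr; apply: low0; clear -zr yr jn; lia.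
have t2 := @two_dn j.+1 j.+1 y ltac:(clear -jn d4; lia) ltac:(clear -yr d4; lia) ltac:(clear -yr d4; lia) f1.
have g1 := @dn_ge1 j.+1 j.+1 (leqnn _) ltac:(by rewrite low1).
have g2 := @dn_ge1 j.+1 y ltac:(clear -yr d4; lia) lowy.
have g3 : x (j + d)%N <= x y by apply: xle; case/andP: yr.
rewrite /= in g1 g2.
have p1 : 0 <= (d%:R - 1) * (dn j.+1 j.+1 - (x j.+1 - x j)) by rewrite mulr_ge0 ?subr_ge0 //; lra.
have p2 : 0 <= d%:R * (c - dn j.+1 j.+1 - (x (j + d)%N - x j)) by rewrite mulr_ge0 ?subr_ge0 //; lra.
lra.
Qed.

Definition pair_at (k y : nat) : Prop :=
  [/\ nb 0 k k = 1%N, (k < y < k + d.-1)%N, nb 0 k y = 1%N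
    & forall z, (k <= z < n)%N -> z != k -> z != y -> nb 0 k z = 0%N].

(** Each of the d - 2 vertices other than [k] and [y] has no edge below [k] and at most d - 1
    neighbours inside, so it sends an edge out at the top. *)
Lemma pair_ecut k y : (k + d <= n)%N -> pair_at k y -> (d - 2 <= ecut (k + d)%N)%N.
Proof.
move=> kn [low1 yr lowy low0].
rewrite /cutsize (@big_cat_nat _ _ _ k 0 (k + d)%N) //=; last exact: leq_addr.
apply: leq_trans (leq_addl _ _).
have kk : (k <= k < k + d)%N by clear -d4; lia.
have ky : (k <= y < k + d)%N by clear -yr; lia.
have kny : k != y by clear -yr; lia.
rewrite (sum_split2n _ kk ky kny); apply: leq_trans (leq_addl _ _).
have e := sum_split2n (fun=> 1%N) kk ky kny; rewrite sum_nat_const_nat muln1 in e.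
have -> : (d - 2 = \sum_(k <= z < k + d | (z != k) && (z != y)) 1)%N by clear -e; lia.
rewrite big_nat_cond [X in (_ <= X)%N]big_nat_cond; apply: leq_sum => z /andP[zr /andP[zk zy]].
have zn : (z < n)%N by clear -zr kn; lia.
have := degd zn; rewrite (@nb_cat A k 0 n) //; last by clear -kn; lia.
rewrite low0 //; last by clear -zr kn; lia.
rewrite add0n (@nb_cat A (k + d) k n) //; last by clear; lia.
have := @nb_le_self _ _ _ _ rk k (k + d) z zr; clear -d4; lia.
Qed.

Lemma pair_sum k y m : (k < n)%N -> pair_at k y ->
  \sum_(k <= z < n) (nb 0 k z)%:R * (x z - m) <= x k + x y - 2 * m.
Proof.
move=> kn [low1 yr lowy low0].
have [yn|yn] := ltnP y n; last first.
  have := @leq0n 0; have : (nb 0 k y = 0)%N.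
    apply/eqP; rewrite -leqn0 leqNgt; apply/negP => /nb_gt0[j _]; rewrite Asym => /Alt.
    by rewrite ltnNge yn.
  by rewrite lowy.
have kk : (k <= k < n)%N by clear -kn; lia.
have ky : (k <= y < n)%N by clear -yr yn; lia.
have kny : k != y by clear -yr; lia.
rewrite (sum_split2 _ kk ky kny) big_nat_cond big1 ?addr0 ?low1 ?lowy; first lra.
by move=> z /andP[zr /andP[zk zy]]; rewrite low0 // mul0r.
Qed.

Lemma pair_at_bound k y del : (k + d < n)%N -> pair_at k y ->
  flux k <= c -> flux (k + d.-1)%N <= c -> kirch k <= del -> kirch y <= del ->
  (d%:R - 1) * (x (k + d.-1)%N + x (k + d)%N - (x k + x y)) <=
  2 * c + 2 * (x (k + d)%N - x (k + d.-1)%N) + 2 * del.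
Proof.
move=> kn [low1 yr lowy low0] f1 f2 k1 k2.
have KE : (k + d.-1 + 1 = k + d)%N by clear -d4; lia.
have := pair_bound rk d4 KE ltac:(clear -kn; lia) degd yr low1 lowy low0 f1 f2 k1 k2.
by rewrite -addn1 KE; lra.
Qed.

Lemma pair_next k y del : (k + d < n)%N -> pair_at k y ->
  flux k <= c -> flux (k + d.-1)%N <= c -> flux (k + d)%N <= c ->
  kirch k <= del -> kirch y <= del -> 0 <= del ->
  x (k + d.-1)%N + x (k + d)%N <= x k + x y + 4 + del.
Proof.
move=> kn pr f1 f2 f3 k1 k2 del0; have D := d4R.
have b := pair_at_bound kn pr f1 f2 k1 k2.
have g := gap_le2 (pair_ecut (ltnW kn) pr) f3.
have kE : ((k + d).-1 = k + d.-1)%N by clear -d4; lia.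
rewrite kE in g.
rewrite -(@ler_pM2l _ (d%:R - 1)); last by lra.
have : 0 <= (d%:R - 3) * del by rewrite mulr_ge0 ?subr_ge0 //; lra.
lra.
Qed.

End RegularCut2.

Section RegularCut2Steps.
Variables (R : realFieldType) (n : nat) (A : rel nat) (x : nat -> R).
Hypothesis rk : ranked n A x.

Local Notation nb := (nbrs A).
Local Notation flux := (cutflux n A x).
Local Notation ecut := (cutsize n A).
Local Notation kirch := (kirch n A x).

Let Asym : symmetric A. Proof. by case: rk. Qed.
Let xle := xle rk.

Variables (d : nat).
Hypothesis d4 : (4 <= d)%N.
Hypothesis degd : forall z, (z < n)%N -> nb 0 n z = d.

Local Notation c := (2 * (d%:R - 2) : R).

Let d4R : 4 <= d%:R :> R. Proof. by rewrite (ler_nat _ 4). Qed.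

Local Notation pair_at := (pair_at n A d).

Definition midpt (b : nat) : R := (x b + x b.+1) / 2.
Local Notation mid := midpt.
Definition stuckE (kap : R) (b S : nat) := forall s, (0 < s <= S)%N -> mid b + s%:R - kap < mid (b + s)%N.

(** The two shapes of a minimal cut that occur without slack: in [U_at] both edges meet at the upper
    end [k]; in [V_at] both start at [k.-1] and end at two ranks of the window. *)
Definition U_at (k : nat) : Prop :=
  nb 0 k k = 2%N /\ (forall z, (k < z < n)%N -> nb 0 k z = 0%N).
Definition V_at (k : nat) : Prop :=
  nb k n k.-1 = 2%N /\ exists y, pair_at k y.

Lemma mid_le b : x b <= mid b <= x b.+1.
Proof. have := @xle b b.+1 (leqnSn b); rewrite /mid => h; apply/andP; split; lra. Qed.

Lemma U_lower k j : U_at k -> (j < k)%N -> (k < n)%N -> (nb k n j <= 1)%N.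
Proof.
move=> [_ low0] jk kn; rewrite nb_recl // -[leqRHS]addn0 leq_add //; first by case: (A j k).
rewrite leqNgt; apply/negP => /nb_gt0[z zr Ajz].
have := @le_nb A 0 k z j ltac:(by rewrite jk) ltac:(by rewrite Asym).
by rewrite low0.
Qed.

Lemma core_V j del : (j + d.+1 < n)%N -> nb j.+1 n j = 2%N -> ecut j.+1 = 2%N ->
  flux j.+1 <= c -> flux (j + d)%N <= c ->
  (forall z, (j < z < j + d)%N -> kirch z <= del) ->
  [\/ (2 * d%:R - 1) * (x (j + d)%N - x j) <= (2 * d%:R + 1) * (d%:R - 2) + del,
      x (j + d).+1 <= x j + d%:R - 2 + del
    | V_at j.+1].
Proof.
move=> jn upj e2 f1 f2 kir; have D := d4R.
have jn' : (j.+1 < n)%N by clear -jn d4; lia.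
have kj : kirch j.+1 <= del by apply: kir; clear -d4; lia.
have [a0|aU|[a1 [y [yr lowy low0]]]] := cut2_cases rk e2 jn'.
- constructor 2; have := @plateau _ _ _ _ rk _ d4 degd _ del jn' a0 kj.
  rewrite addSn; have := le_trans (ecut_gap rk j.+1) f1; rewrite e2 /=; lra.
- by have := U_lower aU (ltnSn j) jn'; rewrite upj.
have [yK|Ky] := ltnP y (j + d).
  constructor 3; split=> //; exists y; split=> //.
  by clear -yK yr d4; lia.
constructor 1; apply: (@cut2_out _ _ _ _ rk _ d4 degd j y) => //.
- by clear -jn; lia.
- by clear -Ky yr; lia.
- by rewrite lowy.
Qed.

Ltac lin := clear -rk Asym xle d4 degd d4R R n A x d; lra.

(** Every other landing pattern of [cut2_cases] gives a slack place. If the edges end at a pair but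
    do not both start at [b.+1], their lower ends lie lower on average and the gain misses d + 1 by
    about a unit. *)
Lemma cut2_step b kap del : (b + d.+3 < n)%N -> 0 <= del -> del <= kap ->
  d%:R * kap <= 1 / 8 -> stuckE kap b d.+1 -> ecut b.+2 = 2%N ->
  (forall k, (b < k <= b + d.+2)%N -> flux k <= c) ->
  (forall z, (b < z <= b + d.+2)%N -> kirch z <= del) ->
  (U_at b.+2 \/ V_at b.+2) /\ mid (b + d).+1 <= mid b + d%:R + 1 + del.
Proof.
move=> bn del0 dk kapd st e2 fl kir; have D := d4R.
have k2n : (b.+2 < n)%N by clear -bn; lia.
have kp0 : 0 <= kap by lra.
have pk : 4 * kap <= d%:R * kap by rewrite ler_wpM2r.
have ep := @ecut_prev _ _ _ _ rk _ degd b.+1 ltac:(clear -bn; lia).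
have a2 : (nb b.+2 n b.+1 <= 2)%N.
  by rewrite -e2 /cutsize big_nat_recr //= leq_addl.
have g2 : x b.+1 - x b <= 2.
  apply: (gap_le2 rk d4 (k := b.+1)); last by apply: fl; clear; lia.
  by clear -ep a2 e2; lia.
have s1 := st d.+1 ltac:(clear; lia); rewrite addnS -natr1 in s1.
have s0 := st d ltac:(clear -d4; lia).
have fk := fl b.+2 ltac:(clear -d4; lia).
have low := flux_low rk b; lazy zeta in low; rewrite -/(mid b) e2 in low.
have gap := le_trans (ecut_gap rk b.+2) fk; rewrite e2 /= in gap.
have /andP[m1 m2] := mid_le (b + d); have /andP[m3 m4] := mid_le (b + d).+1.
have m5 : mid b = x b.+1 - (x b.+1 - x b) / 2 by rewrite /mid; lin.
have kj : kirch b.+2 <= del by apply: kir; clear -d4; lia.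
have bd1 : (b.+2 + d.-1 = (b + d).+1)%N by clear -d4; lia.
have bd2 : (b.+2 + d = (b + d).+2)%N by clear; lia.
have [a0|aU|[a1 [y [yr lowy low0]]]] := cut2_cases rk e2 k2n.
- exfalso; have := @plateau _ _ _ _ rk _ d4 degd _ del k2n a0 kj.
  by rewrite bd2; lra.
- split; first by left.
  have lowU : 2 * (x b.+2 - mid b) <= c.
    have a1 := U_lower aU (ltnSn b.+1) k2n; case: aU => l2 l0.
    rewrite -(ler_nat R) in a1; rewrite big_ltn // l2 big_nat big1 in low; last first.
      by move=> z zr; rewrite l0 ?mul0r.
    have g0 : 0 <= x b.+1 - x b by rewrite subr_ge0 xle.
    have : 0 <= (1 - (nb b.+2 n b.+1)%:R) * (x b.+1 - x b) by rewrite mulr_ge0 ?subr_ge0 //; lra.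
    lra.
  have := @U_bound _ _ _ _ rk _ d4 degd b.+2 (b + d).+1 b.+2 ltac:(clear; lia) ltac:(clear -bn; lia)
    (proj1 aU) (proj2 aU) (fl b.+3 ltac:(clear -d4; lia)) (fl (b + d).+1 ltac:(clear -d4; lia)).
  rewrite ltnn /=.
  rewrite addr0 (_ : 3 * c = (d%:R - 2) * 6); last by ring.
  rewrite ler_pM2l; last by move: D; lin.
  by rewrite {1}/mid; lra.
have [yK|Ky] := ltnP y (b + d).+1; last first.
  exfalso; have := @cut2_out _ _ _ _ rk _ d4 degd b.+1 y del.
  rewrite addSn => /(_ ltac:(clear -bn; lia) a1 ltac:(clear -yr Ky; lia) ltac:(by rewrite lowy) low0 kj fk (fl (b + d).+1 ltac:(clear -d4; lia))).
  have p1 : 0 <= (2 * d%:R - 1) * (x (b + d).+1 - x b.+1 - (d%:R - 1 - kap)) by rewrite mulr_ge0 ?subr_ge0 //; move: D s0 m1 m2 m5 g2 pk s1; lin.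
  lra.
have pr : pair_at b.+2 y by split=> //; clear -yK yr d4; lia.
have nx := @pair_next _ _ _ _ rk _ d4 degd b.+2 y del ltac:(clear -bn; lia) pr fk.
rewrite bd1 bd2 in nx.
have {}nx := nx (fl (b + d).+1 ltac:(clear -d4; lia)) (fl (b + d).+2 ltac:(clear -d4; lia)) kj
  (kir y ltac:(clear -yK yr; lia)) del0.
have ps := pair_sum rk (mid b) k2n pr.
have {}low : x b.+2 + x y - 2 * mid b <= c + (2 * (nb b.+2 n b.+1)%:R - 2) * ((x b.+1 - x b) / 2).
  have [kn [y1 [y2 y3]]] := (k2n, (yr, (lowy, low0))).
  have <- : \sum_(b.+2 <= z < n) (nb 0 b.+2 z)%:R * (x z - mid b) = x b.+2 + x y - 2 * mid b.
    rewrite (@sum_split2 _ _ b.+2 n b.+2 y) ?leqnn ?k2n //; last by clear -yr; lia.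
      rewrite big_nat_cond big1 ?addr0 ?a1 ?lowy; first lin.
      by move=> z /andP[zr /andP[zk zy]]; rewrite low0 // mul0r.
    by clear -yr; lia.
  by lra.
have mm : mid (b + d).+1 = (x (b + d).+1 + x (b + d).+2) / 2 by [].
move: a2; rewrite leq_eqVlt => /orP[/eqP a2|a2].
  split; first by right; split=> //; exists y.
  by rewrite a2 in low; rewrite mm; lra.
exfalso; have g0 : 0 <= x b.+1 - x b by rewrite subr_ge0 xle.
have aR : (nb b.+2 n b.+1)%:R <= 1 :> R by rewrite (ler_nat _ _ 1).
have : 0 <= (1 - (nb b.+2 n b.+1)%:R) * (x b.+1 - x b) by rewrite mulr_ge0 // subr_ge0.
lra.
Qed.

End RegularCut2Steps.

(** * Numerical bounds for cuts of intermediate size *)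

Section Arith.
Variable R : realFieldType.
Implicit Types (D e a t gam P V : R).

(** [P] is the rise up to the cut and [V] the rise over the window behind it. Writing e = 4 + u and
    D = 8 + u + w turns the claim into nonnegative monomials. *)
Lemma arith_low D e P V : 4 <= e -> e <= D - 4 ->
  e * P <= 2 * (D - 2) -> (D - e) * V <= 3 * (D - 2) -> P + V <= D - 1 / 2.
Proof.
move=> e4 eD hP hV; have ed : 0 < e * (D - e) by rewrite mulr_gt0 //; lra.
rewrite -(@ler_pM2l _ (e * (D - e))) //.
have p1 : 0 <= (D - e) * (2 * (D - 2) - e * P) by rewrite mulr_ge0 ?subr_ge0 //; lra.
have p2 : 0 <= e * (3 * (D - 2) - (D - e) * V) by rewrite mulr_ge0 ?subr_ge0 //; lra.
have [u [w [uE wE u0 w0]]] : exists u w, [/\ e = 4 + u, D = 8 + u + w, 0 <= u & 0 <= w].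
  by exists (e - 4), (D - 4 - e); split; lra.
rewrite {}uE {}wE in p1 p2 *.
have q1 : 0 <= u * w by rewrite mulr_ge0.
have q2 : 0 <= u * u by rewrite mulr_ge0.
have q3 : 0 <= w * w by rewrite mulr_ge0.
have q4 : 0 <= u * w * (u + w) by rewrite mulr_ge0 // addr_ge0.
lra.
Qed.

Lemma arith_I4 D e P V : 4 <= e -> e <= D - 4 ->
  e * P <= D - 2 -> (D - e) * V <= 3 * (D - 2) -> P + V <= D - 2.
Proof.
move=> e4 eD hP hV; have ed : 0 < e * (D - e) by rewrite mulr_gt0 //; lra.
rewrite -(@ler_pM2l _ (e * (D - e))) //.
have p1 : 0 <= (D - e) * (D - 2 - e * P) by rewrite mulr_ge0 ?subr_ge0 //; lra.
have p2 : 0 <= e * (3 * (D - 2) - (D - e) * V) by rewrite mulr_ge0 ?subr_ge0 //; lra.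
have [u [w [uE wE u0 w0]]] : exists u w, [/\ e = 4 + u, D = 8 + u + w, 0 <= u & 0 <= w].
  by exists (e - 4), (D - 4 - e); split; lra.
rewrite {}uE {}wE in p1 p2 *.
have q1 : 0 <= u * w by rewrite mulr_ge0.
have q2 : 0 <= u * u by rewrite mulr_ge0.
have q3 : 0 <= w * w by rewrite mulr_ge0.
have q4 : 0 <= u * w * (u + w) by rewrite mulr_ge0 // addr_ge0.
lra.
Qed.

(** Here [t] is the excess 2 [a1] - [e1] of cut edges starting at [b.+1]. The hypothesis on [V] is
    the window bound after replacing its coefficient 2d - e - [a0] by its least value d / 2 + 6. *)
Lemma arith_high D e t gam P V : 10 <= D -> 4 <= e -> e <= D - 4 -> 2 <= t -> t <= e ->
  e * P <= 2 * (D - 2) + t * gam -> (D - t) * gam <= D - 2 ->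
  (D + 12) * V <= 12 * (D - 2) -> P + V <= D - 1 / 4.
Proof.
move=> D10 e4 eD t2 te hP hg hV.
have eDt : 0 < e * (D - t) by rewrite mulr_gt0 //; lra.
have hP' : 2 * (D - 4) * P <= (D - 2) * (D - 2).
  rewrite -(@ler_pM2l _ (e * (D - t))) //.
  have p1 : 0 <= (D - t) * (2 * (D - 2) + t * gam - e * P) by rewrite mulr_ge0 ?subr_ge0 //; lra.
  have p2 : 0 <= t * (D - 2 - (D - t) * gam) by rewrite mulr_ge0 ?subr_ge0 //; lra.
  have p3 : 0 <= (D - 4) * ((D - t) * (2 * (D - 2) + t * gam - e * P)) by rewrite mulr_ge0 ?subr_ge0 //; lra.
  have p4 : 0 <= (D - 4) * (t * (D - 2 - (D - t) * gam)) by rewrite mulr_ge0 ?subr_ge0 //; lra.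
  (* 4(D-4)(2D-t) <= (2D-4)e(D-t): linear in t, then concave in e *)
  have k1 : 0 <= (2 * D - 4) * (e - 4) + 4 * D by rewrite addr_ge0 ?mulr_ge0 ?subr_ge0 //; lra.
  have k2 : 0 <= (e - t) * ((2 * D - 4) * (e - 4) + 4 * D) by rewrite mulr_ge0 ?subr_ge0 //; lra.
  have k3 : 0 <= (2 * D - 4) * ((e - 4) * (D - 4 - e)) by rewrite !mulr_ge0 ?subr_ge0 //; lra.
  have k4 : 0 <= (e - 4) * (D - 4) by rewrite mulr_ge0 ?subr_ge0 //; lra.
  have key : 4 * (D - 4) * (2 * D - t) <= (2 * D - 4) * (e * (D - t)) by lra.
  have k5 : 0 <= (D - 2) * ((2 * D - 4) * (e * (D - t)) - 4 * (D - 4) * (2 * D - t)) by rewrite mulr_ge0 ?subr_ge0 //; lra.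
  lra.
have Dpos : 0 < 2 * (D - 4) * (D + 12) by rewrite !mulr_gt0 //; lra.
rewrite -(@ler_pM2l _ (2 * (D - 4) * (D + 12))) //.
have p1 : 0 <= (D + 12) * ((D - 2) * (D - 2) - 2 * (D - 4) * P) by rewrite mulr_ge0 ?subr_ge0 //; lra.
have p2 : 0 <= (D - 4) * (12 * (D - 2) - (D + 12) * V) by rewrite mulr_ge0 ?subr_ge0 //; lra.
have [s [sE s0]] : exists s, D = 10 + s /\ 0 <= s by exists (D - 10); split; lra.
rewrite {}sE in p1 p2 *.
have q2 : 0 <= s * s by rewrite mulr_ge0.
have q3 : 0 <= s * s * s by rewrite mulr_ge0.
lra.
Qed.

End Arith.

(** * Excluding cuts of intermediate size *)

Section RegularExclusions.
Variables (R : realFieldType) (n : nat) (A : rel nat) (x : nat -> R).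
Hypothesis rk : ranked n A x.

Local Notation nb := (nbrs A).
Local Notation flux := (cutflux n A x).
Local Notation ecut := (cutsize n A).

Let Asym : symmetric A. Proof. by case: rk. Qed.
Let xle := xle rk.

Variables (d : nat).
Hypothesis d4 : (4 <= d)%N.
Hypothesis degd : forall z, (z < n)%N -> nb 0 n z = d.

Local Notation c := (2 * (d%:R - 2) : R).

Let d4R : 4 <= d%:R :> R. Proof. by rewrite (ler_nat _ 4). Qed.

Local Notation mid := (midpt x).
Local Notation stuckE := (stuckE x).
Hypothesis dev : ~~ odd d.

Variables (kap del : R) (b S : nat).
Hypothesis kap0 : 0 <= kap.
Hypothesis kapd : d%:R * kap <= 1 / 8.
Hypothesis dS : (d < S)%N.
Hypothesis st : stuckE kap b S.
Hypothesis bn : (b + d.+3 < n)%N.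
Hypothesis fl : forall k, (b < k <= b + d.+2)%N -> flux k <= c.

Local Notation e0 := (ecut b.+1).
Local Notation e1 := (ecut b.+2).
Local Notation a0 := (nb 0 b.+2 b.+2).
Local Notation a1 := (nb b.+2 n b.+1).
Local Notation gam := ((x b.+1 - x b) / 2).

Lemma kap_small : kap <= 1 / 32.
Proof. by have := ler_wpM2r kap0 d4R; move: kapd; lra. Qed.

(** Only an edge joining [k.-1] and [k] is counted at both ends. *)
Lemma ends_le k : (0 < k < n)%N -> (nb 0 k k + nb k n k.-1 <= (ecut k).+1)%N.
Proof.
case: k => // k /andP[_ kn]; rewrite nb_recr // /cutsize big_nat_recr //=.
have h : (nb 0 k k.+1 <= \sum_(0 <= z < k) nb k.+1 n z)%N.
  apply: leq_sum => z _; rewrite [A k.+1 z]Asym.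
  by rewrite [X in (_ <= X)%N]nb_recl // leq_addr.
by have := leq_b1 (A k.+1 k); move: h; clear; lia.
Qed.

Lemma prev_ecut : (e0 + 2 * a1 = e1 + d)%N.
Proof. by apply: (@ecut_prev _ _ _ _ rk _ degd); clear -bn; lia. Qed.

Lemma a1_le : (a1 <= e1)%N.
Proof. by rewrite /cutsize [X in (_ <= X)%N]big_nat_recr //= leq_addl. Qed.

Lemma low_first : e1%:R * (x b.+2 - mid b) <= c + (2 * a1%:R - e1%:R) * gam.
Proof.
have := flux_low rk b; lazy zeta; rewrite -/(mid b) => low.
have f := fl (k := b.+2) ltac:(clear -d4; lia).
apply: le_trans (_ : flux b.+2 + (2 * a1%:R - e1%:R) * gam <= _); last by lra.
apply: le_trans low; apply: (flux_ge_const rk) => z /andP[zb _].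
by rewrite lerD2r xle.
Qed.

(** The edges of the cut at [b.+2] that do not start at [b.+1] cross the previous cut too, and span
    both steps. *)
Lemma pass_cut : e0%:R * (x b.+1 - x b) + (e1%:R - a1%:R) * (x b.+2 - x b.+1) <= flux b.+1.
Proof.
apply: le_trans (flux_ge_nb rk _); rewrite /= big_ltn; last by clear -bn; lia.
have b1n : (b.+1 < n)%N by clear -bn; lia.
have E : e0 = (nb 0 b.+1 b.+1 + \sum_(b.+2 <= z < n) nb 0 b.+1 z)%N.
  by rewrite (ecut_dn rk) big_ltn.
have t : e1%:R - a1%:R = (\sum_(b.+2 <= z < n) nb 0 b.+1 z)%N%:R :> R.
  have := ecutS rk b1n; rewrite E => h.
  have {}h : e1 = (\sum_(b.+2 <= z < n) nb 0 b.+1 z + a1)%N by clear -h; lia.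
  by rewrite [e1 in LHS]h natrD addrK.
rewrite t E natrD mulrDl -addrA lerD2l natr_sum !mulr_suml -big_split /=.
rewrite [leLHS]big_nat [leRHS]big_nat; apply: ler_sum => z /andP[zb _].
by rewrite -mulrDr ler_wpM2l // addrC subrKA lerD2r xle.
Qed.

Lemma gam_ge0 : 0 <= gam.
Proof. by have := @xle b b.+1 (leqnSn b); lra. Qed.

(** In degree four d - 2 is already the minimal cut size, so larger cuts must be excluded directly;
    the late shape exists only from degree six on. *)
Lemma not_dense4 : d = 4%N -> (4 <= e0)%N -> (4 <= e1)%N -> False.
Proof.
move=> dE h0 h1; have ep := prev_ecut; have al := a1_le.
have t1 : (a1 < e1)%N by clear -ep al h0 h1 dE; lia.
have pc := le_trans pass_cut (fl (k := b.+1) ltac:(clear -d4; lia)).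
have lf := low_first; have g0 := gam_ge0.
have g1 : 0 <= x b.+2 - x b.+1 by rewrite subr_ge0 xle.
have s1 := @st 1%N ltac:(clear -dS d4; lia); rewrite addn1 in s1.
have k32 := kap_small.
have dR : d%:R = 4 :> R by rewrite dE.
have {}t1 : a1%:R + 1 <= e1%:R :> R by rewrite natr1 ler_nat.
have {}h0 : 4 <= e0%:R :> R by rewrite (ler_nat _ 4).
have {}h1 : 4 <= e1%:R :> R by rewrite (ler_nat _ 4).
rewrite dR in lf pc.
move: lf; rewrite (_ : x b.+2 - mid b = (x b.+2 - x b.+1) + gam); last by rewrite /midpt; lra.
have : mid b.+1 - mid b = gam + (x b.+2 - x b.+1) / 2 by rewrite /midpt; lra.
move: pc g0; rewrite (_ : x b.+1 - x b = 2 * gam); last by lra.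
move: gam (x b.+2 - x b.+1) g1 (e0%:R : R) (e1%:R : R) (a1%:R : R) h0 h1 t1 => g h hh E0 E1 A1 h0 h1 t1 pc g0 ms lf.
have p1 : 0 <= (E0 - 4) * g by rewrite mulr_ge0 //; lra.
have p2 : 0 <= (E1 - A1 - 1) * g by rewrite mulr_ge0 //; lra.
have p3 : 0 <= (E1 - 4) * h by rewrite mulr_ge0 //; lra.
have p4 : 0 <= (E1 - A1 - 1) * h by rewrite mulr_ge0 //; lra.
suff : 1 <= 0 :> R by rewrite ler10.
lra.
Qed.

Lemma not_narrow_prev : (4 <= e0)%N -> (e0 + 4 <= d)%N -> False.
Proof.
move=> h4 hd; have D := d4R; have k32 := kap_small.
have bd : (b.+1 + d.-1 = b + d)%N by clear -d4; lia.
have W := @wide_bound _ _ _ _ rk _ d4 degd b.+1.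
rewrite bd in W; have {}W := W ltac:(clear -bn; lia) (fl (k := b.+2) ltac:(clear -d4; lia)) (fl (k := (b + d)%N) ltac:(clear -d4; lia)).
have ae : (nb 0 b.+1 b.+1 <= e0)%N.
  by rewrite (ecut_dn rk) big_ltn ?leq_addr //; clear -bn; lia.
have G := le_trans (ecut_gap rk b.+1) (fl (k := b.+1) ltac:(clear -d4; lia)).
rewrite /= in G.
have s := @st (d.-1) ltac:(clear -dS d4; lia).
have dm : d.-1%:R = d%:R - 1 :> R by rewrite -[1]/(1%:R) -natrB ?subn1 //; clear -d4; lia.
have /andP[_ m2] := mid_le rk (b + d.-1).
have bd' : ((b + d.-1).+1 = b + d)%N by clear -d4; lia.
rewrite bd' in m2; rewrite dm in s.
move: h4 hd ae; rewrite -!(ler_nat R) natrD => h4 hd ae.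
have V0 : 0 <= x (b + d)%N - x b.+1 by rewrite subr_ge0 xle //; clear -d4; lia.
have p1 := ler_wpM2r V0 ae.
have m5 : mid b = x b.+1 - gam by rewrite /midpt; lra.
suff : 1 <= 0 :> R by rewrite ler10.
by have := @arith_I4 R d%:R e0%:R gam (x (b + d)%N - x b.+1) h4 ltac:(lra) ltac:(lra) ltac:(lra); lra.
Qed.

Ltac lin := clear -rk Asym xle d4 degd d4R dev kap0 kapd dS st bn fl R n A x d kap del b S; lra.

Lemma not_narrow : (4 <= e1)%N -> (e1 + 4 <= d)%N -> False.
Proof.
move=> h4 hd; have D := d4R; have k32 := kap_small.
have ende := @ends_le b.+2 ltac:(clear -bn; lia); rewrite /= in ende.
have ep := prev_ecut; have al := a1_le; have lf := low_first; have g0 := gam_ge0.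
have G := le_trans (ecut_gap rk b.+1) (fl (k := b.+1) ltac:(clear -d4; lia)); rewrite /= in G.
have bd : (b.+2 + d.-1 = (b + d).+1)%N by clear -d4; lia.
have W := @wide_bound _ _ _ _ rk _ d4 degd b.+2.
rewrite bd in W; have {}W := W ltac:(clear -bn; lia) (fl (k := b.+3) ltac:(clear -d4; lia)) (fl (k := (b + d).+1) ltac:(clear -d4; lia)).
have ae : (a0 <= e1)%N.
  by rewrite (ecut_dn rk) big_ltn ?leq_addr //; clear -bn; lia.
have s := @st d ltac:(clear -dS d4; lia).
have /andP[_ m2] := mid_le rk (b + d).
have V0 : 0 <= x (b + d).+1 - x b.+2 by rewrite subr_ge0 xle //; clear -d4; lia.
set P := x b.+2 - mid b in lf; set V := x (b + d).+1 - x b.+2 in W V0.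
have PV : d%:R - kap <= P + V by rewrite /P /V; lra.
suff : 1 <= 0 :> R by rewrite ler10.
have h4R : 4 <= e1%:R :> R by rewrite (ler_nat _ 4).
have hdR : e1%:R <= d%:R - 4 :> R by move: hd; rewrite -(ler_nat R) natrD; lin.
(* If at most half of the cut edges start at [b.+1], the correction in [low_first] is favourable.
   Otherwise [prev_ecut] ties the size of the previous cut to this excess and bounds [gam], while
   [ends_le] leaves few edges ending at [b.+2], which sharpens the window bound. *)
have [ta|ta] := leqP (2 * a1)%N e1.
  have taR : 2 * a1%:R <= e1%:R :> R by rewrite -natrM ler_nat.
  have aeR : a0%:R <= e1%:R :> R by rewrite ler_nat.
  have p1 : 0 <= (e1%:R - 2 * a1%:R) * gam by rewrite mulr_ge0 // subr_ge0.
  have p2 := ler_wpM2r V0 aeR.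
  by have := @arith_low R d%:R e1%:R P V h4R hdR ltac:(lra) ltac:(lra); lra.
have e1ev : ~~ odd e1 by apply: (@ecut_even _ _ _ _ rk _ degd) => //; clear -bn; lia.
have t2 : (e1 + 2 <= 2 * a1)%N.
  have := odd_double_half e1; rewrite (negPf e1ev) add0n -mul2n; clear -ta; lia.
have t2R : e1%:R + 2 <= 2 * a1%:R :> R by rewrite -natrM -natrD ler_nat.
have alR : a1%:R <= e1%:R :> R by rewrite ler_nat.
have endR : a0%:R + a1%:R <= e1%:R + 1 :> R by rewrite -natrD natr1 ler_nat.
have epR : e0%:R = e1%:R + d%:R - 2 * a1%:R :> R.
  by have := congr1 (fun m => m%:R : R) ep; rewrite mul2n -addnn !natrD; lin.
have hg : (d%:R - (2 * a1%:R - e1%:R)) * gam <= d%:R - 2 by move: G; rewrite epR; lin.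
have [d10|d10] := leqP 10 d.
  have d10R : 10 <= d%:R :> R by rewrite (ler_nat _ 10).
  have p2 : 0 <= (2 * d%:R - e1%:R - a0%:R - (d%:R / 2 + 6)) * V by rewrite mulr_ge0 //; lra.
  by have := @arith_high R d%:R e1%:R (2 * a1%:R - e1%:R) gam P V d10R h4R hdR ltac:(lra) ltac:(lra) lf hg ltac:(lra); lra.
(* The bounds on [e1] force d >= 8, so 8 is the only even degree out of reach of [arith_high]. *)
have dE : d = 8%N by clear -d10 h4 hd dev; case: d dev d10 hd => [|[|[|[|[|[|[|[|[|[|//]]]]]]]]]]; lia.
have eE : e1 = 4%N by clear -dE h4 hd; lia.
have dR : d%:R = 8 :> R by rewrite dE.
have eR : e1%:R = 4 :> R by rewrite eE.
rewrite dR eR in W lf hg PV.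
have : a1 = 3%N \/ a1 = 4%N by clear -eE al t2; lia.
case=> aE; have aR := congr1 (fun m => m%:R : R) aE; rewrite /= in aR; rewrite aR in lf hg endR; rewrite eR in endR.
  have p2 : 0 <= (2 - a0%:R) * V by rewrite mulr_ge0 //; lra.
  lra.
have p2 : 0 <= (1 - a0%:R) * V by rewrite mulr_ge0 //; lra.
lra.
Qed.

End RegularExclusions.

(** The extreme case [eps = 1], [t3 = 0] of [arith_mid]. It is a linear program in [H1] and [H2]:
    the bound on (D - 2 - t) [H1] + t [H2], with [H1 <= H2] and [2 <= g + H1]. *)
Lemma arith_O (R : realFieldType) (D t a g H1 H2 E : R) :
  6 <= D -> 1 <= t -> t <= D - 2 -> a <= 1 + t -> 2 * a <= D -> 0 <= g ->
  0 <= E -> E * D <= 1 / 32 -> g * (D - a) <= a + E -> H1 <= H2 -> 2 <= g + H1 ->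
  (D - 2 - t) * H1 + t * H2 <= 2 * (D - 2) + (2 * a - (D - 2)) * g + E ->
  E <= 1 / 192 -> 2 * (D - 2) + (2 * a - (D - 2)) * g + E <= 2 * (D - 2) + 2 + E ->
  a * (2 * a - t) <= t * D ->
  (1 + t) * H1 + (D - 1 - t) * H2 < 3 * D - E.
Proof.
move=> hD6 ht1 htD ha_t haD hg0 hE0 hED hhg hH12 hHg hhB e B pat.
have [u uE] : exists u, u = D - 1 - t by exists (D - 1 - t).
have [m mE] : exists m, m = D - 2 - t by exists (D - 2 - t).
have [BB BE] : exists BB, BB = 2 * (D - 2) + (2 * a - (D - 2)) * g + E.
  by exists (2 * (D - 2) + (2 * a - (D - 2)) * g + E).
rewrite -mE -BE in hhB; rewrite -BE in B; rewrite -uE.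
have u0 : 0 <= u by clear -uE htD hD6; lra.
have m0 : 0 <= m by clear -mE htD; lra.
have t0 : 0 < t by clear -ht1; lra.
have t0' : 0 <= t := ltW t0.
have D60 : 0 <= D - 6 by clear -hD6; lra.
have Dt : 0 <= D - t by clear -htD; lra.
have Du : 0 <= D - u by clear -uE ht1; lra.
have t10 : 0 <= t - 1 by clear -ht1; lra.
have t11 : 0 <= 1 + t by clear -ht1; lra.
have hB0 : 0 <= BB - (m * H1 + t * H2) by rewrite subr_ge0.
have H12' : 0 <= H2 - H1 by rewrite subr_ge0.
have gH : 0 <= g + H1 - 2 by rewrite subr_ge0.
have D0 : 0 <= D by clear -hD6; lra.
have ED0 : 0 <= 1 / 32 - E * D by rewrite subr_ge0.
have q1 : 0 <= u * (BB - (m * H1 + t * H2)) by rewrite mulr_ge0.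
have gt : 0 <= g * (t * (1 + t)) by rewrite !mulr_ge0.
have tD6 : 0 <= t * (D - 6) by rewrite mulr_ge0.
have tE : 0 <= (D - t) * E by rewrite mulr_ge0.
have uE' : 0 <= (D - u) * E by rewrite mulr_ge0.
rewrite -(@ltr_pM2l _ t) //.
(* Comparing the slopes of objective and constraint decides which vertex of the feasible region is
   optimal: [H1 = 2 - g] in the first case, [H1 = H2] in the second. *)
have [c1|c1] := leP (t * (1 + t)) (u * m).
  have q2 : 0 <= (u * m - t * (1 + t)) * (g + H1 - 2) by rewrite mulr_ge0 // subr_ge0.
  have fin : g * (u * (2 * a - t) - t * (1 + t)) + u * E < t * D - t * E.
    clear q1 q2 hhB hHg hH12 hB0 BE.
    have [at2|at2] := leP (2 * a) t.
      have : 0 <= g * (u * (t - 2 * a)) by rewrite !mulr_ge0 // subr_ge0.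
      clear uE; lra.
    have at0 : 0 <= 2 * a - t by rewrite subr_ge0 ltW.
    have [g4|g4] := leP (1 / 4) g.
      have r0 : 0 <= D - a - u by clear -uE ha_t; lra.
      have r1 : 0 <= g * (D - a - u) * (2 * a - t) by rewrite !mulr_ge0.
      have r2 : 0 <= (a + E - g * (D - a)) * (2 * a - t) by rewrite mulr_ge0 // subr_ge0.
      have r3 : 0 <= (g - 1 / 4) * (t * (1 + t)) by rewrite !mulr_ge0 // subr_ge0.
      have r4 : 0 <= t * (t - 1) by rewrite mulr_ge0.
      have r6 : 0 <= D - (2 * a - t) by clear -haD t0; lra.
      have r5 : 0 <= E * (D - (2 * a - t)) by rewrite mulr_ge0.
      clear uE; lra.
    have g40 : 0 <= 1 / 4 - g by rewrite subr_ge0 ltW.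
    have r0 : 0 <= 3 * t - (2 * a - t) by clear -ha_t ht1; lra.
    have r1 : 0 <= (1 / 4 - g) * (u * (2 * a - t)) by rewrite !mulr_ge0.
    have r2 : 0 <= u * (3 * t - (2 * a - t)) by rewrite mulr_ge0.
    have r3 : 0 <= t * (D - u) by rewrite mulr_ge0.
    clear uE; lra.
  clear hhg pat gt tD6; move: q1 q2 fin; rewrite BE mE uE; lra.
have c10 : 0 <= t * (1 + t) - u * m by rewrite subr_ge0 ltW.
have q2 : 0 <= t * (H2 - H1) by rewrite mulr_ge0.
have q3' : 0 <= BB - (D - 2) * H1 by clear -q2 hB0 mE; rewrite (_ : D - 2 = m + t); lra.
have q3 : 0 <= (t * (1 + t) - u * m) * (BB - (D - 2) * H1) by rewrite mulr_ge0.
have D2 : 0 < D - 2 by clear -hD6; lra.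
rewrite -(@ltr_pM2l _ (D - 2)) //.
have q4 : 0 <= (D - 2) * (u * (BB - (m * H1 + t * H2))) by rewrite mulr_ge0 // ltW.
have step : (D - 2) * (t * ((1 + t) * H1 + u * H2)) <= BB * (t * D).
  have -> : BB * (t * D) = BB * (u * (m + t) + t * (1 + t) - u * m) by rewrite uE mE; ring.
  move: q3 q4; rewrite (_ : D - 2 = m + t); last by rewrite mE; ring.
  clear; lra.
apply: le_lt_trans step _.
have tD0 : 0 < t * D by rewrite mulr_gt0 //; clear -hD6; lra.
apply: (@le_lt_trans _ _ ((2 * (D - 2) + 2 + E) * (t * D))).
  by rewrite ler_wpM2r // ltW.
rewrite -subr_gt0.
have -> : (D - 2) * (t * (3 * D - E)) - (2 * (D - 2) + 2 + E) * (t * D) =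
  t * (D * (D - 6) + 2 * D - 2 * (E * D) + 2 * E) by ring.
rewrite pmulr_rgt0 //; have : 0 <= D * (D - 6) by rewrite mulr_ge0.
clear -hED hE0 hD6; lra.
Qed.

Section ArithMid.
Variable R : realFieldType.
Variables (D t t3 a g H1 H2 E : R).
Hypothesis D6 : 6 <= D.
Hypothesis t1 : 1 <= t.
Hypothesis tD : t <= D - 2.
Hypothesis t30 : 0 <= t3.
Hypothesis t3t : t3 <= t.
Hypothesis a0 : 0 <= a.
Hypothesis a_t : a <= 1 + t.
Hypothesis aD : 2 * a <= D.
Hypothesis g0 : 0 <= g.
Hypothesis g1 : g <= 1.
Hypothesis E0 : 0 <= E.
Hypothesis ED : E * D <= 1 / 32.
Hypothesis hg : g * (D - a) <= a + E.
Hypothesis H12 : H1 <= H2.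
Hypothesis Hg : 2 <= g + H1.
Hypothesis hB : (D - 2 - t) * H1 + t * H2 <= 2 * (D - 2) + (2 * a - (D - 2)) * g + E.

Ltac localize :=
  have := D6;
  have := t1;
  have := tD;
  have := t30;
  have := t3t;
  have := a0;
  have := a_t;
  have := aD;
  have := g0;
  have := g1;
  have := E0;
  have := ED;
  have := hg;
  have := H12;
  have := Hg;
  have := hB;
  move=> hhB hHg hH12 hhg hED hE0 hg1 hg0 haD ha_t ha0 ht3t ht30 htD ht1 hD6.

Lemma arith_E : E <= 1 / 192.
Proof.
localize.
have : 0 <= E * (D - 6) by rewrite mulr_ge0 ?subr_ge0 //; lra.
lra.
Qed.

Lemma arith_H2 : H2 <= 5 + E.
Proof.
localize.
have p1 : 0 <= (D - 2 - t) * (g + H1 - 2) by rewrite mulr_ge0 ?subr_ge0 //; lra.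
have p2 : 0 <= (2 + 2 * t - 2 * a) * g by rewrite mulr_ge0 ?subr_ge0 //; lra.
have p3 : 0 <= (2 + t) * (1 - g) by rewrite mulr_ge0 ?subr_ge0 //; lra.
have h : t * H2 <= 3 * t + 2 + E by lra.
rewrite leNgt; apply/negP => h2.
have p4 : 0 <= (t - 1) * (H2 - 3) by rewrite mulr_ge0 ?subr_ge0 //; lra.
lra.
Qed.

Lemma arith_B : 2 * (D - 2) + (2 * a - (D - 2)) * g + E <= 2 * (D - 2) + 2 + E.
Proof.
localize.
have p1 : 0 <= (D - 2 * a) * g by rewrite mulr_ge0 ?subr_ge0 //; lra.
lra.
Qed.

Lemma arith_H1 : H1 <= 3.
Proof.
localize.
have B := arith_B; have e := arith_E.
have p1 : 0 <= t * (H2 - H1) by rewrite mulr_ge0 ?subr_ge0 //; lra.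
have p2 : (D - 2) * H1 <= 2 * (D - 2) + 2 + E by lra.
rewrite -(@ler_pM2l _ (D - 2)); last by lra.
lra.
Qed.

Lemma arith_at : a * (2 * a - t) <= t * D.
Proof.
localize.
have p0 : 0 <= t * (D - 2 * a) by rewrite mulr_ge0 ?subr_ge0 //; lra.
have p0' : 0 <= t * (D - 6) by rewrite mulr_ge0 ?subr_ge0 //; lra.
have [a2|a2] := leP a 2.
  have p1 : 0 <= a * (2 - a) by rewrite mulr_ge0 ?subr_ge0 //; lra.
  have p2 : 0 <= a * (t - 1) by rewrite mulr_ge0 ?subr_ge0 //; lra.
  lra.
have [a3|a3] := leP a 3.
  have p1 : 0 <= (a - 2) * (3 - a) by rewrite mulr_ge0 ?subr_ge0 //; lra.
  have p2 : 0 <= (6 + a) * (1 + t - a) by rewrite mulr_ge0 ?subr_ge0 //; lra.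
  lra.
have p1 : 0 <= a * (3 * t - 2 * a) by rewrite mulr_ge0 ?subr_ge0 //; lra.
lra.
Qed.

(** The hypothesis is the flux at [b.+4] as it arises in [all_first]. Since [H1 <= 3] and
    [H2 <= 5 + E], it is weakest for [eps = 1] and [t3 = 0], where [arith_O] refutes it. *)
Lemma arith_mid (eps : R) : 0 <= eps -> eps <= 1 ->
  5 * (D + 2 + t3 - 2 * eps) - 4 + 2 * t3 - 2 * (D - 2) - E <=
  (2 + t - eps) * H1 + (D - t + t3 - eps) * H2 -> False.
Proof.
localize.
move=> e0 e1 h; have O := arith_O D6 t1 tD a_t aD g0 E0 ED hg H12 Hg hB arith_E arith_B arith_at; have h1 := arith_H1; have h2 := arith_H2; have e := arith_E.
have p1 : 0 <= (1 - eps) * (10 - H1 - H2) by rewrite mulr_ge0 ?subr_ge0 //; lra.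
have p2 : 0 <= t3 * (7 - H2) by rewrite mulr_ge0 ?subr_ge0 //; lra.
suff : 1 <= 0 :> R by rewrite ler10.
lra.
Qed.

End ArithMid.

(** * Heights above a place without slack *)

Section RegularMid.
Variables (R : realFieldType) (n : nat) (A : rel nat) (x : nat -> R).
Hypothesis rk : ranked n A x.

Local Notation nb := (nbrs A).
Local Notation dn := (dnsum A x).
Local Notation flux := (cutflux n A x).
Local Notation ecut := (cutsize n A).
Local Notation kirch := (kirch n A x).

Let xle := xle rk.

Variables (d : nat).
Hypothesis d4 : (4 <= d)%N.
Hypothesis degd : forall z, (z < n)%N -> nb 0 n z = d.

Local Notation c := (2 * (d%:R - 2) : R).

Let d4R : 4 <= d%:R :> R. Proof. by rewrite (ler_nat _ 4). Qed.

Local Notation mid := (midpt x).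
Local Notation stuckE := (stuckE x).

Variables (kap del : R) (b S : nat).
Hypothesis kap0 : 0 <= kap.
Hypothesis kapd : d%:R * kap <= 1 / 8.
Hypothesis del0 : 0 <= del.
Hypothesis dk : del <= kap.
Hypothesis dS : (d.+1 < S)%N.
Hypothesis st : stuckE kap b S.
Hypothesis bn : (b + d.+3 < n)%N.
Hypothesis fl : forall k, (b < k <= b + d.+2)%N -> flux k <= c.
Hypothesis kir : forall z, (b < z <= b + d.+2)%N -> kirch z <= del.

Local Notation e0 := (ecut b.+1).
Local Notation e1 := (ecut b.+2).
Local Notation a0 := (nb 0 b.+2 b.+2).
Local Notation a1 := (nb b.+2 n b.+1).
Local Notation gam := ((x b.+1 - x b) / 2).

Let k32 : kap <= 1 / 32. Proof. by have := ler_wpM2r kap0 d4R; move: kapd; lra. Qed.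

Lemma not_prev2 : e0 = 2%N -> (3 <= e1)%N -> False.
Proof.
move=> e2 h3; have D := d4R; have K := k32.
have [hd hdk] : 0 <= del /\ del <= kap by [].
have b1n : (b.+1 < n)%N by clear -bn; lia.
have f1 := fl (k := b.+1) ltac:(clear -d4; lia).
have G := le_trans (ecut_gap rk b.+1) f1; rewrite /= e2 in G.
have kj : kirch b.+1 <= del by apply: kir; clear -d4; lia.
have s := @st d ltac:(clear -dS d4; lia).
have s' := @st d.-1 ltac:(clear -dS d4; lia).
have dm : d.-1%:R = d%:R - 1 :> R by rewrite -[1]/(1%:R) -natrB ?subn1 //; clear -d4; lia.
rewrite dm in s'.
have /andP[_ m2] := mid_le rk (b + d).
have /andP[_ m2'] := mid_le rk (b + d.-1).
have bd' : ((b + d.-1).+1 = b + d)%N by clear -d4; lia.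
rewrite bd' in m2'.
have m5 : mid b = x b.+1 - gam by rewrite /midpt; lra.
have /andP[m6 _] := mid_le rk b.
have bd : (b.+1 + d.-1 = b + d)%N by clear -d4; lia.
have bd2 : (b.+1 + d = (b + d).+1)%N by clear -d4; lia.
suff : 1 <= 0 :> R by rewrite ler10.
have [a0|[a2 l0]|[a1 [y [yr lowy low0]]]] := cut2_cases rk e2 b1n.
- have := @plateau _ _ _ _ rk _ d4 degd _ del b1n a0 kj; rewrite bd2; lra.
- have d5 : 5 <= d%:R :> R.
    rewrite (ler_nat _ 5); have := @ecut_next _ _ _ _ rk _ degd b.+1 b1n.
    by rewrite e2 a2; clear -h3; lia.
  have := @U_bound _ _ _ _ rk _ d4 degd b.+1 (b + d)%N b.+1 ltac:(clear; lia) ltac:(clear -bn; lia)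
    a2 l0 (fl (k := b.+2) ltac:(clear -d4; lia)) (fl (k := (b + d)%N) ltac:(clear -d4; lia)).
  rewrite ltnn /= addr0 (_ : 3 * c = (d%:R - 2) * 6); last by ring.
  rewrite ler_pM2l; last lra.
  by move: s; rewrite {2}/midpt; lra.
have [yK|Ky] := ltnP y (b + d); last first.
  have := @cut2_out _ _ _ _ rk _ d4 degd b y del ltac:(clear -bn; lia) a1 ltac:(clear -yr Ky; lia)
    ltac:(by rewrite lowy) low0 kj f1 (fl (k := (b + d)%N) ltac:(clear -d4; lia)).
  have p1 : 0 <= (2 * d%:R - 1) * (x (b + d)%N - x b - (d%:R - 1 - kap)) by rewrite mulr_ge0 ?subr_ge0 //; lra.
  move: kapd; lra.
have pr : pair_at n A d b.+1 y by split=> //; clear -yK yr d4; lia.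
have g1 := @dn_ge1 _ _ _ _ rk b.+1 b.+1 (leqnn _) ltac:(by rewrite a1).
rewrite /= in g1.
(* If the edge into [b.+1] uses at least one unit of flux, the other end [y] is a unit lower than
   the flux alone allows; otherwise Kirchhoff at [b.+1] keeps [x] too flat over the window. *)
have [al|al] := leP 1 (dn b.+1 b.+1).
  have nx := @pair_next _ _ _ _ rk _ d4 degd b.+1 y del ltac:(clear -bn; lia) pr f1.
  rewrite bd bd2 in nx.
  have {}nx := nx (fl (k := (b + d)%N) ltac:(clear -d4; lia)) (fl (k := (b + d).+1) ltac:(clear -d4; lia)) kj
    (kir (z := y) ltac:(clear -yK yr; lia)) hd.
  have t2 := @two_dn _ _ _ _ rk d b.+1 b.+1 y ltac:(clear -bn d4; lia) ltac:(clear -yr d4; lia) ltac:(clear -yr d4; lia) f1.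
  have g2 := @dn_ge1 _ _ _ _ rk b.+1 y ltac:(clear -yr d4; lia) ltac:(by rewrite lowy).
  rewrite /= in g2.
  by move: s; rewrite /midpt; lra.
have := @up_kirch _ _ _ _ rk (d - 2) b.+1 b1n.
have -> : (b.+2 + (d - 2) = b + d)%N by clear -d4; lia.
have nbu := @nb_self _ _ _ _ rk _ degd b.+1 b1n; rewrite a1 in nbu.
move=> /(_ ltac:(clear -nbu d4; lia)).
lra.
Qed.

Hypothesis kapd2 : d%:R ^+ 2 * kap <= 1 / 64.

Local Notation H := (fun j => x (b.+1 + j)%N - mid b + 2 * kap).

(** The shift by 2 [kap] in [H] absorbs the slack, so that the heights obey clean integer bounds. *)
Lemma H_pair j : (0 < j <= d.+1)%N -> 2 * (j%:R + 1) <= H j + H j.+1.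
Proof.
move=> hj; have := @st j.+1 ltac:(clear -hj dS; lia).
rewrite -natr1 {2}/midpt /= !addSn !addnS; have := kap0; lra.
Qed.

Lemma H_ge j : (1 < j <= d.+2)%N -> j%:R <= H j.
Proof.
case: j => // j hj; have := @H_pair j ltac:(clear -hj; lia); rewrite /= -natr1.
have := @xle (b.+1 + j)%N (b.+1 + j.+1)%N ltac:(clear; lia); lra.
Qed.

Lemma H_gam : 2 <= gam + H 1%N.
Proof.
have := @st 1%N ltac:(clear -dS; lia).
rewrite /midpt /= !addn1; have := kap0; lra.
Qed.

(** Only sums of neighbouring heights are controlled, so the smallest possible partial sums are
    those of 3, 5, 5, 5, and so on. *)
Lemma sumH3 u : (u <= d)%N -> 5 * u%:R - 2 <= \sum_(0 <= t < u) H (3 + t)%N.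
Proof.
elim: u => [|u IHu] ud; first by rewrite big_geq //; lra.
have {}IHu := IHu (ltnW ud); rewrite big_nat_recr //=.
have h3 := @H_ge (3 + u)%N ltac:(clear -ud d4; lia).
rewrite natrD in h3; rewrite -natr1.
case: u ud IHu h3 => [|[|u]] ud IHu h3.
- by rewrite big_geq //; lra.
- rewrite big_nat1; have := @H_pair 3 ltac:(clear -ud d4; lia); rewrite /=; lra.
have : 2 <= u.+2%:R :> R by rewrite (ler_nat _ 2).
by move: h3 IHu => /=; lra.
Qed.

Lemma sumH1 u : (0 < u <= d)%N -> gam <= 1 ->
  2 * u%:R - 2 * gam <= \sum_(0 <= t < u) (H t.+1 - gam).
Proof.
move=> + g1; elim: u => // u IHu ud; rewrite big_nat_recr //=.
case: u IHu ud => [_ ud|[|u] IHu ud].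
- by rewrite big_geq //; have := H_gam => /=; lra.
- rewrite big_nat1; have := @H_pair 1 ltac:(clear -ud d4; lia); rewrite /=; lra.
have {}IHu := IHu ltac:(clear -ud; lia).
have := @H_ge u.+3 ltac:(clear -ud; lia).
have : 3 <= u.+3%:R :> R by rewrite (ler_nat _ 3).
rewrite -[u.+3%:R]natr1; move: IHu => /=; lra.
Qed.

End RegularMid.

(** * Cuts of nearly full size: the late shape *)

Section RegularWide.
Variables (R : realFieldType) (n : nat) (A : rel nat) (x : nat -> R).
Hypothesis rk : ranked n A x.

Local Notation nb := (nbrs A).
Local Notation up := (upsum n A x).
Local Notation flux := (cutflux n A x).
Local Notation ecut := (cutsize n A).

Let Asym : symmetric A. Proof. by case: rk. Qed.
Let xle := xle rk.

Variables (d : nat).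
Hypothesis d4 : (4 <= d)%N.
Hypothesis degd : forall z, (z < n)%N -> nb 0 n z = d.

Local Notation c := (2 * (d%:R - 2) : R).

Let d4R : 4 <= d%:R :> R. Proof. by rewrite (ler_nat _ 4). Qed.

Local Notation mid := (midpt x).
Local Notation stuckE := (stuckE x).
Hypothesis dev : ~~ odd d.

Variables (kap del : R) (b S : nat).
Hypothesis kap0 : 0 <= kap.
Hypothesis kapd : d%:R * kap <= 1 / 8.
Hypothesis dS : (d.+1 < S)%N.
Hypothesis st : stuckE kap b S.
Hypothesis bn : (b + d.+3 < n)%N.
Hypothesis fl : forall k, (b < k <= b + d.+2)%N -> flux k <= c.

Local Notation e0 := (ecut b.+1).
Local Notation e1 := (ecut b.+2).
Local Notation a0 := (nb 0 b.+2 b.+2).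
Local Notation a1 := (nb b.+2 n b.+1).
Local Notation gam := ((x b.+1 - x b) / 2).

Hypothesis kapd2 : d%:R ^+ 2 * kap <= 1 / 64.
Hypothesis d6 : (6 <= d)%N.
Hypothesis wide0 : (d - 2 <= e0)%N.
Hypothesis wide1 : (d - 2 <= e1)%N.

Local Notation H := (fun j => x (b.+1 + j)%N - mid b + 2 * kap).

Let e_prev : (e0 + 2 * a1 = e1 + d)%N := prev_ecut rk degd bn.

Lemma gam_le1 : gam <= 1.
Proof. by have := gap_le2 rk d4 wide0 (fl (k := b.+1) ltac:(clear -d4; lia)) => /=; lra. Qed.

Lemma first_cut :
  \sum_(0 <= t < a1) (H t.+1 - gam) + (e1%:R - a1%:R) * (H 1%N + gam) <= c + 2 * kap * e1%:R.
Proof.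
have f := fl (k := b.+2) ltac:(clear -d4; lia).
rewrite /cutflux big_nat_recr //= in f.
have u1 := @up_ge _ _ _ _ rk a1 b.+2 b.+1 (leqnSn _) (leqnn _).
have m5 : mid b = x b.+1 - gam by rewrite /midpt; lra.
have eE : e1%:R = (\sum_(0 <= z < b.+1) nb b.+2 n z)%N%:R + a1%:R :> R.
  by rewrite -natrD /cutsize big_nat_recr.
have u2 : (\sum_(0 <= z < b.+1) nb b.+2 n z)%N%:R * (x b.+2 - x b) <= \sum_(0 <= z < b.+1) up b.+2 z.
  rewrite natr_sum mulr_suml [leLHS]big_nat [leRHS]big_nat; apply: ler_sum => z /andP[_ zb].
  have zb2 : (z <= b.+2)%N by clear -zb; lia.
  apply: le_trans (up_ge_nb rk zb2); rewrite ler_wpM2l // lerD2l lerN2 xle //.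
have s1 : \sum_(0 <= t < a1) (H t.+1 - gam) =
   \sum_(0 <= t < a1) (x (b.+2 + t)%N - x b.+1) + 2 * kap * a1%:R.
  have -> : 2 * kap * a1%:R = \sum_(0 <= t < a1) (2 * kap).
    by rewrite sumr_const_nat subn0 mulr_natr.
  rewrite -big_split /=; apply: eq_bigr => t _; rewrite addnS addSn m5; ring.
rewrite s1 /= addn1 m5; move: f u1 u2 eE.
move: (\sum_(0 <= z < b.+1) _)%N%:R (\sum_(0 <= z < b.+1) _) (\sum_(0 <= t < a1) _) => S1 S2 S3 f u1 u2 ->.
lra.
Qed.

(** By [sumH1] an edge of this cut costs about 2 on average while the flux is 2(d - 2); hence fewer
    than d edges, and parity leaves d - 2. *)
Lemma e1_eq : e1 = (d - 2)%N.
Proof.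
have D := d4R; have g1 := gam_le1; have g0 := gam_ge0 rk b; have f := first_cut; have k0 := kap0.
have hg : 2 <= gam + H 1%N := H_gam kap0 dS st.
have al : a1%:R <= e1%:R :> R by rewrite ler_nat; exact: a1_le.
have p1 : 0 <= (e1%:R - a1%:R) * (gam + H 1%N - 2) by rewrite mulr_ge0 ?subr_ge0 //; lra.
have tot : 2 * e1%:R - 2 * gam <= c + 2 * kap * e1%:R.
  have [a0|a0] := posnP a1.
    by move: f p1; rewrite a0 big_geq //; lra.
  have ad : (0 < a1 <= d)%N.
    rewrite a0 /=; apply: leq_trans (_ : (nb 0 n b.+1 <= d)%N).
      by rewrite (@nb_cat A b.+2 0 n) ?leq_addl //; clear -bn; lia.
    by rewrite degd //; clear -bn; lia.
  have := sumH1 rk d4 kap0 dS st ad g1; move: f p1.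
  by move: (\sum_(0 <= t < a1) _) => S1; lra.
have kd := kapd.
have : (e1 < d)%N.
  rewrite ltnNge; apply/negP => de; have deR : d%:R <= e1%:R :> R by rewrite ler_nat.
  have p2 : 0 <= (e1%:R - d%:R) * (2 - 2 * kap).
    rewrite mulr_ge0 //; first by lra.
    have := kap_small d4 kap0 kapd; lra.
  suff : 1 <= 0 :> R by rewrite ler10.
  lra.
have ev := @ecut_even _ _ _ _ rk _ degd b.+2 dev ltac:(clear -bn; lia).
have := odd_double_half e1; have := odd_double_half d; rewrite (negPf ev) (negPf dev) -!mul2n.
clear -wide1; lia.
Qed.

Let e1R : e1%:R = d%:R - 2 :> R.
Proof. by rewrite e1_eq natrB //; clear -d4; lia. Qed.

(** In [pass_cut] the second step is at least about 2 - 2 [gam] by [H_gam], and [e_prev] expresses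
    the previous cut size through [a1]. *)
Lemma gam_bound : gam * (d%:R - a1%:R) <= a1%:R + kap * d%:R.
Proof.
have pc := le_trans (pass_cut rk bn) (fl (k := b.+1) ltac:(clear -d4; lia)).
have k0 := kap0; have D := d4R.
have hg : 2 <= gam + H 1%N := H_gam kap0 dS st.
have e0R : e0%:R = 2 * d%:R - 2 - 2 * a1%:R :> R.
  by have := congr1 (fun m => m%:R : R) e_prev; rewrite mul2n -addnn !natrD e1R; lra.
have al : a1%:R <= d%:R - 2 :> R by rewrite -e1R ler_nat; exact: a1_le.
have a10 : 0 <= a1%:R :> R by [].
rewrite e0R e1R in pc; rewrite /= addn1 in hg.
have m5 : mid b = x b.+1 - gam by rewrite /midpt; lra.
have p1 : 0 <= (d%:R - 2 - a1%:R) * (x b.+2 - x b.+1 - (2 - 2 * gam - 2 * kap)).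
  by rewrite mulr_ge0 ?subr_ge0 //; lra.
have p2 : 0 <= kap * (2 + a1%:R) by rewrite mulr_ge0 ?subr_ge0 //; lra.
lra.
Qed.

Ltac lin := clear -rk Asym xle d4 degd d4R dev kap0 kapd dS st bn fl kapd2 d6 wide0 wide1 e_prev e1R R n A x d kap del b S; lra.

(** Let t edges of the cut end above [b.+2]. If t > 0, the flux through [b.+4] has to carry the
    upper edges of [b.+2] and [b.+3] as well as the [t3] edges passing over both, which the heights
    of [sumH3] make too expensive. *)
Lemma all_first : a0 = (d - 2)%N.
Proof.
have D := d4R; have g1 := gam_le1; have g0 := gam_ge0 rk b; have k0 := kap0.
have b2n : (b.+2 < n)%N by clear -bn; lia.
have b3n : (b.+3 < n)%N by clear -bn d4; lia.
have [t tE] : exists t, (t + a0 = d - 2)%N.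
  by exists (d - 2 - a0)%N; rewrite subnK // -e1_eq (ecut_dn rk) [X in (_ <= X)%N]big_ltn // leq_addr.
have [t0|t1] := posnP t; first by rewrite -tE t0.
exfalso.
have ende := @ends_le _ _ _ _ rk b.+2 ltac:(clear -bn; lia); rewrite /= e1_eq -tE in ende.
have at_ : (a1 <= t.+1)%N by clear -ende; lia.
have aD : (2 * a1 <= d)%N by have := e_prev; rewrite e1_eq; clear -wide0 d4; lia.
have f1 := le_trans (flux_low rk b) (lerD (fl (k := b.+2) ltac:(clear -d4; lia)) (lexx _)).
lazy zeta in f1; rewrite -/(mid b) e1R big_ltn // in f1.
have restE : (\sum_(b.+3 <= z < n) nb 0 b.+2 z = t)%N.
  by have := e1_eq; rewrite (ecut_dn rk) big_ltn // -tE; clear; lia.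
have f1' : t%:R * (x b.+3 - mid b) <= \sum_(b.+3 <= z < n) (nb 0 b.+2 z)%:R * (x z - mid b).
  rewrite -restE natr_sum mulr_suml [leLHS]big_nat [leRHS]big_nat; apply: ler_sum => z /andP[zb _].
  by rewrite ler_wpM2l // lerD2r xle.
have a0R : a0%:R = d%:R - 2 - t%:R :> R.
  by rewrite -e1R e1_eq -tE natrD; ring.
set nq := nb 0 b.+2 b.+3; set eps := A b.+2 b.+3.
have [t3 t3E] : exists t3, (t3 + nq = t)%N.
  by exists (t - nq)%N; rewrite subnK // -restE big_ltn ?leq_addr //.
have cnt3 : (\sum_(0 <= z < b.+2) nb b.+4 n z = t3)%N.
  have := e1_eq; rewrite /cutsize (eq_bigr (fun z => (A z b.+2 + (A z b.+3 + nb b.+4 n z))%N)); last first.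
    by move=> z _; rewrite -!nb_recl //; clear -bn d4; lia.
  rewrite !big_split /=.
  have -> : (\sum_(0 <= z < b.+2) A z b.+2 = a0)%N by apply: eq_bigr => z _; rewrite Asym.
  have -> : (\sum_(0 <= z < b.+2) A z b.+3 = nq)%N by apply: eq_bigr => z _; rewrite Asym.
  by rewrite -tE -t3E; clear; lia.
have b4n : (b.+4 <= n)%N by clear -bn d4; lia.
have upE : (nb b.+4 n b.+2 + a0 + eps = d)%N.
  have := @nb_self _ _ _ _ rk _ degd b.+2 b2n; rewrite (nb_recl _ _ b3n) /eps; clear; lia.
have uqE : (nb b.+4 n b.+3 + nq + eps = d)%N.
  have := @nb_self _ _ _ _ rk _ degd b.+3 b3n; rewrite (@nb_cat A b.+2 0 b.+3) // nb1 -/nq /eps Asym; clear; lia.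
(* All counts of edges past [b.+3] are now expressed through t, [t3] and the adjacency [eps] of
   [b.+2] and [b.+3]; this flux is what they must fit into. *)
have f3 := fl (k := b.+4) ltac:(clear -d6; lia).
rewrite /cutflux 2?big_nat_recr //= in f3.
have m5 : mid b = x b.+1 - gam by rewrite /midpt; lra.
have h3 : 3%:R <= H 3%N := H_ge rk kap0 dS st (j := 3%N) ltac:(clear -d4; lia).
rewrite /= addnS addn2 in h3.
have low3 : t3%:R * (2 - 2 * kap) <= \sum_(0 <= z < b.+2) up b.+4 z.
  rewrite -cnt3 natr_sum mulr_suml [leLHS]big_nat [leRHS]big_nat; apply: ler_sum => z /andP[_ zb].
  have zb4 : (z <= b.+4)%N by clear -zb; lia.
  apply: le_trans (up_ge_nb rk zb4); apply: ler_wpM2l => //.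
  have := @xle z b.+1 zb; lra.
have upp := @up_ge _ _ _ _ rk _ b.+4 b.+2 (leqW (leqnSn _)) (leqnn _).
have upq := @up_ge _ _ _ _ rk _ b.+4 b.+3 (leqnSn _) (leqnn _).
have sH u v : (u <= d)%N -> u%:R * (5 - H v) - 2 <= \sum_(0 <= t < u) (x (b.+4 + t)%N - x (b.+1 + v)%N).
  move=> ud; have := sumH3 rk d4 kap0 dS st ud.
  have -> : \sum_(0 <= t < u) (x (b.+4 + t)%N - x (b.+1 + v)%N) =
     \sum_(0 <= t < u) (H (3 + t)%N) - u%:R * H v.
    have -> : u%:R * H v = \sum_(0 <= t < u) H v by rewrite sumr_const_nat subn0 mulr_natl.
    rewrite -sumrB; by apply: eq_bigr => i _; rewrite /= addnA addnS addn2; ring.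
  by move: (\sum_(0 <= t < u) _) => S1 /=; lin.
have sp := @sH (nb b.+4 n b.+2) 1%N ltac:(clear -upE; lia).
have sq := @sH (nb b.+4 n b.+3) 2%N ltac:(clear -uqE; lia).
rewrite addn1 in sp; rewrite addn2 in sq.
have uR : (nb b.+4 n b.+2)%:R = 2 + t%:R - eps%:R :> R.
  have := congr1 (fun m => m%:R : R) upE; rewrite !natrD a0R; lin.
have t3R : t3%:R + nq%:R = t%:R :> R by rewrite -natrD t3E.
have qR : (nb b.+4 n b.+3)%:R = d%:R - t%:R + t3%:R - eps%:R :> R.
  have := congr1 (fun m => m%:R : R) uqE; rewrite !natrD; move: t3R; lin.
rewrite uR in sp; rewrite qR in sq.
have kd0 : 0 <= kap * d%:R by rewrite mulr_ge0.
have tR1 : 1 <= t%:R :> R by rewrite (ler_nat _ 1).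
have t3le : t3%:R <= t%:R :> R by rewrite ler_nat -t3E leq_addr.
have tDR : t%:R <= d%:R - 2 :> R by rewrite -e1R ler_nat e1_eq -tE leq_addr.
have h12 : x b.+2 - mid b + 2 * kap <= x b.+3 - mid b + 2 * kap by rewrite !lerD2r xle.
have hg : 2 <= gam + H 1%N := H_gam kap0 dS st.
have gb := gam_bound.
rewrite /= addn1 in hg.
have kt : 0 <= kap * (d%:R - t3%:R) by rewrite mulr_ge0 ?subr_ge0 //; move: t3le tDR; lin.
apply: (@arith_mid R d%:R t%:R t3%:R a1%:R gam
   (x b.+2 - mid b + 2 * kap) (x b.+3 - mid b + 2 * kap) (2 * (kap * d%:R)) _ _ _ _ _ _ _ _ _ _ _ _ _ _ _ _ eps%:R).
all: clear sH.
- by rewrite (ler_nat _ 6).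
- by [].
- by [].
- by [].
- by [].
- by [].
- by rewrite addrC natr1 ler_nat.
- by rewrite -natrM ler_nat.
- by [].
- by [].
- by rewrite mulr_ge0.
- by move: kapd2; rewrite expr2; lin.
- by lra.
- by [].
- by [].
- rewrite a0R in f1; move: f1 f1'; move: (\sum_(b.+3 <= z < n) _) => S1 f1 f1'; lra.
- by [].
- by case: (eps).
move: f3 low3 upp upq sp sq.
move: (\sum_(0 <= z < b.+2) _) (\sum_(0 <= t < nb b.+4 n b.+2) _) (\sum_(0 <= t < nb b.+4 n b.+3) _) (up b.+4 b.+2) (up b.+4 b.+3) => S1 S2 S3 U1 U2 f3 low3 upp upq sp sq.
lra.
Qed.

Lemma wide_late : [/\ nb b.+3 n b.+2 = 2%N, ecut b.+3 = 2%N &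
  (d%:R - 2) * (x b.+2 - mid b) <= c - (d%:R - 4) * gam].
Proof.
have b2n : (b.+2 < n)%N by clear -bn; lia.
have s := @nb_self _ _ _ _ rk _ degd b.+2 b2n.
have en := @ecut_next _ _ _ _ rk _ degd b.+2 b2n.
have ende := @ends_le _ _ _ _ rk b.+2 ltac:(clear -bn; lia); rewrite /= in ende.
rewrite all_first in s en ende; rewrite e1_eq in en ende.
split; [by clear -s d4; lia | by clear -en d4; lia |].
have := low_first rk d4 fl; rewrite e1R => lf.
have al : a1%:R <= 1 :> R by rewrite (ler_nat _ _ 1); clear -ende; lia.
have : 0 <= (1 - a1%:R) * gam by rewrite mulr_ge0 ?subr_ge0 // (gam_ge0 rk).
lra.
Qed.

End RegularWide.

(** * Separation of entries and exits in a window *)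

Section RegularAssembly.
Variables (R : realFieldType) (n : nat) (A : rel nat) (x : nat -> R).
Hypothesis rk : ranked n A x.

Local Notation nb := (nbrs A).
Local Notation ecut := (cutsize n A).

Let Asym : symmetric A. Proof. by case: rk. Qed.
Let Airr : irreflexive A. Proof. by case: rk. Qed.
Let Alt : forall i j, A i j -> (j < n)%N. Proof. by case: rk. Qed.
Let xle := xle rk.

Variables (d : nat).
Hypothesis d4 : (4 <= d)%N.
Hypothesis degd : forall z, (z < n)%N -> nb 0 n z = d.


Local Notation U_at := (U_at n A).
Local Notation V_at := (V_at n A d).

(** The entry is [k], with at most d - 2 neighbours in the window. Each of the d other vertices that
    is not a neighbour of [k] needs an exit edge, and there are at least two of these. Two exit
    edges are all there are, so neither [k] nor any of its neighbours is an exit. *)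
Lemma good_U k : (k + d.+1 <= n)%N -> U_at k -> ecut (k + d.+1)%N = 2%N -> good A k (k + d.+1)%N.
Proof.
move=> kn [lk l0] e2; set k' := (k + d.+1)%N in kn e2 *.
have kk' : (k < k')%N by rewrite /k'; clear; lia.
have kn' : (k < n)%N := leq_trans kk' kn.
have only u y : (u < k)%N -> (k <= y)%N -> A u y -> y = k.
  move=> uk ky Auy; apply/eqP; apply: contraT => yk.
  have := @le_nb A 0 k y u ltac:(by rewrite uk) ltac:(by rewrite Asym).
  by rewrite l0 // (Alt Auy) andbT ltn_neqAle eq_sym yk.
have tot : (nb k' n k + \sum_(k.+1 <= z < k') nb k' n z <= 2)%N.
  rewrite -e2 -big_ltn // /cutsize (@big_cat_nat _ _ _ k 0 k') //=; last exact: ltnW.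
  by rewrite leq_addl.
have ext z : (k < z < k')%N -> (1 - A k z <= nb k' n z)%N.
  move=> zr; have zn : (z < n)%N by clear -zr kn; lia.
  have := degd zn; rewrite (@nb_cat A k 0 n) //; last exact: ltnW.
  rewrite l0 ?add0n; last by clear -zr zn; lia.
  rewrite (nb_recl _ _ kn') (@nb_cat A k' k.+1 n) // [A z k]Asym.
  have := @nb_le_self _ _ _ _ rk k.+1 k' z zr.
  by rewrite /k'; clear -d4; lia.
have deg_k : (nb k.+1 k' k + nb k' n k = d - 2)%N.
  have := @nb_self _ _ _ _ rk _ degd k kn'; rewrite lk (@nb_cat A k' k.+1 n) //; clear; lia.
have s1 : (\sum_(k.+1 <= z < k') (1 - A k z) = d - nb k.+1 k' k)%N.
  have : (\sum_(k.+1 <= z < k') ((1 - A k z) + A k z) = d)%N.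
    rewrite (eq_bigr (fun=> 1%N)); last by move=> z _; case: (A k z).
    by rewrite sum_nat_const_nat muln1 /k'; clear; lia.
  by rewrite big_split /= -/(nb k.+1 k' k) => h; rewrite -h addnK.
have le1 : (\sum_(k.+1 <= z < k') (1 - A k z) <= \sum_(k.+1 <= z < k') nb k' n z)%N.
  by rewrite big_nat [X in (_ <= X)%N]big_nat; apply: leq_sum => z; exact: ext.
have up0 : nb k' n k = 0%N by rewrite s1 in le1; clear -le1 tot deg_k d4; lia.
split=> [u v uk k'v|u y x' w uk yW x'W k'w Auy Ax'w].
  apply/negP => Auv; have := only u v uk ltac:(clear -kk' k'v; lia) Auv.
  by clear -kk' k'v; lia.
rewrite (only u y uk ltac:(by case/andP: yW) Auy).
have ux : (0 < nb k' n x')%N by apply: (@le_nb A k' n x' w) => //; rewrite k'w (Alt Ax'w).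
have kx : k != x' by apply: contraTneq ux => <-; rewrite up0.
rewrite kx /=; apply/negP => Akx.
have x'r : (k.+1 <= x' < k')%N by clear -x'W kx; lia.
have : (\sum_(k.+1 <= z < k') (1 - A k z) < \sum_(k.+1 <= z < k') nb k' n z)%N.
  rewrite !(bigD1_seq x') ?mem_index_iota ?iota_uniq //= Akx subnn add0n.
  apply: (@leq_ltn_trans (\sum_(k.+1 <= z < k' | z != x') nb k' n z)); last first.
    by rewrite -[X in (X < _)%N]add0n ltn_add2r.
  rewrite big_nat_cond [X in (_ <= X)%N]big_nat_cond; apply: leq_sum => z /andP[zr _]; exact: ext.
by rewrite s1; clear -tot deg_k up0 d4; lia.
Qed.

(** Both exit edges start at the last vertex [r], so every vertex other than [k] and [y] must be
    joined to [r] to have degree d. These already are the d - 2 inner neighbours of [r], so the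
    entries [k] and [y] are not adjacent to it. *)
Lemma good_V k : (0 < k)%N -> (k + d.+1 <= n)%N -> V_at k -> ecut (k + d.+1)%N = 2%N ->
  nb (k + d.+1) n (k + d)%N = 2%N -> good A k (k + d.+1)%N.
Proof.
move=> k0 kn [_ [y [lk yr ly l0]]] e2 ur; set k' := (k + d.+1)%N in kn e2 ur *; set r := (k + d)%N in ur.
have kr : (k <= r < k')%N by rewrite /r /k'; clear; lia.
have rn : (r < n)%N by clear -kr kn; lia.
have only u v : (u < k)%N -> (k <= v)%N -> A u v -> v = k \/ v = y.
  move=> uk kv Auv; have [|vk] := eqVneq v k; first by left.
  have [|vy] := eqVneq v y; first by right.
  have := @le_nb A 0 k v u ltac:(by rewrite uk) ltac:(by rewrite Asym).
  by rewrite l0 // (Alt Auv) kv.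
have upz z : (z < k')%N -> z != r -> nb k' n z = 0%N.
  move=> zk' zr; apply/eqP; rewrite -leqn0 -(leq_add2r 2) add0n -{1}ur -e2.
  by apply: (@sum_ge2 (nb k' n) 0 k' z r) => //; case/andP: kr.
have kkr : (k <= k < r)%N by rewrite /r; clear -d4; lia.
have kyr : (k <= y < r)%N by rewrite /r; clear -yr; lia.
have kny : k != y by clear -yr; lia.
have adj z : (k <= z < r)%N -> (z != k) && (z != y) -> A r z.
  move=> zr /andP[zk zy]; have zn : (z < n)%N by clear -zr rn; lia.
  have := degd zn; rewrite (@nb_cat A k 0 n) ?l0 //; [|clear -zr zn; lia|clear -rn kr; lia].
  rewrite add0n (@nb_cat A k' k n) // ?upz ?addn0; [|clear -zr kr; lia|clear -zr; lia|clear -kr; lia].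
  rewrite (_ : k' = r.+1); last by rewrite /k' /r addnS.
  rewrite nb_recr; last by clear -kr; lia.
  have := @nb_le_self _ _ _ _ rk k r z zr; rewrite [A z r]Asym.
  by case: (A r z) => //; rewrite /r; clear -d4; lia.
have degr : nb k r r = (d - 2)%N.
  have := degd rn; rewrite (@nb_cat A k 0 n) ?l0 //; [|clear -kr rn; lia|clear -kkr; lia|clear -kyr; lia|clear -rn kr; lia].
  rewrite add0n (@nb_cat A k' k n) ?ur //; [|clear -kr; lia].
  rewrite (_ : k' = r.+1); last by rewrite /k' /r addnS.
  rewrite nb_recr; last by clear -kr; lia.
  by rewrite Airr; clear -d4; lia.
have nadj : (A r k + A r y = 0)%N.
  have := degr; rewrite /nbrs (sum_split2n _ kkr kyr kny).
  have := sum_split2n (fun=> 1%N) kkr kyr kny; rewrite sum_nat_const_nat muln1.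
  have -> : (\sum_(k <= i < r | (i != k) && (i != y)) A r i = \sum_(k <= i < r | (i != k) && (i != y)) 1)%N.
    rewrite big_nat_cond [RHS]big_nat_cond; apply: eq_bigr => z /andP[zr zz].
    by rewrite (adj z zr zz).
  by rewrite /r; clear -d4; lia.
split=> [u v uk k'v|u y' x' w uk yW x'W k'w Auy Ax'w].
  apply/negP => Auv; have := only u v uk ltac:(clear -kr k'v; lia) Auv.
  by clear -kkr kyr kr k'v; lia.
have xr : x' = r.
  apply/eqP; apply: contraT => xr; have := @le_nb A k' n x' w ltac:(by rewrite k'w (Alt Ax'w)) Ax'w.
  by rewrite upz //; case/andP: x'W.
rewrite xr; have [->|->] := only u y' uk ltac:(by case/andP: yW) Auy.
  rewrite [A k r]Asym; move: nadj; case: (A r k) => // _; rewrite andbT; clear -kkr; lia.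
rewrite [A y r]Asym; move: nadj; case: (A r y) => [|_]; first by rewrite addn1.
rewrite andbT; clear -kyr; lia.
Qed.

End RegularAssembly.

(** * Late windows, and what follows a full window *)

Section RegularFinal.
Variables (R : realFieldType) (n : nat) (A : rel nat) (x : nat -> R).
Hypothesis rk : ranked n A x.

Local Notation nb := (nbrs A).
Local Notation up := (upsum n A x).
Local Notation flux := (cutflux n A x).
Local Notation ecut := (cutsize n A).
Local Notation kirch := (kirch n A x).

Let Asym : symmetric A. Proof. by case: rk. Qed.
Let Alt : forall i j, A i j -> (j < n)%N. Proof. by case: rk. Qed.
Let xle := xle rk.

Variables (d : nat).
Hypothesis d4 : (4 <= d)%N.
Hypothesis degd : forall z, (z < n)%N -> nb 0 n z = d.

Local Notation c := (2 * (d%:R - 2) : R).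

Let d4R : 4 <= d%:R :> R. Proof. by rewrite (ler_nat _ 4). Qed.

Local Notation mid := (midpt x).
Local Notation stuckE := (stuckE x).
Local Notation pair_at := (pair_at n A d).
Local Notation U_at := (U_at n A).
Local Notation V_at := (V_at n A d).
Hypothesis dev : ~~ odd d.
Hypothesis conn : forall k, (0 < k < n)%N -> (0 < ecut k)%N.

Variable del : R.
Hypothesis del0 : 0 <= del.

Definition small (kap : R) := (del <= kap) && (d%:R ^+ 2 * kap <= 1 / 64).

Lemma smallP kap : small kap ->
  [/\ 0 <= kap, del <= kap, d%:R * kap <= 1 / 256, kap <= 1 / 1024 & d%:R ^+ 2 * kap <= 1 / 64].
Proof.
move=> /andP[dk kd]; have k0 : 0 <= kap by apply: le_trans dk.
have D := d4R.
have h1 : d%:R * kap <= 1 / 256.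
  have : 0 <= (d%:R - 4) * (d%:R * kap) by rewrite !mulr_ge0 ?subr_ge0 //; lra.
  move: kd; rewrite expr2; lra.
split=> //; have : 0 <= (d%:R - 4) * kap by rewrite mulr_ge0 ?subr_ge0 //; lra.
lra.
Qed.

Definition calm (b L : nat) : Prop :=
  [/\ (b + L < n)%N, forall k, (b < k <= b + L)%N -> flux k <= c
    & forall z, (b < z <= b + L)%N -> kirch z <= del].

Lemma calm_sub b L b' L' : calm b L -> (b <= b')%N -> (b' + L' <= b + L)%N -> calm b' L'.
Proof.
move=> [h1 h2 h3] bb bl; split; first by clear -h1 bl; lia.
- by move=> k hk; apply: h2; clear -hk bb bl; lia.
- by move=> k hk; apply: h3; clear -hk bb bl; lia.
Qed.

Local Notation gam b := ((x b.+1 - x b) / 2).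

(** A whole cut of d - 2 edges ends at rank [b.+2], which sends up only two: a minimal cut one rank
    further than expected, of the kind [V_at]. *)
Definition late_at (b : nat) : Prop :=
  [/\ (6 <= d)%N, nb b.+3 n b.+2 = 2%N, ecut b.+3 = 2%N, nb 0 b.+2 b.+2 = (d - 2)%N &
    (d%:R - 2) * (x b.+2 - mid b) <= c - (d%:R - 4) * gam b].

Lemma trichotomy kap b S : small kap -> (d.+1 < S)%N -> stuckE kap b S -> calm b d.+3 ->
  ecut b.+2 = 2%N \/ ecut b.+2 <> 2%N /\ late_at b.
Proof.
move=> /smallP[k0 dk kd _ kd2] dS st [bn fl kir].
have kd8 : d%:R * kap <= 1 / 8 by lra.
have fl' k : (b < k <= b + d.+2)%N -> flux k <= c by move=> hk; apply: fl; clear -hk; lia.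
have kir' z : (b < z <= b + d.+2)%N -> kirch z <= del by move=> hk; apply: kir; clear -hk; lia.
have dS' : (d < S)%N := ltnW dS.
have two k : (0 < k < n)%N -> ecut k = 2%N \/ (4 <= ecut k)%N /\ ~~ odd (ecut k).
  move=> kr; have ev := @ecut_even _ _ _ _ rk _ degd k dev ltac:(clear -kr; lia).
  have := conn kr; have := odd_double_half (ecut k); rewrite (negPf ev) -mul2n.
  clear; lia.
have [|[h4 ev1]] := two b.+2 ltac:(clear -bn; lia); first by left.
right; split; first by clear -h4; lia.
have wd e : (4 <= e)%N -> ~~ odd e -> ~~ (e + 4 <= d)%N -> (d - 2 <= e)%N.
  move=> e4 ev; have := odd_double_half e; have := odd_double_half d.
  by rewrite (negPf ev) (negPf dev) -!mul2n; clear; lia.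
have [hd|hd] := boolP (ecut b.+2 + 4 <= d)%N.
  by case: (not_narrow rk d4 degd dev k0 kd8 dS' st bn fl' h4 hd).
have w1 := wd _ h4 ev1 hd.
have [e2|[h4' ev0]] := two b.+1 ltac:(clear -bn; lia).
  by case: (not_prev2 rk d4 degd k0 kd8 del0 dk dS st bn fl' kir' e2 (ltnW h4)).
have [hd'|hd'] := boolP (ecut b.+1 + 4 <= d)%N.
  by case: (not_narrow_prev rk d4 degd k0 kd8 dS' st bn fl' h4' hd').
have w0 := wd _ h4' ev0 hd'.
have [d6|d6] := leqP 6 d; last first.
  have dE : d = 4%N.
    by have := odd_double_half d; rewrite (negPf dev) -mul2n; clear -d6 d4; lia.
  by case: (not_dense4 rk d4 degd k0 kd8 dS' st bn fl' dE h4' h4).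
have [l1 l2 l3] := wide_late rk d4 degd dev k0 kd8 dS st bn fl' kd2 d6 w0 w1.
have l4 := all_first rk d4 degd dev k0 kd8 dS st bn fl' kd2 d6 w0 w1.
by split.
Qed.

Lemma V_upper j y : (j.+1 < n)%N -> nb j.+1 n j = 2%N -> ecut j.+1 = 2%N -> pair_at j.+1 y ->
  flux j.+1 <= c -> x j.+1 + x y <= 2 * x j + c.
Proof.
move=> jn uj e2 [l1 yr ly l0] f.
have z0 z : (z < j)%N -> nb j.+1 n z = 0%N.
  move=> zj; apply/eqP; rewrite -leqn0 -(leq_add2r 2) add0n -{1}uj -e2.
  by apply: (@sum_ge2 (nb j.+1 n) 0 j.+1 z j) => //=; clear -zj; lia.
have yn : (y < n)%N.
  by have := @nb_gt0 A 0 j.+1 y ltac:(by rewrite ly) => -[i _]; rewrite Asym => /Alt.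
have := f; rewrite (flux_split rk _ (x j)) big_nat_recr //= subrr mulr0 addr0.
rewrite [X in _ - X]big_nat [X in _ - X]big1 ?subr0; last by move=> z zr; rewrite z0 ?mul0r.
rewrite (@sum_split2 _ _ j.+1 n j.+1 y); [|by rewrite leqnn jn|by clear -yr yn; lia|by clear -yr; lia].
rewrite big_nat_cond big1 ?addr0 ?l1 ?ly; first lra.
by move=> z /andP[zr /andP[zk zy]]; rewrite l0 // mul0r.
Qed.

Ltac lin := clear -rk Asym Alt xle d4 degd d4R dev conn del0 R n A x d del; lra.

(** The gain of a late window is critical only if the estimate in [late_at] is nearly an equality:
    rank [b.+2] lies almost two units up and [gam] almost vanishes. These two facts refute a late
    window after a full one. *)
Lemma late_tight kap b S : small kap -> (d.+2 < S)%N -> stuckE kap b S -> calm b d.+4 ->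
  late_at b -> [/\ V_at b.+3, mid (b + d).+2 <= x b.+2 + d%:R + del,
     x b.+2 <= mid b + 2, gam b <= 2 * (kap + del) & 2 - kap - del <= x b.+2 - mid b].
Proof.
move=> /smallP[k0 dk kd k1 _] dS st [bn fl kir] [d6 u2 e2 _ hx]; have D := d4R; have hd0 := del0.
have d6R : 6 <= d%:R :> R by rewrite (ler_nat _ 6).
have g0 := gam_ge0 rk b.
have xj : x b.+2 <= mid b + 2.
  rewrite -(@ler_pM2l _ (d%:R - 2)); last by move: D; lin.
  have : 0 <= (d%:R - 4) * gam b by rewrite mulr_ge0 ?subr_ge0 //; move: d6R; lin.
  by move: hx g0; lin.
have s1 := st d.+1 ltac:(clear -dS; lia); have s2 := st d.+2 ltac:(clear -dS; lia).
rewrite !addnS in s1 s2; rewrite -natr1 in s1; rewrite -addn2 natrD in s2.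
have /andP[_ m1] := mid_le rk (b + d).+1; have /andP[_ m2] := mid_le rk (b + d).+2.
have f3 := fl b.+3 ltac:(clear; lia).
have := @core_V _ _ _ _ rk _ d4 degd b.+2 del ltac:(clear -bn; lia) u2 e2 f3
  (fl (b.+2 + d)%N ltac:(clear; lia)) (fun z hz => kir z ltac:(clear -hz; lia)).
rewrite addSn addSn; case=> [h|h|vat].
- exfalso; have : 0 <= (2 * d%:R - 1) * (x (b + d).+2 - x b.+2 - (d%:R - 1 - kap)) by rewrite mulr_ge0 ?subr_ge0 //; move: D s1 m1 m2 xj dk k1; lin.
  lra.
- by exfalso; lra.
have [_ [y pr]] := vat; have pr' := pr; case: pr' => _ yr _ _.
have vu := V_upper (j := b.+2) ltac:(clear -bn; lia) u2 e2 pr f3.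
have nx := @pair_next _ _ _ _ rk _ d4 degd b.+3 y del ltac:(clear -bn; lia) pr f3
  (fl (b.+3 + d.-1)%N ltac:(clear -d4; lia)) (fl (b.+3 + d)%N ltac:(clear; lia)) (kir b.+3 ltac:(clear; lia))
  (kir y ltac:(clear -yr; lia)) del0.
have bd1 : (b.+3 + d.-1 = (b + d).+2)%N by clear -d4; lia.
rewrite bd1 !addSn in nx.
have mm : mid (b + d).+2 = (x (b + d).+2 + x (b + d).+3) / 2 by [].
have up : mid (b + d).+2 <= x b.+2 + d%:R + del by lra.
have lo : 2 - kap - del <= x b.+2 - mid b by move: up s2 m1 m2 mm; lin.
split=> //.
have p1 : 0 <= (d%:R - 2) * (x b.+2 - mid b - (2 - kap - del)) by rewrite mulr_ge0 ?subr_ge0 //; move: d6R; lin.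
have p2 : (d%:R - 4) * gam b <= (d%:R - 2) * (kap + del) by move: p1 hx; lin.
rewrite -(@ler_pM2l _ (d%:R - 4)); last by move: d6R; lin.
have : 0 <= (d%:R - 6) * (kap + del) by rewrite mulr_ge0 ?subr_ge0 // addr_ge0.
by move: p2; lin.
Qed.

(** The window can be critical only if its last step [G] is nearly 2. A late shape next would need
    [G] to be tiny, and a last vertex with at most one exit edge would put at least d edges into the
    preceding cut, so that [G] is at most c / d. *)
Lemma after_V kap j S : small kap -> (d.+2 < S)%N -> stuckE kap (j + d)%N S ->
  calm j (2 * d + 4) -> ecut j.+1 = 2%N -> V_at j.+1 ->
  x j + d%:R - kap <= mid (j + d)%N ->
  ecut (j + d).+2 = 2%N /\ good A j.+1 (j + d).+2.
Proof.
move=> sk dS st cm e2 vat tight; have D := d4R; have hd0 := del0.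
have [k0 dk kd k1 kd2] := smallP sk.
have [jn fl kir] := cm; have vat' := vat; case: vat' => u2 [y pr] /=; rewrite /= in u2.
have [_ yr _ _] := pr.
have f1 := fl j.+1 ltac:(clear -d4; lia).
have vu := V_upper (j := j) ltac:(clear -jn; lia) u2 e2 pr f1.
have pb := @pair_at_bound _ _ _ _ rk _ d4 degd j.+1 y del ltac:(clear -jn; lia) pr f1
  (fl (j.+1 + d.-1)%N ltac:(clear -d4; lia)) (kir j.+1 ltac:(clear -d4; lia))
  (kir y ltac:(clear -yr d4; lia)).
have bd1 : (j.+1 + d.-1 = j + d)%N by clear -d4; lia.
rewrite bd1 addSn in pb.
set G := x (j + d).+1 - x (j + d)%N in pb.
have G0 : 0 <= G by rewrite subr_ge0 xle.
have mm : 2 * mid (j + d)%N = x (j + d)%N + x (j + d).+1 by rewrite /midpt; lin.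
have p1 : 0 <= (d%:R - 1) * (2 * x j + c - (x j.+1 + x y)) by rewrite mulr_ge0 ?subr_ge0 //; move: D; lin.
have p2 : 0 <= (d%:R - 1) * (x (j + d)%N + x (j + d).+1 - 2 * (x j + d%:R - kap)) by rewrite mulr_ge0 ?subr_ge0 //; move: D tight mm; lin.
have key : 4 * (d%:R - 1) - 2 * (d%:R - 1) * kap <= 2 * c + 2 * G + 2 * del by move: pb p1 p2; lin.
have cm' : calm (j + d)%N d.+4 by apply: calm_sub cm _ _; clear; lia.
have e2' : ecut (j + d).+2 = 2%N.
  have [//|[_ lt]] := trichotomy sk (ltnW dS) st ltac:(apply: calm_sub cm _ _; clear; lia).
  have [_ _ _ gl _] := late_tight sk dS st cm' lt.
  exfalso; rewrite -/G in gl; suff : 1 <= 0 :> R by rewrite ler10.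
  lra.
split=> //.
have kE : ((j + d).+2 = j.+1 + d.+1)%N by clear; lia.
have rE : ((j + d).+1 = j.+1 + d)%N by clear; lia.
have gV := @good_V _ _ _ _ rk _ d4 degd j.+1 isT.
rewrite -kE -rE in gV; apply: (gV ltac:(clear -jn; lia) vat e2'); move=> {gV}.
have rn : ((j + d).+1 < n)%N by clear -jn; lia.
have ep := @ecut_prev _ _ _ _ rk _ degd (j + d).+1 rn.
have : (nb (j + d).+2 n (j + d).+1 <= 2)%N.
  by rewrite -e2' /cutsize big_nat_recr //= leq_addl.
rewrite leq_eqVlt => /orP[/eqP //|u1]; exfalso.
have de : (d <= ecut (j + d).+1)%N by rewrite e2' in ep; clear -ep u1; lia.
have gp := le_trans (ecut_gap rk (j + d).+1) (fl (j + d).+1 ltac:(clear -d4; lia)).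
rewrite /= -/G in gp.
have deR : d%:R <= (ecut (j + d).+1)%:R :> R by rewrite ler_nat.
have q1 := ler_wpM2r G0 deR.
have q2 : 0 <= d%:R * (2 * c + 2 * G + 2 * del - (4 * (d%:R - 1) - 2 * (d%:R - 1) * kap)) by rewrite mulr_ge0 ?subr_ge0 //; lra.
have q3 : 0 <= d%:R * (kap - del) by rewrite mulr_ge0 ?subr_ge0 //; lra.
have q4 : 0 <= d%:R * kap by rewrite mulr_ge0 ?subr_ge0 //; lra.
suff : 1 <= 0 :> R by rewrite ler10.
by move: kd2 q1 q2 q3 q4 gp kd k1 D; rewrite expr2; lin.
Qed.

Lemma U_low b : (b.+2 < n)%N -> U_at b.+2 -> flux b.+2 <= c -> 2 * (x b.+2 - mid b) <= c.
Proof.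
move=> b2n aU f; have a1 := U_lower rk aU (ltnSn b.+1) b2n; case: aU => l2 l0.
have low := flux_low rk b; lazy zeta in low; rewrite -/(mid b) in low.
have e2 : ecut b.+2 = 2%N.
  by rewrite (ecut_dn rk) big_ltn // l2 big_nat big1 // => z zr; rewrite l0.
rewrite e2 big_ltn // l2 big_nat big1 in low; last by move=> z zr; rewrite l0 ?mul0r.
rewrite -(ler_nat R) in a1; have g0 := gam_ge0 rk b.
have : 0 <= (1 - (nb b.+2 n b.+1)%:R) * gam b by rewrite mulr_ge0 ?subr_ge0 //; lra.
lra.
Qed.

End RegularFinal.

Section RegularLocal.
Variables (R : realFieldType) (n : nat) (A : rel nat) (x : nat -> R).
Hypothesis rk : ranked n A x.

Local Notation nb := (nbrs A).
Local Notation up := (upsum n A x).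
Local Notation ecut := (cutsize n A).

Let Asym : symmetric A. Proof. by case: rk. Qed.
Let xle := xle rk.

Variables (d : nat).
Hypothesis d4 : (4 <= d)%N.
Hypothesis degd : forall z, (z < n)%N -> nb 0 n z = d.

Local Notation c := (2 * (d%:R - 2) : R).

Let d4R : 4 <= d%:R :> R. Proof. by rewrite (ler_nat _ 4). Qed.

Local Notation mid := (midpt x).
Local Notation stuckE := (stuckE x).
Local Notation U_at := (U_at n A).
Hypothesis dev : ~~ odd d.
Hypothesis conn : forall k, (0 < k < n)%N -> (0 < ecut k)%N.

Variable del : R.
Hypothesis del0 : 0 <= del.

Local Notation small := (small d del).
Local Notation calm := (calm n A x d del).

Ltac lin := clear -rk Asym xle d4 degd d4R dev conn del0 R n A x d del; lra.

(** In a late shape rank [r] has d - 2 >= 4 lower neighbours. At most three of them can be [b.+2]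
    and the two ranks just below [r], so some interior vertex is joined to [r]; by [late_tight] that
    edge is about a unit longer than needed, and [U_bound] becomes contradictory. *)
Lemma after_U kap b S : small kap -> (d.+2 < S)%N -> stuckE kap (b + d).+1 S ->
  calm b (2 * d + 5) -> U_at b.+2 ->
  mid b + d%:R + 1 - kap <= mid (b + d).+1 ->
  ecut (b + d).+3 = 2%N /\ good A b.+2 (b + d).+3.
Proof.
move=> sk dS st cm aU tight; have D := d4R; have hd0 := del0.
have [k0 dk kd k1 kd2] := smallP d4 del0 sk.
have [jn fl kir] := cm.
have f2 := fl b.+2 ltac:(clear -d4; lia).
have kE : ((b + d).+3 = b.+2 + d.+1)%N by clear; lia.
have cm' : calm (b + d).+1 d.+4 by apply: (calm_sub cm); clear; lia.
suff e2 : ecut (b + d).+3 = 2%N.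
  have gU := @good_U _ _ _ _ rk _ d4 degd b.+2.
  rewrite -kE in gU; split=> //; exact: (gU ltac:(clear -jn; lia) aU e2).
have [//|[_ lt]] := trichotomy rk d4 degd dev conn del0 sk (ltnW dS) st ltac:(by apply: (calm_sub cm'); clear; lia).
exfalso; have [_ _ _ gl lo] := late_tight rk d4 degd del0 sk dS st cm' lt.
case: lt => d6 _ _ lowr _.
set r := (b + d).+3 in lowr lo.
have rn : (r < n)%N by rewrite /r; clear -jn d4; lia.
have lU := U_low rk (b := b) ltac:(clear -jn; lia) aU f2.
have [z0 z0r Ar] : exists2 z, (b.+3 <= z < (b + d).+1)%N & A r z.
  apply: nb_gt0; have := lowr; rewrite (@nb_cat A b.+2 0 r) //; last by rewrite /r; clear; lia.
  rewrite (proj2 aU) ?add0n; last by rewrite rn /r; clear -d4; lia.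
  rewrite (@nb_recl A b.+2 r) //; last by rewrite /r; clear -d4; lia.
  rewrite (@nb_cat A (b + d).+1 b.+3 r) //; [|by clear -d4; lia|by rewrite /r; clear; lia].
  have := @nb_le A (b + d).+1 r r; have := leq_b1 (A r b.+2).
  have -> : (r - (b + d).+1 = 2)%N by rewrite /r; clear; lia.
  by clear -d6; lia.
have := @U_bound _ _ _ _ rk _ d4 degd b.+2 (b + d).+1 z0 ltac:(clear; lia) ltac:(clear -jn d4; lia)
    (proj1 aU) (proj2 aU) (fl b.+3 ltac:(clear -d4; lia)) (fl (b + d).+1 ltac:(clear -d4; lia)).
rewrite z0r /= [A z0 _]Asym Ar => ub.
have mm : 2 * mid (b + d).+1 = x (b + d).+1 + x (b + d).+2 by rewrite /midpt; lin.
have mg : mid (b + d).+1 = x (b + d).+2 - (x (b + d).+2 - x (b + d).+1) / 2 by rewrite /midpt; lin.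
have rg : 1 <= x r - x (b + d).+2 by move: lo gl mg dk k1; lin.
have p1 : 0 <= (d%:R - 2) * (c - 2 * (x b.+2 - mid b)) by rewrite mulr_ge0 ?subr_ge0 //; move: D lU; lin.
have p2 : 0 <= (d%:R - 2) * (x (b + d).+1 + x (b + d).+2 - 2 * (mid b + d%:R + 1 - kap)) by rewrite mulr_ge0 ?subr_ge0 //; move: D mm tight; lin.
suff : 1 <= 0 :> R by rewrite ler10.
by move: ub p1 p2 rg kd k1 dk k0 hd0 D mm mg tight; rewrite -/r; lin.
Qed.

Lemma full_E kap b S : small kap -> small (kap + del) -> (2 * d + 4 <= S)%N -> stuckE kap b S ->
  calm b (2 * d + 5) -> ecut b.+2 = 2%N ->
  [/\ ecut (b + d).+3 = 2%N, good A b.+2 (b + d).+3 & mid (b + d).+1 <= mid b + d%:R + 1 + del].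
Proof.
move=> sk sk' dS st cm e2; have D := d4R; have hd0 := del0.
have [k0 dk kd k1 kd2] := smallP d4 del0 sk.
have [bn fl kir] := cm.
have [UV up] := cut2_step rk d4 degd (b := b) (kap := kap) (del := del) ltac:(clear -bn; lia) hd0 dk ltac:(lra)
  (fun s hs => st s ltac:(clear -hs dS; lia)) e2
  (fun k hk => fl k ltac:(clear -hk; lia)) (fun k hk => kir k ltac:(clear -hk; lia)).
(* The window may gain [del] more than d + 1, so the absence of slack is inherited with [kap + del]
   instead of [kap]. *)
have st' : stuckE (kap + del) (b + d).+1 d.+3.
  move=> s hs; have := st (d.+1 + s)%N ltac:(clear -hs dS; lia).
  have -> : (b + (d.+1 + s) = (b + d).+1 + s)%N by clear; lia.
  by rewrite natrD -natr1; lra.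
have s1 := st d.+1 ltac:(clear -dS; lia); rewrite addnS -natr1 in s1.
case: UV => [aU|aV].
  have [] := after_U sk' (ltnSn _) st' cm aU ltac:(lra).
  by split.
have bE : ((b + d).+1 = b.+1 + d)%N by clear; lia.
have V := @after_V _ _ _ _ rk _ d4 degd dev conn _ del0 (kap + del) b.+1 d.+3 sk' (ltnSn _).
rewrite -bE in V.
have ep := @ecut_prev _ _ _ _ rk _ degd b.+1 ltac:(clear -bn; lia).
have g2 : x b.+1 - x b <= 2.
  apply: (gap_le2 rk d4 (k := b.+1)); last by apply: fl; clear; lia.
  by case: aV => /= a2 _; clear -ep a2 e2; lia.
have mb : mid b = x b.+1 - (x b.+1 - x b) / 2 by rewrite /midpt; lra.
have [] := V st' ltac:(by apply: (calm_sub cm); clear; lia) e2 aV ltac:(lra).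
by split.
Qed.

(** The constant 1 / 128 is half of the one in [small], so that [kap + del], at most 2 [kap], is
    still small. *)
Lemma local_E kap b S : del <= kap -> d%:R ^+ 2 * kap <= 1 / 128 -> (2 * d + 5 <= S)%N ->
  calm b (2 * d + 6) ->
  [\/ exists2 s, (0 < s <= S)%N & mid (b + s)%N <= mid b + s%:R - kap,
      [/\ ecut b.+2 = 2%N, ecut (b + d).+3 = 2%N, good A b.+2 (b + d).+3
        & mid (b + d).+1 <= mid b + d%:R + 1 + del]
    | [/\ ecut b.+2 <> 2%N, ecut (b + d).+4 = 2%N, good A b.+3 (b + d).+4
        & mid (b + d).+2 <= mid b + d%:R + 2 + del]].
Proof.
move=> dk kd2 dS cm; have hd0 := del0.
have sk : small kap.
  rewrite /small dk /=; move: kd2 => h; apply: le_trans h _; lra.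
have sk' : small (kap + del).
  rewrite /small; apply/andP; split; first by lra.
  have : 0 <= d%:R ^+ 2 * (kap - del) by rewrite mulr_ge0 ?exprn_ge0 // subr_ge0.
  move: kd2; lra.
have [/hasP[s]|/hasPn st0] :=
  boolP (has (fun s => mid (b + s)%N <= mid b + s%:R - kap) (index_iota 1 S.+1)).
  by rewrite mem_index_iota ltnS => hs le; constructor 1; exists s.
have st : stuckE kap b S.
  by move=> s hs; rewrite ltNge st0 // mem_index_iota ltnS.
have [e2|[ne lt]] := trichotomy rk d4 degd dev conn del0 sk (S := S) ltac:(clear -dS; lia) st
    ltac:(by apply: (calm_sub cm); clear; lia).
  constructor 2; have [] := full_E sk sk' (S := S) ltac:(clear -dS; lia) st
    ltac:(by apply: (calm_sub cm); clear; lia) e2.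
  by split.
constructor 3.
have [vat up xj gl lo] := late_tight rk d4 degd del0 sk (S := S) ltac:(clear -dS; lia) st
   ltac:(by apply: (calm_sub cm); clear -d4; lia) lt.
have st' : stuckE (kap + del) (b + d).+2 d.+3.
  move=> s hs; have := st (d.+2 + s)%N ltac:(clear -hs dS; lia).
  have -> : (b + (d.+2 + s) = (b + d).+2 + s)%N by clear; lia.
  by rewrite natrD -addn2 natrD; lra.
have s1 := st d.+2 ltac:(clear -dS; lia); rewrite !addnS -addn2 natrD in s1.
have bE : ((b + d).+2 = b.+2 + d)%N by clear; lia.
have V := @after_V _ _ _ _ rk _ d4 degd dev conn _ del0 (kap + del) b.+2 d.+3 sk' (ltnSn _).
rewrite -bE in V.
have [_ _ e2 _ _] := lt.
have [] := V st' ltac:(by apply: (calm_sub cm); clear; lia) e2 vat ltac:(lra).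
by split=> //; lra.
Qed.

End RegularLocal.

(** * Chaining the local steps *)

(** [b] is a strict lower bound for the next start; passing on [k + d] makes the windows of d + 1
    ranks disjoint. *)
Fixpoint blocks (A : rel nat) (n d b : nat) (ks : seq nat) : Prop :=
  if ks is k :: ks' then
    [/\ (b < k)%N, (k + d.+1 < n)%N, good A k (k + d.+1)%N & blocks A n d (k + d)%N ks']
  else True.

Lemma blocks_le A n d b b' ks : (b' <= b)%N -> blocks A n d b ks -> blocks A n d b' ks.
Proof.
by case: ks => //= k ks bb [bk kn g bl]; split=> //; apply: leq_ltn_trans bk.
Qed.

Section Chain.
Variables (R : realFieldType) (n d tau S K1 : nat) (A : rel nat) (x : nat -> R).
Variables (mu c kap B L : R) (typ : pred nat).

Definition negsum (k : nat) : R := - \sum_(0 <= j < k) x j.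
Local Notation M := negsum.
(** One definition serves both cases: [tau = 0] gives the entry itself, [tau = 1] the mean of two
    consecutive entries. *)
Definition node (b : nat) : R := (x b + x (b + tau)%N) / 2.
Local Notation N := node.
(** [M] moves by at most [B] per rank, so this dominates [M] on the next [L] ranks. *)
Definition Mhat (b : nat) : R := M b + L * B.
Definition scale (b : nat) : R := mu / c * Mhat b.

Hypothesis xmono : {homo x : i j / (i <= j)%N >-> i <= j}.
Hypothesis Mn : M n = 0.
Hypothesis xB : forall j, (j < n)%N -> `|x j| <= B.
Hypothesis xrange : forall i j, (i < n)%N -> (j < n)%N -> x j - x i <= B.
Hypothesis mu0 : 0 < mu.
Hypothesis c1 : 1 <= c.
Hypothesis kap0 : 0 <= kap.
Hypothesis kap1 : kap <= 1.
Hypothesis tau1 : (tau <= 1)%N.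
Hypothesis dS : (d.+2 <= S)%N.
Hypothesis SK : (S + 3 <= K1)%N.
Hypothesis LS : S%:R + 1 <= L.

Hypothesis step : forall b, (b + K1 <= n)%N ->
  [\/ exists2 s, (0 < s <= S)%N & N (b + s)%N - N b <= scale b * (s%:R - kap),
      [/\ typ b, typ (b + d.+1)%N, good A (b + tau).+1 ((b + tau).+1 + d.+1)%N
        & N (b + d.+1)%N - N b <= scale b * d.+1%:R + mu * B]
    | [/\ ~~ typ b, typ (b + d.+2)%N, good A (b + tau).+2 ((b + tau).+2 + d.+1)%N
        & N (b + d.+2)%N - N b <= scale b * d.+2%:R + mu * B]].

Lemma MS k : M k.+1 = M k - x k.
Proof. by rewrite /negsum big_nat_recr //= opprD. Qed.

Lemma M0 : M 0 = 0. Proof. by rewrite /negsum big_geq // oppr0. Qed.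

Lemma M_ge0 k : (k <= n)%N -> 0 <= M k.
Proof.
move=> kn; have [|xk] := leP (x k) 0.
  move=> xk; rewrite /negsum oppr_ge0 big_nat sumr_le0 // => j /andP[_ jk].
  by apply: le_trans xk; apply: xmono; apply: ltnW.
have : M n = M k - \sum_(k <= j < n) x j.
  by rewrite /negsum (@big_cat_nat _ _ _ k) //= opprD.
rewrite Mn => /eqP; rewrite eq_sym subr_eq0 => /eqP ->.
rewrite big_nat sumr_ge0 // => j /andP[kj _].
by apply: le_trans (ltW xk) _; apply: xmono.
Qed.

Lemma M_lip k s : (k + s <= n)%N -> `|M (k + s)%N - M k| <= s%:R * B.
Proof.
elim: s => [|s IHs] ks; first by rewrite addn0 subrr normr0 mul0r.
have {}IHs := IHs ltac:(clear -ks; lia).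
have := @xB (k + s)%N ltac:(clear -ks; lia).
rewrite addnS MS -natr1 mulrDl mul1r => xb.
rewrite addrAC; apply: le_trans (ler_normB _ _) _; exact: lerD.
Qed.

(** What summation by parts leaves of the sum of squares beyond rank [a]; from 0 on it is the whole
    sum ([sum_sq]). *)
Definition tailsum (a : nat) : R := \sum_(a.+1 <= k < n) M k * (x k - x k.-1).
Definition tail2 (b : nat) : R := (tailsum b + tailsum (b + tau)%N) / 2.

Lemma seg_le a s H : (forall k, (a < k <= a + s)%N -> M k <= H) ->
  \sum_(a.+1 <= k < (a + s).+1) M k * (x k - x k.-1) <= H * (x (a + s)%N - x a).
Proof.
elim: s => [|s IHs] h; first by rewrite addn0 big_geq // subrr mulr0.
rewrite addnS big_nat_recr /=; last by rewrite ltnS leq_addr.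
have {}IHs := IHs (fun k hk => h k ltac:(clear -hk; lia)).
have g0 : 0 <= x (a + s).+1 - x (a + s)%N by rewrite subr_ge0 xmono.
have := ler_wpM2r g0 (h (a + s).+1 ltac:(clear; lia)).
by move: IHs; move: (\sum_(_ <= _ < _) _) => S1; lra.
Qed.

Lemma tailsum_step a s H : (a + s < n)%N -> (forall k, (a < k <= a + s)%N -> M k <= H) ->
  tailsum a <= H * (x (a + s)%N - x a) + tailsum (a + s)%N.
Proof.
move=> asn h; rewrite /tailsum (@big_cat_nat _ _ _ (a + s).+1) //=; last by rewrite ltnS leq_addr.
by rewrite lerD2r seg_le.
Qed.

Lemma B0 : (0 < n)%N -> 0 <= B.
Proof. by move=> n0; apply: le_trans (xB n0). Qed.

Lemma tail2_step b s : (0 < s <= S)%N -> (b + K1 <= n)%N ->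
  tail2 b <= Mhat b * (N (b + s)%N - N b) + tail2 (b + s)%N.
Proof.
move=> hs bn.
have h k : (b < k <= b + S + 1)%N -> M k <= Mhat b.
  move=> kr; have [t tE] : exists t, k = (b + t)%N by exists (k - b)%N; clear -kr; lia.
  have tS : t%:R <= L.
    by apply: le_trans LS; rewrite natr1 ler_nat; clear -tE kr; lia.
  have := @M_lip b t ltac:(clear -tE kr bn SK; lia); rewrite -tE ler_norml => /andP[_ h].
  have := ler_wpM2r (B0 ltac:(clear -kr bn SK; lia)) tS.
  by rewrite /Mhat; lra.
have t1 := @tailsum_step b s (Mhat b) ltac:(clear -hs bn SK; lia) (fun k hk => h k ltac:(clear -hk hs; lia)).
have t2 := @tailsum_step (b + tau) s (Mhat b) ltac:(clear -hs bn SK tau1; lia) (fun k hk => h k ltac:(clear -hk hs tau1; lia)).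
by rewrite /tail2 /node [(b + s + tau)%N]addnAC; lra.
Qed.

(** The cost of replacing [Mhat b] by [M k], which differ by at most 2LB: 4LB M + 4 (LB)^2 from the
    squares, and B (M + 2LB) from the drift [mu * B]. *)
Definition err (k : nat) : R := (4 * L + 1) * B * M k + (4 * L ^+ 2 + 2 * L) * B ^+ 2.

Lemma L1 : 1 <= L.
Proof. by have := LS; have : 0 <= S%:R :> R by []; lra. Qed.

Lemma step_sum b s (sl : bool) : (0 < s <= S)%N -> (b + K1 <= n)%N ->
  N (b + s)%N - N b <= scale b * (s%:R - sl%:R * kap) + (~~ sl)%:R * (mu * B) ->
  tail2 b <= mu / c * (\sum_(b <= k < b + s) M k ^+ 2 - sl%:R * (kap * M b ^+ 2)) +
     mu * \sum_(b <= k < b + s) err k + tail2 (b + s)%N.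
Proof.
move=> hs bn hN; apply: le_trans (tail2_step hs bn) _; rewrite lerD2r.
have b0 : 0 <= B by apply: B0; clear -bn SK; lia.
have l1 := L1; have hc := c1; have hm := mu0; have hk := kap0.
have Mb : 0 <= M b by apply: M_ge0; clear -bn; lia.
have LB0 : 0 <= L * B by rewrite mulr_ge0 ?subr_ge0 //; lra.
have Mh : 0 <= Mhat b by rewrite /Mhat addr_ge0.
have mc0 : 0 < mu / c by rewrite divr_gt0 //; lra.
have mcle : mu / c <= mu by rewrite ler_pdivrMr ?ler_peMr //; lra.
apply: le_trans (ler_wpM2l Mh hN) _.
have pt k : (b <= k < b + s)%N -> mu / c * Mhat b ^+ 2 + (~~ sl)%:R * (mu * B * Mhat b) <=
    mu / c * M k ^+ 2 + mu * err k.
  move=> kr; have [t tE] : exists t, k = (b + t)%N by exists (k - b)%N; clear -kr; lia.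
  have Mk : 0 <= M k by apply: M_ge0; clear -kr bn hs SK; lia.
  have tS : t%:R <= L.
    by apply: le_trans LS; rewrite natr1 ler_nat; clear -tE kr hs; lia.
  have := @M_lip b t ltac:(clear -tE kr bn SK hs; lia); rewrite -tE ler_norml => /andP[h _].
  have hM : Mhat b <= M k + 2 * (L * B).
    by have := ler_wpM2r b0 tS; rewrite /Mhat; lra.
  have sq : Mhat b ^+ 2 <= M k ^+ 2 + (4 * (L * B) * M k + 4 * (L * B) ^+ 2).
    have : 0 <= (M k + 2 * (L * B) - Mhat b) * (M k + 2 * (L * B) + Mhat b).
      by rewrite mulr_ge0 ?subr_ge0 //; lra.
    rewrite !expr2; lra.
  have e0 : 0 <= 4 * (L * B) * M k + 4 * (L * B) ^+ 2.
    by rewrite addr_ge0 ?mulr_ge0 ?exprn_ge0 //; lra.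
  have s1 : mu / c * Mhat b ^+ 2 <= mu / c * M k ^+ 2 + mu * (4 * (L * B) * M k + 4 * (L * B) ^+ 2).
    have h1 := ler_wpM2l (ltW mc0) sq; have h2 := ler_wpM2r e0 mcle.
    by apply: le_trans h1 _; rewrite mulrDr lerD2l.
  have s2 : (~~ sl)%:R * (mu * B * Mhat b) <= mu * (B * (M k + 2 * (L * B))).
    have q0 : 0 <= mu * B * Mhat b by rewrite !mulr_ge0 // ltW.
    apply: (@le_trans _ _ (mu * B * Mhat b)).
      by case: (sl); rewrite /= ?mul0r ?mul1r.
    by rewrite -mulrA; apply: ler_wpM2l; [exact: ltW | exact: ler_wpM2l].
  have -> : mu * err k = mu * (4 * (L * B) * M k + 4 * (L * B) ^+ 2) + mu * (B * (M k + 2 * (L * B))).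
    by rewrite /err; ring.
  by rewrite addrA; apply: lerD.
have := ler_sum_nat pt; rewrite sumr_const_nat addKn -[X in X <= _]mulr_natl.
rewrite big_split /= -!mulr_sumr => main.
have s1 : 1 <= s%:R :> R by rewrite ler1n; case/andP: hs.
have q0 : 0 <= (~~ sl)%:R * (mu * B * Mhat b) by rewrite !mulr_ge0 // ltW.
have q1 := ler_wpM2r q0 s1.
have q2 : sl%:R * (kap * (mu / c * M b ^+ 2)) <= sl%:R * (kap * (mu / c * Mhat b ^+ 2)).
  apply: ler_wpM2l => //; apply: ler_wpM2l => //; apply: ler_wpM2l; first exact: ltW.
  by rewrite ler_pXn2r ?nnegrE // /Mhat lerDl.
have e1 : Mhat b * (scale b * (s%:R - sl%:R * kap) + (~~ sl)%:R * (mu * B)) =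
   s%:R * (mu / c * Mhat b ^+ 2) - sl%:R * (kap * (mu / c * Mhat b ^+ 2)) + (~~ sl)%:R * (mu * B * Mhat b).
  by rewrite /scale; ring.
rewrite e1; move: main q1 q2.
move: (\sum_(b <= i < b + s) M i ^+ 2) (\sum_(b <= i < b + s) err i) (sl%:R : R) (~~ sl)%:R (mu / c) => S1 S2 z1 z2 m.
move: (m * Mhat b ^+ 2) (mu * B * Mhat b) => P1 P2 main q1 q2.
lra.
Qed.

Lemma tailsum_end a : (0 < n)%N -> (n < a + K1)%N -> tailsum a <= K1%:R * B * B.
Proof.
move=> n0 an; have b0 := B0 n0; rewrite /tailsum.
have [na|an'] := leqP n a.+1; first by rewrite big_geq // !mulr_ge0.
have [s sE] : exists s, n = (a + s).+1 by exists (n - a.+1)%N; clear -an'; lia.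
rewrite sE; apply: le_trans (@seg_le a s (K1%:R * B) _) _ => [k kr|].
  have [t tE] : exists t, n = (k + t)%N by exists (n - k)%N; clear -kr sE; lia.
  have := @M_lip k t ltac:(by rewrite tE); rewrite -tE Mn sub0r normrN => h.
  apply: le_trans (ler_norm _) (le_trans h _); rewrite ler_wpM2r // ler_nat.
  by clear -tE sE kr an; lia.
rewrite ler_wpM2l ?mulr_ge0 //; apply: xrange; clear -sE; lia.
Qed.

(** The term [~~ typ b] in the count is the account of late starts: a late window takes one rank
    more than d + 1, but every window ends at a place of type [typ], where nothing is owed. *)
Lemma chain b : (b <= n)%N -> (0 < n)%N -> exists sl ks,
  [/\ sorted ltn sl, forall s, s \in sl -> (b <= s < n)%N, blocks A n d (b + tau)%N ks,
      (n <= b + d.+1 * size ks + S.+1 * size sl + K1 + ~~ typ b)%N &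
      tail2 b <= mu / c * (\sum_(b <= k < n) M k ^+ 2 - kap * \sum_(s <- sl) M s ^+ 2) +
        mu * (\sum_(b <= k < n) err k) + K1%:R * B * B].
Proof.
move=> bn n0; have b0 := B0 n0; have hc := c1; have hm := mu0; have l1 := L1.
have err0 k : (k <= n)%N -> 0 <= err k.
  move=> kn; rewrite /err addr_ge0 // !mulr_ge0 ?M_ge0 ?exprn_ge0 //; first lra.
  by rewrite addr_ge0 ?mulr_ge0 ?exprn_ge0 //; lra.
have [m] := ubnP (n - b)%N; elim: m b bn => // m IHm b bn hm'.
have [bK|nbK] := leqP (b + K1) n; last first.
  exists [::], [::]; split=> //.
    by rewrite /= !muln0 !addn0; clear -nbK; lia.
  rewrite big_nil mulr0 subr0 -[leLHS]add0r lerD //.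
    apply: addr_ge0; apply: mulr_ge0.
    - by rewrite divr_ge0 //; lra.
    - by apply: sumr_ge0 => k _; exact: sqr_ge0.
    - exact: ltW.
    - by rewrite big_nat; apply: sumr_ge0 => k /andP[_ kn]; rewrite err0 // ltnW.
  have t1 := tailsum_end n0 nbK.
  have t2 := @tailsum_end (b + tau) n0 ltac:(clear -nbK; lia).
  by rewrite /tail2; lra.
have big_cat F s : (b + s <= n)%N -> \sum_(b <= k < n) F k =
    \sum_(b <= k < b + s) F k + \sum_((b + s)%N <= k < n) F k :> R.
  by move=> h; rewrite (@big_cat_nat _ _ _ (b + s)%N) // leq_addr.
have [[s hs hN]|[tb tb' gd hN]|[tb tb' gd hN]] := step bK.
- have bsn : (b + s <= n)%N by clear -hs bK SK; lia.
  have [sl [ks [so sn bl cnt F]]] := IHm (b + s)%N bsn ltac:(clear -hm' hs bK SK; lia).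
  exists (b :: sl), ks; split.
  + rewrite /= path_min_sorted //; apply/allP => t /sn; clear -hs; lia.
  + by move=> t; rewrite inE => /orP[/eqP->|/sn]; clear -hs bK SK; lia.
  + by apply: blocks_le bl; clear; lia.
  (* A slack step may end at a place of either type; the extra one in [S.+1] prepays a late window
     there. *)
  + by rewrite /= mulnS; have := leq_b1 (~~ typ (b + s)); clear -cnt hs; lia.
  have := @step_sum b s true hs bK; rewrite mul1r mul0r addr0 => /(_ hN).
  rewrite !(big_cat _ s) // big_cons; move: F; rewrite mul1r ?mulrDr ?mulrBr; lra.
- have bsn : (b + d.+1 <= n)%N by clear -dS bK SK; lia.
  have [sl [ks [so sn bl cnt F]]] := IHm (b + d.+1)%N bsn ltac:(clear -hm' bK SK dS; lia).
  exists sl, ((b + tau).+1 :: ks); split=> //.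
  + by move=> t /sn; clear; lia.
  + split=> //; [by clear -dS bK SK tau1; lia | by apply: blocks_le bl; clear; lia].
  + by rewrite /= mulnS; rewrite tb' in cnt; clear -cnt; lia.
  have := @step_sum b d.+1 false ltac:(clear -dS; lia) bK; rewrite /= !mul0r !subr0 mul1r => /(_ hN).
  rewrite !(big_cat _ d.+1) //; move: F; rewrite ?mulrDr ?mulrBr; lra.
have bsn : (b + d.+2 <= n)%N by clear -dS bK SK; lia.
have [sl [ks [so sn bl cnt F]]] := IHm (b + d.+2)%N bsn ltac:(clear -hm' bK SK dS; lia).
exists sl, ((b + tau).+2 :: ks); split=> //.
+ by move=> t /sn; clear; lia.
+ split=> //; [by clear -dS bK SK tau1; lia | by apply: blocks_le bl; clear; lia].
+ by rewrite /= mulnS tb; rewrite tb' in cnt; clear -cnt; lia.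
have := @step_sum b d.+2 false ltac:(clear -dS; lia) bK; rewrite /= !mul0r !subr0 mul1r => /(_ hN).
rewrite !(big_cat _ d.+2) //; move: F; rewrite ?mulrDr ?mulrBr; lra.
Qed.

End Chain.

(** * The discrete Wirtinger inequality with defect *)

Section Picone.
Variables (R : realFieldType) (m : nat) (s u M : nat -> R) (C : R).
Local Notation n := m.+2.
Hypothesis s0 : s 0 = 0.
Hypothesis sn : s n = 0.
Hypothesis spos : forall k, (0 < k < n)%N -> 0 < s k.
Hypothesis sle1 : forall k, s k <= 1.
Hypothesis srec : forall k, s k.+2 + s k = 2 * C * s k.+1.
Hypothesis ustep : forall k, (0 < k)%N -> (k.+1 < n)%N -> u k - u k.+1 = s 1%N / (s k * s k.+1).
Hypothesis ule : forall k l, (0 < k)%N -> (k <= l)%N -> (l < n)%N -> u k - u l <= (s k * s l)^-1.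
Hypothesis M0 : M 0 = 0.
Hypothesis Mn : M n = 0.

Definition ratio (k : nat) : R := M k / s k.
Local Notation h := ratio.
Definition pterm (k : nat) : R := s k * s k.+1 * (h k.+1 - h k) ^+ 2.
Definition defect : R := \sum_(1 <= k < m.+1) pterm k.

Lemma ratioE k : (0 < k < n)%N -> M k = s k * h k.
Proof. by move=> kr; rewrite /ratio mulrCA mulfV ?mulr1 // gt_eqF // spos. Qed.

(** Substituting M = s h, the recursion for s collects the terms containing h squared into the
    eigenvalue term and leaves only weighted differences of h. *)
Lemma picone : \sum_(0 <= k < n) (M k.+1 - M k) ^+ 2 =
  (2 - 2 * C) * \sum_(0 <= k < n) M k ^+ 2 + defect.
Proof.
pose P k := h k ^+ 2 * s k * (s k - s k.-1); pose Q k := h k ^+ 2 * s k * (s k - s k.+1).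
have PQ k : (0 < k < n)%N -> P k + Q k = (2 - 2 * C) * M k ^+ 2.
  case: k => // k kr; rewrite ratioE // /P /Q /= -mulrDr.
  have -> : s k.+1 - s k + (s k.+1 - s k.+2) = (2 - 2 * C) * s k.+1.
    by have := srec k; lra.
  ring.
rewrite big_nat_recr //= big_ltn // M0 subr0 Mn sub0r sqrrN.
rewrite [in RHS]big_ltn // M0 expr0n add0r mulr_sumr.
have -> : \sum_(1 <= k < n) (2 - 2 * C) * M k ^+ 2 = \sum_(1 <= k < n) (P k + Q k).
  by rewrite big_nat [RHS]big_nat; apply: eq_bigr => k kr; rewrite PQ.
rewrite big_split /= [\sum_(1 <= i < n) P i]big_ltn // [\sum_(1 <= i < n) Q i]big_nat_recr //=.
have -> : \sum_(1 <= k < m.+1) (M k.+1 - M k) ^+ 2 =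
   \sum_(1 <= k < m.+1) pterm k + \sum_(1 <= k < m.+1) P k.+1 + \sum_(1 <= k < m.+1) Q k.
  rewrite -!big_split /= big_nat [RHS]big_nat; apply: eq_bigr => k kr.
  have kn : (0 < k < n)%N by clear -kr; lia.
  have kn' : (0 < k.+1 < n)%N by clear -kr; lia.
  by rewrite (ratioE kn) (ratioE kn') /pterm /P /Q /=; ring.
have -> : M 1%N ^+ 2 = P 1%N by rewrite ratioE // /P /= s0; ring.
have -> : M m.+1 ^+ 2 = Q m.+1 by rewrite ratioE ?leqnn // /Q sn; ring.
rewrite [\sum_(2 <= i < n) P i]big_add1 /= /defect.
by move: (P 1%N) (Q m.+1) (\sum_(1 <= k < m.+1) _) (\sum_(1 <= k < m.+1) P _) (\sum_(1 <= k < m.+1) Q _) => p q a b e; ring.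
Qed.

Lemma pterm_ge0 k : (0 < k < m.+1)%N -> 0 <= pterm k.
Proof.
move=> kr; apply: mulr_ge0; last exact: sqr_ge0.
by apply: mulr_ge0; apply: ltW; apply: spos; clear -kr; lia.
Qed.

Lemma defect_ge0 : 0 <= defect.
Proof. by rewrite /defect big_nat sumr_ge0 // => k kr; rewrite pterm_ge0. Qed.

Lemma part_le k l : (0 < k)%N -> (l < n)%N -> \sum_(k <= j < l) pterm j <= defect.
Proof.
move=> k0 ln; have [lk|kl] := leqP l k; first by rewrite big_geq // defect_ge0.
rewrite /defect (@big_cat_nat _ _ _ k 1 m.+1) //=; last by clear -kl ln; lia.
rewrite (@big_cat_nat _ _ _ l k m.+1) //=; last exact: ltnW.
rewrite addrCA lerDl addr_ge0 // big_nat sumr_ge0 // => j jr; rewrite pterm_ge0 //.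
  by clear -jr kl ln; lia.
by clear -jr kl k0; lia.
Qed.

(** Cauchy-Schwarz for the telescoping difference of h with weights [s j * s j.+1]. The inverse
    weights telescope as well, since s(1) / (s(j) s(j+1)) is a difference of [u], in the application
    a cotangent. *)
Lemma cauchy_part k l : (0 < k)%N -> (k <= l)%N -> (l < n)%N ->
  s 1%N * (h l - h k) ^+ 2 <= (u k - u l) * \sum_(k <= j < l) pterm j.
Proof.
move=> k0; elim: l => [|l IHl] kl ln; first by move: k0 kl; clear; lia.
have s1 : 0 < s 1%N by apply: spos.
move: kl; rewrite leq_eqVlt => /orP[/eqP <-|kl].
  by rewrite !subrr expr0n /= mulr0 mul0r.
have {}kl : (k <= l)%N by [].
have {}IHl := IHl kl (ltnW ln).
have l0 : (0 < l)%N := leq_trans k0 kl.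
have sl : 0 < s l by apply: spos; clear -l0 ln; lia.
have sl' : 0 < s l.+1 by apply: spos.
rewrite big_nat_recr //= /pterm.
have us := ustep l0 ln.
have a0 : 0 < s l * s l.+1 by rewrite mulr_gt0.
have D0 : 0 <= \sum_(k <= j < l) pterm j.
  by rewrite big_nat sumr_ge0 // => j jr; rewrite pterm_ge0 //; clear -jr k0 ln; lia.
have P0 : 0 <= u k - u l.
  have hm : forall t, (k <= t)%N -> (t < n)%N -> 0 <= u k - u t.
    elim=> [|t IHt] kt tn; first by move: k0 kt; clear; lia.
    move: kt; rewrite leq_eqVlt => /orP[/eqP <-|kt]; first by rewrite subrr.
    have t0 : (0 < t)%N := leq_trans k0 kt.
    have := IHt kt (ltnW tn); have := ustep t0 tn.
    have : 0 <= s 1%N / (s t * s t.+1).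
      apply: divr_ge0; first exact: ltW.
      by apply: mulr_ge0; apply: ltW; apply: spos; clear -t0 tn; lia.
    lra.
  by apply: hm => //; apply: ltnW.
have -> : u k - u l.+1 = u k - u l + s 1%N / (s l * s l.+1) by rewrite -us; ring.
set a := s l * s l.+1 in a0 *; set P := u k - u l in IHl P0 *.
move: (\sum_(k <= j < l) pterm j) D0 IHl => Dk D0 IHl.
have -> : h l.+1 - h k = (h l - h k) + (h l.+1 - h l) by ring.
move: (h l - h k) (h l.+1 - h l) IHl => v e IHl.
have as1 : s 1%N / a * (a * e ^+ 2) = s 1%N * e ^+ 2.
  by rewrite mulrA divfK // gt_eqF.
(* The mean inequality for the cross term is all the induction step needs; the case P = 0 is
   separate because the square is completed after multiplying by P. *)
suff am : 2 * s 1%N * v * e <= P * (a * e ^+ 2) + s 1%N / a * Dk.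
  rewrite mulrDl !mulrDr as1 sqrrD.
  have -> : s 1%N * (v ^+ 2 + v * e *+ 2 + e ^+ 2) = s 1%N * v ^+ 2 + 2 * s 1%N * v * e + s 1%N * e ^+ 2.
    by rewrite -mulr_natr; ring.
  lra.
have [P00|P1] := eqVneq P 0.
  rewrite P00 mul0r in IHl.
  have : v ^+ 2 <= 0 by rewrite -(pmulr_rle0 _ s1).
  rewrite real_exprn_even_le0 ?num_real //= => /eqP ->.
  rewrite mulr0 mul0r; apply: addr_ge0; apply: mulr_ge0 => //.
    by apply: mulr_ge0; [exact: ltW | exact: sqr_ge0].
  by apply: divr_ge0; exact: ltW.
have {}P1 : 0 < P by rewrite lt_neqAle eq_sym P1.
have Pa : 0 < P * a by rewrite mulr_gt0.
rewrite -(@ler_pM2l _ (P * a)) //.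
have -> : P * a * (P * (a * e ^+ 2) + s 1%N / a * Dk) = (P * a * e) ^+ 2 + s 1%N * (P * Dk) * (a / a).
  by ring.
rewrite mulfV ?gt_eqF // mulr1.
have q1 := ler_wpM2l (ltW s1) IHl.
have q2 : 0 <= (P * a * e - s 1%N * v) ^+ 2 by rewrite sqr_ge0.
move: q1 q2; rewrite sqrrB -mulr_natr !exprMn !expr2; lra.
Qed.

Lemma ratio_diff k l : (0 < k < n)%N -> (0 < l < n)%N ->
  s 1%N * s k * s l * (h l - h k) ^+ 2 <= defect.
Proof.
wlog kl : k l / (k <= l)%N.
  move=> wl kr lr; have [kl|/ltnW lk] := leqP k l; first exact: wl.
  have -> : s 1%N * s k * s l * (h l - h k) ^+ 2 = s 1%N * s l * s k * (h k - h l) ^+ 2 by ring.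
  exact: wl.
move=> /andP[k0 kn] /andP[l0 ln].
have sk : 0 < s k by apply: spos; rewrite k0.
have sl : 0 < s l by apply: spos; rewrite l0.
have D0 : 0 <= \sum_(k <= j < l) pterm j.
  by rewrite big_nat sumr_ge0 // => j jr; rewrite pterm_ge0 //; clear -jr k0 ln; lia.
apply: le_trans (part_le k0 ln).
have h1 := cauchy_part k0 kl ln.
have h2 := ler_wpM2r D0 (ule k0 kl ln).
have kl0 : 0 < s k * s l by rewrite mulr_gt0.
have -> : s 1%N * s k * s l * (h l - h k) ^+ 2 = s k * s l * (s 1%N * (h l - h k) ^+ 2) by ring.
apply: le_trans (ler_wpM2l (ltW kl0) (le_trans h1 h2)) _.
by rewrite mulrA mulfV ?mul1r // gt_eqF.
Qed.

(** M(l) is split into s(l) h(k) plus s(l) (h(l) - h(k)), squared and summed over l. If M is small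
    at [k], then either s is small there or the defect is large. *)
Lemma profile k : (k < n)%N ->
  s 1%N * s k ^+ 2 * (\sum_(0 <= l < n) M l ^+ 2) <= 2 * n%:R * (s 1%N * M k ^+ 2 + defect).
Proof.
move=> kn; have s1 : 0 < s 1%N by apply: spos.
have D0 := defect_ge0.
have sM0 : 0 <= s 1%N * M k ^+ 2 by apply: mulr_ge0; [exact: ltW | exact: sqr_ge0].
have [->|k0] := posnP k.
  rewrite s0 expr0n mulr0 mul0r; apply: mulr_ge0; first by rewrite mulr_ge0.
  apply: addr_ge0 => //.
  by rewrite M0 expr0n mulr0.
have kr : (0 < k < n)%N by rewrite k0.
have sk := spos kr.
have -> : 2 * n%:R * (s 1%N * M k ^+ 2 + defect) = \sum_(0 <= l < n) (2 * (s 1%N * M k ^+ 2 + defect)).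
  by rewrite sumr_const_nat subn0 -[RHS]mulr_natl; ring.
rewrite mulr_sumr [leLHS]big_nat [leRHS]big_nat; apply: ler_sum => l /andP[_ ln].
have [->|l0] := posnP l.
  by rewrite M0 expr0n mulr0; apply: mulr_ge0 => //; exact: addr_ge0.
have lr : (0 < l < n)%N by rewrite l0.
have sl := spos lr.
have rd := ratio_diff kr lr.
rewrite (ratioE lr) (ratioE kr).
have step1 : (s l * h l) ^+ 2 <= 2 * (s l * h k) ^+ 2 + 2 * (s l ^+ 2 * (h l - h k) ^+ 2).
  have : 0 <= (s l * (h l - 2 * h k)) ^+ 2 by rewrite sqr_ge0.
  have -> : 2 * (s l * h k) ^+ 2 + 2 * (s l ^+ 2 * (h l - h k) ^+ 2) =
     (s l * h l) ^+ 2 + (s l * (h l - 2 * h k)) ^+ 2 by ring.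
  lra.
have c0 : 0 <= s 1%N * s k ^+ 2 by apply: mulr_ge0; [exact: ltW | exact: sqr_ge0].
apply: le_trans (ler_wpM2l c0 step1) _.
have -> : s 1%N * s k ^+ 2 * (2 * (s l * h k) ^+ 2 + 2 * (s l ^+ 2 * (h l - h k) ^+ 2)) =
  2 * (s l ^+ 2 * (s 1%N * (s k * h k) ^+ 2) + s k * s l * (s 1%N * s k * s l * (h l - h k) ^+ 2)) by ring.
rewrite ler_wpM2l //.
have sl2 : s l ^+ 2 <= 1 by apply: exprn_ile1 => //; exact: ltW.
have skl : s k * s l <= 1 by apply: mulr_ile1 => //; exact: ltW.
apply: lerD.
  by apply: ler_piMl => //; apply: mulr_ge0; [exact: ltW | exact: sqr_ge0].
apply: le_trans (_ : s k * s l * defect <= _).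
  by apply: ler_wpM2l => //; apply: ltW; rewrite mulr_gt0.
by apply: ler_piMl.
Qed.

End Picone.

Lemma sorted_mid_count (n r : nat) (sl : seq nat) : sorted ltn sl -> all (fun k => k < n)%N sl ->
  (size sl <= count (fun k => r <= k <= n - r)%N sl + 2 * r)%N.
Proof.
move=> so al; have us : uniq sl by apply: (sorted_uniq ltn_trans ltnn).
have c1 : (count (fun k => k < r)%N sl <= r)%N.
  rewrite -size_filter -[leqRHS](size_iota 0); apply: uniq_leq_size; first exact: filter_uniq.
  by move=> k; rewrite mem_filter mem_iota => /andP[].
have c2 : (count (fun k => n - r < k < n)%N sl <= r)%N.
  rewrite -size_filter; apply: (@leq_trans (size (iota (n - r).+1 (n - (n - r).+1)))).
    apply: uniq_leq_size; first exact: filter_uniq.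
    by move=> k; rewrite mem_filter mem_iota; clear; lia.
  by rewrite size_iota; clear; lia.
have : (size sl <= count (fun k => r <= k <= n - r)%N sl + (count (fun k => k < r)%N sl + count (fun k => n - r < k < n)%N sl))%N.
  elim: sl al {so us c1 c2} => //= k sl IHsl /andP[kn /IHsl]; move: kn; clear; lia.
by move: c1 c2; clear; lia.
Qed.

(** * The sine sequence and elementary bounds *)

Section Sine.
Import numFieldNormedType.Exports.
Variable R : realType.
Implicit Types (x y : R).

Lemma cos_ge1B x : 0 <= x -> 1 - x <= cos x.
Proof.
rewrite le_eqVlt => /orP[/eqP <-|x0]; first by rewrite cos0 subr0.
have [|t _] := @MVT R cos (fun t => - sin t) 0 x x0 (fun t _ => is_derive_cos t).
  by apply: continuous_subspaceT => t; apply: continuous_cos.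
rewrite cos0 subr0 => e.
have : sin t * x <= x by rewrite ler_piMl ?sin_le1 // ltW.
by move: e; rewrite mulNr; lra.
Qed.

Lemma sin_geM x : 0 <= x -> x * (1 - x) <= sin x.
Proof.
rewrite le_eqVlt => /orP[/eqP <-|x0]; first by rewrite sin0 mul0r.
have [|t tx] := @MVT R sin cos 0 x x0 (fun t _ => is_derive_sin t).
  by apply: continuous_subspaceT => t; apply: continuous_sin.
rewrite sin0 !subr0 => ->; rewrite mulrC ler_wpM2r // ?(ltW x0) //.
move: tx; rewrite in_itv /= => /andP[t0 tx].
by apply: le_trans (cos_ge1B (ltW t0)); rewrite lerD2l lerN2 ltW.
Qed.

Lemma pi_lt4 : pi < 4 :> R.
Proof. by have := pihalf_lt2 R; lra. Qed.

Variables (m : nat).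
Local Notation n := m.+2.
Hypothesis n8 : (8 <= n)%N.

Definition theta : R := pi / n%:R.
Definition sn (k : nat) : R := sin (k%:R * theta).

Let n0 : 0 < n%:R :> R. Proof. by rewrite ltr0n. Qed.
Let pi0 : 0 < pi :> R := pi_gt0 R.

Lemma theta_gt0 : 0 < theta. Proof. by rewrite divr_gt0. Qed.

Lemma theta_n : n%:R * theta = pi.
Proof. by rewrite /theta mulrCA mulfV ?mulr1 // gt_eqF. Qed.

Lemma theta_half : theta <= 1 / 2.
Proof.
rewrite /theta ler_pdivrMr //.
have : 8 <= n%:R :> R by rewrite (ler_nat _ 8).
have := pi_lt4; lra.
Qed.

Lemma sn_gt0 k : (0 < k < n)%N -> 0 < sn k.
Proof.
move=> /andP[k0 kn]; apply: sin_gt0_pi; rewrite mulr_gt0 ?ltr0n ?theta_gt0 //=.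
by rewrite -theta_n ltr_pM2r ?theta_gt0 // ltr_nat.
Qed.

Lemma sn0 : sn 0 = 0. Proof. by rewrite /sn mul0r sin0. Qed.
Lemma snn : sn n = 0. Proof. by rewrite /sn theta_n sinpi. Qed.

Lemma sn_rec k : sn k.+2 + sn k = 2 * cos theta * sn k.+1.
Proof.
rewrite /sn; have -> : k.+2%:R * theta = k.+1%:R * theta + theta by rewrite -[k.+2%:R]natr1; ring.
have -> : k%:R * theta = k.+1%:R * theta - theta by rewrite -[k.+1%:R]natr1; ring.
by rewrite sinD sinB; ring.
Qed.

(** The cotangent of k theta; its differences are the inverse Picone weights, up to the factor
    [sn 1]. *)
Definition cotn (k : nat) : R := cos (k%:R * theta) / sn k.

Lemma cotn_diff k l : (0 < k < n)%N -> (0 < l < n)%N ->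
  cotn k - cotn l = sin (l%:R * theta - k%:R * theta) / (sn k * sn l).
Proof.
move=> /sn_gt0 sk /sn_gt0 sl; rewrite sinB /cotn -/(sn k) -/(sn l).
by field; rewrite !gt_eqF.
Qed.

Lemma cotn_step k : (0 < k)%N -> (k.+1 < n)%N -> cotn k - cotn k.+1 = sn 1 / (sn k * sn k.+1).
Proof.
move=> k0 kn; rewrite cotn_diff ?k0 ?(ltnW kn) //; congr (sin _ / _).
by rewrite -[k.+1%:R]natr1; ring.
Qed.

Lemma cotn_le k l : (0 < k)%N -> (k <= l)%N -> (l < n)%N ->
  cotn k - cotn l <= (sn k * sn l)^-1.
Proof.
move=> k0 kl ln; have kr : (0 < k < n)%N by rewrite k0 (leq_ltn_trans kl ln).
have lr : (0 < l < n)%N by rewrite ln (leq_trans k0 kl).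
rewrite cotn_diff // ler_piMl ?sin_le1 // invr_ge0 ltW // mulr_gt0 // sn_gt0 //.
Qed.

Lemma sn1_ge : n%:R^-1 <= sn 1.
Proof.
have t0 := theta_gt0; have th := theta_half.
rewrite /sn mul1r; apply: le_trans (sin_geM (ltW t0)).
have p2 : 2 / n%:R <= theta by rewrite /theta ler_pM2r ?invr_gt0 // pi_ge2.
have : 0 <= theta * (1 / 2 - theta) by rewrite mulr_ge0 ?subr_ge0 // ltW.
by move: p2; move: (n%:R^-1) => i; lra.
Qed.

Lemma sn_ge r k : (r <= k <= n - r)%N -> r%:R / (2 * n%:R) <= sn k.
Proof.
wlog kh : k / (2 * k <= n)%N.
  move=> wl kr; have [kh|kh] := leqP (2 * k) n; first exact: wl.
  have kn : (k <= n)%N by clear -kr; lia.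
  have <- : sn (n - k) = sn k.
    by rewrite /sn natrB // mulrBl theta_n sinB sinpi cospi; ring.
  by apply: wl; clear -kr kh; lia.
case: r => [|r] /andP[rk rn]; first by rewrite mul0r sin_ge0_pi // mulr_ge0 ?(ltW theta_gt0) //= -theta_n ler_pM2r ?theta_gt0 // ler_nat; clear -kh; lia.
have t0 := theta_gt0; set y := k%:R * theta; rewrite /sn -/y.
have y0 : 0 < y by rewrite mulr_gt0 // ltr0n; clear -rk; lia.
have yp : y <= pi / 2.
  rewrite /y /theta mulrA ler_pdivrMr //.
  have : 2 * k%:R <= n%:R :> R by rewrite -natrM ler_nat.
  by move=> h; have := ler_wpM2r (ltW pi0) h; move: (n%:R : R) => nn; lra.
have ry : r.+1%:R / (2 * n%:R) <= y / 2.
  have : r.+1%:R / n%:R <= y.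
    rewrite /y /theta mulrA ler_pM2r ?invr_gt0 // -[leLHS]mulr1 ler_pM //.
      by rewrite ler_nat.
    by have := pi_ge2 R; lra.
  by move=> h; rewrite invfM [2^-1 * _]mulrC mulrA ler_wpM2r // invr_ge0.
(* Up to 1/2 the bound y (1 - y) gives at least y / 2; beyond, sine is increasing up to pi / 2 and
   already at least 1/4. *)
have [yh|yh] := leP y (1 / 2).
  apply: le_trans ry _; apply: le_trans (sin_geM (ltW y0)).
  have : 0 <= y * (1 / 2 - y) by rewrite mulr_ge0 ?subr_ge0 // ltW.
  lra.
have s12 : 1 / 4 <= sin (1 / 2) :> R.
  by have := @sin_geM (1 / 2) ltac:(lra); lra.
apply: le_trans (_ : 1 / 4 <= _).
  rewrite ler_pdivrMr ?mulr_gt0 //.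
  have : 2 * r.+1%:R <= n%:R :> R by rewrite -natrM ler_nat; clear -rk kh; lia.
  lra.
apply: le_trans s12 _; rewrite ltW // ltr_sin //.
- by rewrite in_itv /=; apply/andP; split; move: (pi_ge2 R); lra.
- by rewrite in_itv /=; apply/andP; split; move: (pi_ge2 R); lra.
Qed.

Lemma lambda_ge : pi ^+ 2 * (1 - pi / n%:R) <= n%:R ^+ 2 * (2 - 2 * cos theta).
Proof.
have t0 := theta_gt0; have th := theta_half.
have e : 2 - 2 * cos theta = 4 * sin (theta / 2) ^+ 2.
  have th2 : theta / 2 *+ 2 = theta by rewrite -[LHS]mulr_natr divfK // pnatr_eq0.
  have := cos_mulr2n (theta / 2); rewrite th2 => ->.
  by rewrite sin2cos2 -[_ *+ 2]mulr_natr; ring.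
rewrite e -[pi / n%:R]/theta -theta_n exprMn -mulrA ler_wpM2l ?sqr_ge0 //.
have h0 : 0 <= theta / 2 by lra.
have h := sin_geM h0.
have h1 : 0 <= theta / 2 * (1 - theta / 2) by rewrite mulr_ge0 ?subr_ge0 //; lra.
have h2 : (theta / 2 * (1 - theta / 2)) ^+ 2 <= sin (theta / 2) ^+ 2.
  by rewrite ler_pXn2r ?nnegrE // (le_trans h1).
apply: le_trans (_ : 4 * (theta / 2 * (1 - theta / 2)) ^+ 2 <= _); last by rewrite ler_wpM2l.
have h3 : 0 <= (theta * theta) ^+ 2 by rewrite sqr_ge0.
have -> : 4 * (theta / 2 * (1 - theta / 2)) ^+ 2 = theta ^+ 2 * (1 - theta) + (theta * theta) ^+ 2 / 4 by field.
lra.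
Qed.

End Sine.

(** * Counting slack places *)

Section FewSlack.
Variables (R : realType) (C_tail kap : R).
Hypothesis C_tail_ge0 : 0 <= C_tail.
Hypothesis kap0 : 0 < kap.
Hypothesis kap1 : kap <= 1.

(** With pi^2 <= 16 and pi < 4, the tail costs 16 [C_tail] / n and the cosine 64 / n. The 6 bounds
    2Q + 2 n^2 D in units of [C_gap * eta * Y / kap]. In the last constant, 512 comes from (q / 2)
    (q / (16 n))^2, and 216 = 6^3 covers q < 6. *)
Definition C_gap : R := 1 + 16 * (C_tail + 4).
Definition C_weight : R := C_gap * (6 / kap).
Definition C_count : R := 512 * C_weight + 216.

Variables (m : nat) (M : nat -> R) (sl : seq nat) (w eps : R).
Local Notation n := m.+2.
Local Notation nR := (n%:R : R).
Hypothesis n8 : (8 <= n)%N.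
Hypothesis nC_tail : 2 * C_tail <= nR.
Hypothesis eps01 : 0 <= eps <= 1.
Hypothesis M0 : M 0 = 0.
Hypothesis Mn : M n = 0.
Hypothesis w0 : 0 <= w.
Hypothesis wle : nR ^+ 2 * w <= pi ^+ 2 + eps.
Hypothesis so : sorted ltn sl.
Hypothesis sln : all (fun k => k < n)%N sl.

Local Notation X := (\sum_(0 <= k < n) (M k.+1 - M k) ^+ 2).
Local Notation Y := (\sum_(0 <= k < n) M k ^+ 2).
Local Notation Q := (\sum_(k <- sl) M k ^+ 2).
Local Notation eta := (eps + nR^-1).
Hypothesis Y0 : 0 < Y.
Hypothesis hX : (1 - C_tail / nR) * X <= w * (Y - kap * Q).

Let n0 : 0 < nR. Proof. by rewrite ltr0n. Qed.
Let D := defect m (sn R m) M.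

Let XE : X = (2 - 2 * cos (theta R m)) * Y + D.
Proof.
by apply: (picone (s := sn R m)) => //; [exact: sn0 | exact: snn | exact: sn_gt0 | exact: sn_rec].
Qed.

Let D0 : 0 <= D. Proof. by apply: defect_ge0; exact: sn_gt0. Qed.
Let Q0 : 0 <= Q. Proof. by apply: sumr_ge0 => k _; exact: sqr_ge0. Qed.

Let pi16 : pi ^+ 2 <= 16 :> R.
Proof.
have := pi_lt4 R; have := pi_gt0 R => p0 p4.
have : 0 <= (4 - pi) * (4 + pi) :> R by rewrite mulr_ge0 ?subr_ge0 //; lra.
lra.
Qed.

Lemma scaled_gap : nR ^+ 2 * D / 2 + kap * Q <= C_gap * eta * Y.
Proof.
have hn := n0; have hC := C_tail_ge0; have hk := kap0; have hD := D0; have hQ := Q0; have hY := Y0.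
have h16 := pi16; have hp := pi_ge2 R; have hp4 := pi_lt4 R.
have /andP[e0 e1] := eps01.
have n2 : 0 < nR ^+ 2 by rewrite exprn_gt0.
have inv0 : 0 < nR^-1 by rewrite invr_gt0.
have f1 : 0 <= C_tail / nR by rewrite divr_ge0 // ltW.
have f2 : C_tail / nR <= 1 / 2 by rewrite ler_pdivrMr //; move: nC_tail; lra.
have h8 : 8 <= nR by rewrite (ler_nat _ 8).
have f3 : pi / nR <= 1 / 2 by rewrite ler_pdivrMr //; lra.
have f4 : 0 <= pi / nR by rewrite divr_ge0 // ltW //; lra.
have lam := lambda_ge R n8.
have kQ0 : 0 <= kap * Q by rewrite mulr_ge0 // ltW.
have main : (1 - C_tail / nR) * (nR ^+ 2 * (2 - 2 * cos (theta R m)) * Y + nR ^+ 2 * D) <= nR ^+ 2 * w * (Y - kap * Q).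
  have := ler_wpM2l (ltW n2) hX; rewrite XE.
  by rewrite [leLHS]mulrCA mulrDr !mulrA.
set lm := nR ^+ 2 * (2 - 2 * cos (theta R m)) in lam main.
set mm := nR ^+ 2 * w in main.
have mle : mm <= pi ^+ 2 + eps by [].
have mm0 : 0 <= mm by rewrite mulr_ge0 // ltW.
have lam2 : 2 <= lm.
  apply: le_trans lam; have : 0 <= pi ^+ 2 * (1 / 2 - pi / nR) by rewrite mulr_ge0 ?sqr_ge0 ?subr_ge0.
  have : 0 <= (pi - 2) * (pi + 2) :> R by rewrite mulr_ge0 ?subr_ge0 //; lra.
  by move: (pi / nR) => a; lra.
clearbody lm mm.
have nD0 : 0 <= nR ^+ 2 * D by rewrite mulr_ge0 // ltW.
have lmY : 2 * Y <= lm * Y by rewrite ler_wpM2r // ltW.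
(* The scaled eigenvalue [mm] is at least 1, so the slack term keeps its full coefficient [kap]. *)
have one : Y <= mm * Y.
  have q1 : 0 <= (1 / 2 - C_tail / nR) * (lm * Y + nR ^+ 2 * D).
    by rewrite mulr_ge0 ?subr_ge0 // addr_ge0 // (le_trans _ lmY) // mulr_ge0 // ltW.
  have q2 : 0 <= mm * (kap * Q) by rewrite mulr_ge0.
  move: main q1 q2 lmY nD0; rewrite mulrBr.
  by move: (C_tail / nR) (nR ^+ 2 * D) (mm * (kap * Q)) (lm * Y) (mm * Y) => a b e f g; lra.
have mm1 : 1 <= mm by rewrite -(@ler_pM2r _ Y) // mul1r.
have q1 : mm * (Y - kap * Q) <= (pi ^+ 2 + eps) * Y - kap * Q.
  rewrite mulrBr; apply: lerB; first by rewrite ler_wpM2r // ltW.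
  by rewrite ler_peMl.
have q2 : 0 <= (1 / 2 - C_tail / nR) * (nR ^+ 2 * D) by rewrite mulr_ge0 ?subr_ge0.
have q3 : (pi ^+ 2 - 16 * (C_tail + 4) / nR) * Y <= (1 - C_tail / nR) * lm * Y.
  rewrite ler_wpM2r ?(ltW hY) //.
  have c10 : 0 <= 1 - C_tail / nR by move: f2; move: (C_tail / nR) => a; lra.
  have q4 : (1 - C_tail / nR) * (pi ^+ 2 * (1 - pi / nR)) <= (1 - C_tail / nR) * lm by rewrite ler_wpM2l.
  apply: le_trans q4.
  have -> : 16 * (C_tail + 4) / nR = 16 * (C_tail / nR) + 64 / nR by ring.
  have q5 : pi / nR <= 4 / nR by rewrite ler_wpM2r ?invr_ge0 // ltW.
  have q6 : 0 <= (16 - pi ^+ 2) * (C_tail / nR) by rewrite mulr_ge0 // subr_ge0.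
  have q7 : 0 <= (16 - pi ^+ 2) * (pi / nR) by rewrite mulr_ge0 // subr_ge0.
  have q8 : 0 <= pi ^+ 2 * ((C_tail / nR) * (pi / nR)).
    by apply: mulr_ge0; [exact: sqr_ge0 | exact: mulr_ge0].
  have -> : 64 / nR = 16 * (4 / nR) by ring.
  move: q5 q6 q7 q8; move: (C_tail / nR) (pi / nR) (4 / nR) (pi ^+ 2) => a b c p; lra.
have etaE : (16 * (C_tail + 4) / nR + eps) * Y <= C_gap * eta * Y.
  rewrite ler_wpM2r ?(ltW hY) // -subr_ge0 (_ : _ - _ = nR^-1 + 16 * (C_tail + 4) * eps); last first.
    by rewrite /C_gap; ring.
  by rewrite addr_ge0 ?(ltW inv0) // !mulr_ge0 ?subr_ge0 //; lra.
apply: le_trans etaE.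
move: main; rewrite mulrDr mulrA => main.
have -> : (16 * (C_tail + 4) / nR + eps) * Y = (pi ^+ 2 + eps) * Y - (pi ^+ 2 - 16 * (C_tail + 4) / nR) * Y by ring.
move: main q1 q2 q3; move: (16 * (C_tail + 4) / nR) (C_tail / nR) (nR ^+ 2 * D) (kap * Q) => a b dd kq main q1 q2 q3.
lra.
Qed.

(** [profile] is summed over the slack ranks. Its right-hand side consists of Q and the defect, both
    controlled by [scaled_gap]; [sn 1 >= 1 / n] converts the factor of the defect. *)
Lemma sum_sn2_le : \sum_(k <- sl) sn R m k ^+ 2 <= C_weight * eta * nR.
Proof.
have hn := n0; have hk := kap0; have hD := D0; have hQ := Q0; have hY := Y0.
have gap := scaled_gap.
have /andP[e0 e1] := eps01.
have s1 : 0 < sn R m 1 by apply: sn_gt0.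
have s1n := sn1_ge R n8.
have qn : (size sl)%:R <= nR.
  rewrite ler_nat -[leqRHS](size_iota 0); apply: uniq_leq_size.
    exact: (sorted_uniq ltn_trans ltnn).
  by move=> k /(allP sln); rewrite mem_iota.
have pr : \sum_(k <- sl) (sn R m 1 * sn R m k ^+ 2 * Y) <=
   \sum_(k <- sl) (2 * nR * (sn R m 1 * M k ^+ 2 + D)).
  rewrite big_seq [leRHS]big_seq; apply: ler_sum => k ks.
  apply: (profile (u := cotn R m)) => //; first exact: sn0.
  - exact: sn_gt0.
  - by move=> j; exact: sin_le1.
  - exact: cotn_step.
  - exact: cotn_le.
  - exact: (allP sln).
have cD : \sum_(k <- sl) D = (size sl)%:R * D.
  by rewrite big_const_seq count_predT iter_addr_0 mulr_natl.
rewrite -mulr_suml -mulr_sumr -mulr_sumr big_split /= -mulr_sumr cD in pr.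
rewrite -(@ler_pM2l _ (sn R m 1 * Y)) ?mulr_gt0 //.
have lhsE : sn R m 1 * Y * \sum_(k <- sl) sn R m k ^+ 2 = sn R m 1 * (\sum_(k <- sl) sn R m k ^+ 2) * Y by ring.
rewrite lhsE; apply: le_trans pr _.
have d1 : D <= sn R m 1 * (nR * D).
  rewrite mulrA ler_peMl // -(@ler_pM2r _ nR^-1) ?invr_gt0 // mul1r mulfK ?gt_eqF //.
have q1 : (size sl)%:R * D <= nR * (sn R m 1 * (nR * D)).
  by apply: ler_pM => //.
have q2 : 2 * nR * (sn R m 1 * Q + (size sl)%:R * D) <= sn R m 1 * nR * (2 * Q + 2 * (nR ^+ 2 * D)).
  have -> : sn R m 1 * nR * (2 * Q + 2 * (nR ^+ 2 * D)) = 2 * nR * (sn R m 1 * Q + nR * (sn R m 1 * (nR * D))) by ring.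
  by rewrite ler_wpM2l ?mulr_ge0 ?(ltW hn) // lerD2l.
apply: le_trans q2 _.
have -> : sn R m 1 * Y * (C_weight * eta * nR) = sn R m 1 * nR * (C_weight * eta * Y) by ring.
rewrite ler_wpM2l ?mulr_ge0 ?(ltW s1) ?(ltW hn) //.
have nD0 : 0 <= nR ^+ 2 * D by rewrite mulr_ge0 ?sqr_ge0.
have ce0 : 0 <= C_gap * eta * Y.
  by apply: le_trans gap; rewrite addr_ge0 ?divr_ge0 ?mulr_ge0 // ltW.
have -> : C_weight * eta * Y = 6 * (C_gap * eta * Y / kap) by rewrite /C_weight; ring.
have hQ2 : Q <= C_gap * eta * Y / kap.
  rewrite ler_pdivlMr // [Q * kap]mulrC; move: gap nD0.
  by move: (nR ^+ 2 * D) (kap * Q) (C_gap * eta * Y) => a b e; lra.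
have hD2 : nR ^+ 2 * D <= 2 * (C_gap * eta * Y).
  have : 0 <= kap * Q by rewrite mulr_ge0 // ltW.
  by move: gap; move: (nR ^+ 2 * D) (kap * Q) (C_gap * eta * Y) => a b e; lra.
have hE : C_gap * eta * Y <= C_gap * eta * Y / kap.
  by rewrite ler_pdivlMr // ler_piMr // kap1.
by move: hQ2 hD2 hE; move: (C_gap * eta * Y / kap) (C_gap * eta * Y) => a b; lra.
Qed.

Lemma few_slack : (size sl)%:R ^+ 3 <= C_count * eta * nR ^+ 3.
Proof.
have hn := n0; have hk := kap0; have hC := C_tail_ge0; have /andP[e0 e1] := eps01.
have n1 : 1 <= nR by rewrite ler1n.
have C_weight_ge0 : 0 <= C_weight.
  rewrite /C_weight mulr_ge0 ?divr_ge0 ?ltW // /C_gap; lra.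
have eta0 : 0 <= eta by rewrite addr_ge0 // invr_ge0 ltW.
have en : 1 <= eta * nR ^+ 3.
  have : nR^-1 * nR ^+ 3 <= eta * nR ^+ 3 by apply: ler_wpM2r; [rewrite exprn_ge0 // ltW | rewrite lerDr].
  have -> : nR^-1 * nR ^+ 3 = nR ^+ 2 by rewrite [nR ^+ 3]exprS mulKf // gt_eqF.
  move=> h; apply: le_trans h.
  by rewrite exprn_ege1.
have [q6|q6] := leqP 6 (size sl); last first.
  apply: le_trans (_ : 216 <= _).
    have : (size sl <= 6)%N by apply: ltnW.
    rewrite -(ler_nat R) => h; apply: le_trans (_ : 6 ^+ 3 <= _); last by rewrite -natrX ler_nat.
    by rewrite ler_pXn2r ?nnegrE.
  rewrite /C_count -mulrA mulrDl; have : 0 <= 512 * C_weight * (eta * nR ^+ 3).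
    exact: mulr_ge0 (mulr_ge0 (ler0n R 512) C_weight_ge0) (le_trans ler01 en).
  by move: en; move: (eta * nR ^+ 3) => a; lra.
(* Distinct ranks cannot all sit near the ends: at most 2r of them lie outside [r, n - r], so at
   least half have a sine of order q / n. *)
set q := size sl in q6 *; set r := (q %/ 4)%N.
have cnt := sorted_mid_count r so sln; rewrite -/q in cnt.
set t := count _ sl in cnt.
have low : t%:R * (r%:R / (2 * nR)) ^+ 2 <= \sum_(k <- sl) sn R m k ^+ 2.
  rewrite /t; elim: (sl) => [|k l IHl] /=; first by rewrite big_nil mul0r.
  rewrite big_cons natrD mulrDl lerD //.
  have [kr|_] := boolP (r <= k <= n - r)%N; rewrite /= ?mul1r ?mul0r ?sqr_ge0 //.
  have h0 : 0 <= r%:R / (2 * nR) by rewrite divr_ge0 ?mulr_ge0 // ltW.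
  have h := sn_ge R kr.
  by rewrite ler_pXn2r ?nnegrE // (le_trans h0 h).
have upsum := le_trans low sum_sn2_le.
have tq : q%:R / 2 <= t%:R :> R.
  rewrite ler_pdivrMr // -natrM ler_nat; move: cnt; rewrite /r; clear; lia.
have rq : q%:R / 8 <= r%:R :> R.
  rewrite ler_pdivrMr // -natrM ler_nat /r; clear -q6; lia.
have q0 : 0 <= q%:R / 8 :> R by rewrite divr_ge0.
have r2 : (q%:R / 8 / (2 * nR)) ^+ 2 <= (r%:R / (2 * nR)) ^+ 2.
  have i0 : 0 <= (2 * nR)^-1 by rewrite invr_ge0 mulr_ge0 // ltW.
  by rewrite ler_pXn2r ?nnegrE ?mulr_ge0 // ler_wpM2r.
have low2 : q%:R / 2 * (q%:R / 8 / (2 * nR)) ^+ 2 <= C_weight * eta * nR.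
  by apply: le_trans upsum; apply: ler_pM; rewrite ?divr_ge0 ?sqr_ge0.
have n2 : 0 < nR ^+ 2 by rewrite exprn_gt0.
have := ler_wpM2r (ltW n2) low2.
have -> : q%:R / 2 * (q%:R / 8 / (2 * nR)) ^+ 2 * nR ^+ 2 = q%:R ^+ 3 / 512.
  by field; rewrite gt_eqF.
have -> : C_weight * eta * nR * nR ^+ 2 = C_weight * (eta * nR ^+ 3) by ring.
rewrite /C_count -mulrA [(512 * C_weight + 216) * _]mulrDl.
move: en; move: (eta * nR ^+ 3) => a; lra.
Qed.

End FewSlack.

(** * Blocks and distances *)

Section Potential.
Variables (A : rel nat) (n d : nat).
Hypothesis Asym : symmetric A.
Hypothesis Alt : forall i j, A i j -> (j < n)%N.

(** Progress through one window: 1 at entries, 3 at exits, 2 at the other inner vertices. By [good]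
    no edge skips a level. Exits already have level 3, so an edge leaving the window does not change
    its level, and the levels of several windows can be added. *)
Definition psi (k i : nat) : nat :=
  if (i < k)%N then 0
  else if (k + d.+1 <= i)%N || (0 < nbrs A (k + d.+1) n i)%N then 3
  else if (0 < nbrs A 0 k i)%N then 1 else 2.

Fixpoint pot (ks : seq nat) (i : nat) : nat :=
  if ks is k :: ks' then psi k i + pot ks' i else 0.

Lemma psi_far k i j : good A k (k + d.+1)%N -> A i j -> (i < j)%N -> (k + d.+1 <= j)%N ->
  psi k i = psi k j.
Proof.
move=> [jump _] Aij ij kj; rewrite /psi kj orTb.
have -> : (j < k)%N = false by clear -kj; lia.
have -> : (i < k)%N = false.
  by apply/negbTE/negP => ik; have := jump i j ik kj; rewrite Aij.
have -> : (0 < nbrs A (k + d.+1) n i)%N by apply: (@le_nb A _ n i j) => //; rewrite kj (Alt Aij).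
by rewrite orbT.
Qed.

Lemma psi_near k i j : good A k (k + d.+1)%N -> A i j -> (i < j)%N -> (j < k + d.+1)%N ->
  (psi k j <= psi k i + 1)%N /\ (psi k i <= psi k j + 1)%N.
Proof.
move=> [jump gd] Aij ij jk; rewrite /psi.
have -> : (k + d.+1 <= j)%N = false by rewrite leqNgt jk.
have -> : (k + d.+1 <= i)%N = false by clear -ij jk; lia.
have upsum w : (k <= w < k + d.+1)%N -> (0 < nbrs A (k + d.+1) n w)%N -> exists2 v, (k + d.+1 <= v)%N & A w v.
  by move=> _ /nb_gt0[v /andP[kv _] Awv]; exists v.
have low w : (0 < nbrs A 0 k w)%N -> exists2 u, (u < k)%N & A u w.
  by move=> /nb_gt0[u /andP[_ uk] Awu]; exists u; rewrite // Asym.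
rewrite !orFb.
have [ik|ki] := ltnP i k; have [jk'|kj] := ltnP j k => //.
- have lj : (0 < nbrs A 0 k j)%N by apply: (@le_nb A 0 k j i); rewrite // Asym.
  have [/upsum [|v kv Ajv]|_] := boolP (0 < nbrs A (k + d.+1) n j)%N; first by rewrite kj.
    have := gd i j j v ik ltac:(by rewrite kj) ltac:(by rewrite kj) kv Aij Ajv.
    by rewrite eqxx.
  by rewrite lj.
- by clear -ij ki jk'; lia.
have iW : (k <= i < k + d.+1)%N by clear -ki ij jk; lia.
have jW : (k <= j < k + d.+1)%N by clear -kj jk; lia.
have sep w w' : (k <= w < k + d.+1)%N -> (k <= w' < k + d.+1)%N -> A w w' ->
    (0 < nbrs A (k + d.+1) n w')%N -> (0 < nbrs A 0 k w)%N -> False.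
  move=> wW w'W Aww /(upsum w' w'W) [v kv Awv] /low [u uk Auw].
  by have := gd u w w' v uk wW w'W kv Auw Awv; rewrite Aww andbF.
have s1 := sep i j iW jW Aij; have s2 := sep j i jW iW ltac:(by rewrite Asym).
move: s1 s2; case: (0 < nbrs A (k + d.+1) n i)%N; case: (0 < nbrs A (k + d.+1) n j)%N;
  case: (0 < nbrs A 0 k i)%N; case: (0 < nbrs A 0 k j)%N => //= s1 s2;
  solve [case: (s1 isT isT) | case: (s2 isT isT)].
Qed.

Lemma pot_low ks b i : blocks A n d b ks -> (i <= b)%N -> pot ks i = 0%N.
Proof.
elim: ks b => //= k ks IHks b [bk _ _ bl] ib; rewrite /psi (leq_ltn_trans ib bk) add0n.
by apply: IHks bl _; clear -ib bk; lia.
Qed.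

(** Windows are disjoint and an edge ending beyond a window leaves its level unchanged, so along an
    edge at most one summand changes. *)
Lemma pot_lip_lt ks b i j : blocks A n d b ks -> A i j -> (i < j)%N ->
  (pot ks j <= pot ks i + 1)%N /\ (pot ks i <= pot ks j + 1)%N.
Proof.
elim: ks b => //= k ks IHks b [bk kn gd bl] Aij ij.
have [kj|jk] := leqP (k + d.+1) j.
  have [h1 h2] := IHks _ bl Aij ij; rewrite (psi_far gd Aij ij kj).
  by move: h1 h2; clear; lia.
have [h1 h2] := psi_near gd Aij ij jk.
by rewrite (pot_low (i := i) bl) ?(pot_low (i := j) bl) ?addn0 //; clear -jk ij; lia.
Qed.

Lemma pot_lip ks b i j : irreflexive A -> blocks A n d b ks -> A i j -> (pot ks j <= pot ks i + 1)%N.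
Proof.
move=> Airr bl Aij; have [ij|ji|ij] := ltngtP i j.
- by case: (pot_lip_lt bl Aij ij).
- by rewrite Asym in Aij; case: (pot_lip_lt bl Aij ji).
- by rewrite ij Airr in Aij.
Qed.

Lemma pot_top ks b : blocks A n d b ks -> pot ks n.-1 = (3 * size ks)%N.
Proof.
elim: ks b => //= k ks IHks b [bk kn _ bl]; rewrite (IHks _ bl) /psi.
have -> : (n.-1 < k)%N = false by clear -kn; lia.
have -> : (k + d.+1 <= n.-1)%N by clear -kn; lia.
by rewrite /= mulnS.
Qed.

End Potential.

Section CutIdentity.
Variables (R : realFieldType) (n : nat) (A : rel nat) (x : nat -> R) (mu : R).
Hypothesis Asym : symmetric A.
Hypothesis kirchx : forall z, (z < n)%N -> kirch n A x z = - mu * x z.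

(** Summing the eigenvalue equation over the ranks below [K], the inner edges cancel by
    antisymmetry. *)
Lemma flux_negsum K : (K <= n)%N -> cutflux n A x K = mu * negsum x K.
Proof.
move=> Kn; rewrite /negsum mulrN -mulNr mulr_sumr.
have -> : \sum_(0 <= j < K) - mu * x j = \sum_(0 <= z < K) kirch n A x z.
  by rewrite [LHS]big_nat [RHS]big_nat; apply: eq_bigr => z /andP[_ zK]; rewrite kirchx // (leq_trans zK).
pose T z j := (A z j)%:R * (x j - x z).
have asym0 : \sum_(0 <= z < K) \sum_(0 <= j < K) T z j = 0.
  set S := (X in X = 0); suff : S = - S by move/eqP; rewrite -subr_eq0 opprK -mulr2n mulrn_eq0 /= => /eqP.
  rewrite {1}/S exchange_big /= /S -sumrN; apply: eq_bigr => z _; rewrite -sumrN.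
  by apply: eq_bigr => j _; rewrite /T Asym; ring.
rewrite /cutflux -[LHS]add0r -{1}asym0 -big_split /=; apply: eq_bigr => z _.
by rewrite /kirch (@big_cat_nat _ _ _ K 0 n).
Qed.

End CutIdentity.

Lemma blocks_size A n d b ks : blocks A n d b ks -> (b + d.+1 * size ks <= maxn b n)%N.
Proof.
elim: ks b => /= [|k ks IHks] b; first by rewrite muln0 addn0 leq_maxl.
move=> [bk kn _ /IHks]; rewrite mulnS; clear -bk kn; lia.
Qed.

(** * From vertices to ranks *)

Section Transport.
Variables (R : realFieldType) (V : finType) (G : sgraph V) (f : V -> R) (v0 : V) (mu : R).
Hypothesis con : connected_graph G.
Hypothesis eig : forall v, \sum_(w : V) (adj G v w)%:R * (f w - f v) = - mu * f v.

Local Notation n := #|V|.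
Definition byval : seq V := sort (fun u v => f u <= f v) (enum V).
Local Notation vs := byval.
(** Capping the index continues the sequence by its last value, so that it is monotone on all of
    [nat]. *)
Definition rankval (i : nat) : R := f (nth v0 vs (minn i n.-1)).
Definition rankadj : rel nat :=
  fun i j => [&& (i < n)%N, (j < n)%N & adj G (nth v0 vs i) (nth v0 vs j)].
Local Notation X := rankval.
Local Notation A := rankadj.

Lemma byval_perm : perm_eq vs (enum V).
Proof. by rewrite /byval perm_sort. Qed.

Lemma size_byval : size vs = n.
Proof. by rewrite (perm_size byval_perm) -cardE. Qed.

Lemma byval_uniq : uniq vs.
Proof. by rewrite (perm_uniq byval_perm) enum_uniq. Qed.

Lemma mem_byval v : v \in vs.
Proof. by rewrite (perm_mem byval_perm) mem_enum. Qed.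

Lemma byval_gt0 : (0 < n)%N. Proof. by case: con. Qed.

Lemma rankvalE i : (i < n)%N -> X i = f (nth v0 vs i).
Proof. by move=> i_n; rewrite /rankval; congr (f (nth _ _ _)); clear -i_n; lia. Qed.

Lemma ranked_graph : ranked n A X.
Proof.
split.
- by move=> i j; rewrite /rankadj adj_sym; do 2!case: (_ < _)%N.
- by move=> i; rewrite /rankadj adj_irr !andbF.
- by move=> i j /and3P[].
move=> i j ij; rewrite /rankval.
have tot : total (fun u v => f u <= f v) by move=> u v; exact: le_total.
have tr : transitive (fun u v => f u <= f v) by move=> u v w; exact: le_trans.
apply: (sorted_leq_nth tr (fun u => lexx (f u)) v0 (sort_sorted tot _)).
- by rewrite inE -/vs size_byval; have := byval_gt0; clear; lia.
- by rewrite inE -/vs size_byval; have := byval_gt0; clear; lia.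
by clear -ij; lia.
Qed.

Lemma sum_rank (T : Type) (idx : T) (op : Monoid.com_law idx) (F : V -> T) :
  \big[op/idx]_(0 <= i < n) F (nth v0 vs i) = \big[op/idx]_(v : V) F v.
Proof.
rewrite -size_byval -(big_nth v0 xpredT F) (perm_big _ byval_perm).
by rewrite big_enum.
Qed.

Lemma rank_degree z : (z < n)%N -> nbrs A 0 n z = degree G (nth v0 vs z).
Proof.
move=> zn; rewrite /nbrs /degree cardsE -sum1_card.
transitivity (\sum_(v : V) (adj G (nth v0 vs z) v : nat))%N.
  rewrite -(sum_rank _ (fun v => adj G (nth v0 vs z) v : nat)) [LHS]big_nat [RHS]big_nat.
  by apply: eq_bigr => i /andP[_ i_n]; rewrite /rankadj zn i_n.
by rewrite [RHS]big_mkcond /=; apply: eq_bigr => v _; rewrite -topredE /=; case: (adj G _ v).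
Qed.

Lemma rank_kirch z : (z < n)%N -> kirch n A X z = - mu * X z.
Proof.
move=> zn; rewrite rankvalE // -eig -(sum_rank _ (fun w => (adj G (nth v0 vs z) w)%:R * (f w - f (nth v0 vs z)))).
rewrite /kirch [LHS]big_nat [RHS]big_nat; apply: eq_bigr => i /andP[_ i_n].
by rewrite /rankadj zn i_n /= !rankvalE.
Qed.

Lemma rank_conn k : (0 < k < n)%N -> (0 < cutsize n A k)%N.
Proof.
move=> kr; rewrite lt0n; apply/negP => /eqP e0.
have no i j : (i < k)%N -> (k <= j)%N -> ~~ A i j.
  move=> ik kj; apply/negP => Aij.
  have jn : (j < n)%N by case/and3P: Aij.
  have h1 : (0 < nbrs A k n i)%N by apply: (@le_nb A k n i j) => //; rewrite kj.
  have := @sum_ge1 (nbrs A k n) 0 k i ik; rewrite -/(cutsize n A k) e0; clear -h1; lia.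
pose a := [pred v : V | (index v vs < k)%N].
have cl : fingraph.closed (adj G) a.
  move=> u v uv; rewrite !inE.
  have iu : (index u vs < n)%N by rewrite -size_byval index_mem mem_byval.
  have iv : (index v vs < n)%N by rewrite -size_byval index_mem mem_byval.
  have Auv : A (index u vs) (index v vs) by rewrite /rankadj iu iv !nth_index ?mem_byval.
  have Avu : A (index v vs) (index u vs) by rewrite /rankadj iu iv !nth_index ?mem_byval // adj_sym.
  have [uk|uk] := ltnP (index u vs) k; have [vk|vk] := ltnP (index v vs) k => //.
  - by have := no _ _ uk vk; rewrite Auv.
  - by have := no _ _ vk uk; rewrite Avu.
have := closed_connect cl (proj2 con (nth v0 vs 0) (nth v0 vs k)).
rewrite !inE !index_uniq ?size_byval ?byval_uniq //; clear -kr; lia.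
Qed.

Lemma rank_diam d b ks : (2 < d)%N -> (b < n)%N -> blocks A n d b ks -> (3 * size ks <= diam G)%N.
Proof.
move=> d3 bn bl; have n0 := byval_gt0; case: ranked_graph => [Asym Airr Alt _].
set x := nth v0 vs 0; set y := nth v0 vs n.-1.
apply: (@leq_trans (dist G x y)); last first.
  apply: leq_trans (leq_bigmax (F := fun x => \max_(y : V) dist G x y) x).
  exact: (leq_bigmax (F := fun y => dist G x y)).
rewrite /dist; set P := fun k => walk G k x y.
have [hp|hp] := boolP (has P (iota 0 n)); last first.
  (* The default value of [dist] is [#|V|]; it is large enough because disjoint windows have at
     least three ranks each. *)
  move: (hp); rewrite has_find -leqNgt size_iota => h; apply: leq_trans h.
  have := blocks_size bl; rewrite (maxn_idPr (ltnW bn)).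
  have : (3 * size ks <= d.+1 * size ks)%N by rewrite leq_mul2r ltnW ?orbT.
  clear; lia.
have := nth_find 0%N hp; rewrite has_find size_iota in hp; rewrite nth_iota // add0n.
move: (find _ _) => k /existsP[p /andP[pth /eqP lst]].
pose phi v := pot A n d ks (index v vs).
have lip u v : adj G u v -> (phi v <= phi u + 1)%N.
  move=> uv; apply: (pot_lip Asym Alt Airr bl).
  have iu : (index u vs < n)%N by rewrite -size_byval index_mem mem_byval.
  have iv : (index v vs < n)%N by rewrite -size_byval index_mem mem_byval.
  by rewrite /rankadj iu iv !nth_index ?mem_byval.
have walk_le : forall q u, path (adj G) u q -> (phi (last u q) <= phi u + size q)%N.
  elim=> [|v q IHq] u /=; first by rewrite addn0.
  move=> /andP[uv pq]; have := IHq _ pq; have := lip _ _ uv; clear; lia.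
have := walk_le _ _ pth; rewrite lst size_tuple /phi !index_uniq ?size_byval ?byval_uniq //; last by rewrite prednK.
by rewrite (pot_top bl) (pot_low bl).
Qed.

End Transport.

(** * The eigenvector of the algebraic connectivity *)

(** Both lists contain each number as often as it is a root of the characteristic polynomial. *)
Lemma eigenvalues_perm (R : realType) (n : nat) (A : 'M[R]_n) (s : seq R) :
  char_poly A = \prod_(y <- s) ('X - y%:P) -> perm_eq (eigenvalues A) s.
Proof.
move=> pE; have p0 : char_poly A != 0 by rewrite monic_neq0 // char_poly_monic.
apply/allP => x _ /=; rewrite -[X in _ == X]mu_prod_XsubC -pE /eigenvalues count_flatten -map_comp.
rewrite (eq_map (g := fun y => if y == x then mup x (char_poly A) else 0%N)); last first.
  move=> y /=; rewrite count_nseq /=; case: eqP => [->|_]; by rewrite ?mul1n.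
rewrite sumnE big_map -big_mkcond /= big_const_seq iter_addn_0 mulnC.
have := roots_on_rootsR p0 x; rewrite in_itv /= => rE.
have u : uniq (rootsR (char_poly A)).
  by apply: (sorted_uniq lt_trans ltxx); exact: sorted_roots.
rewrite (count_uniq_mem x u) -rE.
have [rx|rx] := boolP (root (char_poly A) x); first by rewrite mul1n.
by rewrite mul0n mupNroot.
Qed.

Lemma eigenvalues_sorted (R : realType) (n : nat) (A : 'M[R]_n) :
  sorted <=%R (eigenvalues A).
Proof.
rewrite /eigenvalues; have := sorted_roots (- cauchy_bound (char_poly A)) (cauchy_bound (char_poly A)) (char_poly A).
rewrite -/(rootsR _); elim: (rootsR _) => //= x s IHs; rewrite (path_sortedE lt_trans) => /andP[/allP xs /IHs so].
rewrite sorted_pairwise ?pairwise_cat //; last exact: le_trans.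
rewrite -!sorted_pairwise //; [|exact: le_trans|exact: le_trans].
rewrite so andbT; apply/andP; split.
  apply/allrelP => y z /nseqP[-> _] /flattenP[t /mapP[w ws ->] /nseqP[-> _]].
  by rewrite ltW // xs.
by elim: (mup _ _) => //= m; case: m => //= m ->; rewrite lexx.
Qed.

(** * The spectrum of a real symmetric matrix *)

Section RealSymmetric.
Variables (R : realType) (n : nat) (A : 'M[R]_n).
Hypothesis Asym : A^T = A.

Local Notation toC := (real_complex R).
Let AC := map_mx toC A.
Let P := spectralmx AC.
Let D := spectral_diag AC.

Let ACherm : AC \is hermsymmx.
Proof.
apply: realsym_hermsym.
  by apply/is_hermitianmxP; rewrite expr0 scale1r map_mx_id // /AC map_trmx Asym.
by apply/mxOverP => i j; rewrite mxE complex_real.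
Qed.

Let ACE : AC = invmx P *m diag_mx D *m P.
Proof. exact/orthomx_spectralP/hermitian_normalmx. Qed.

Let Dreal i : toC (complex.Re (D 0 i)) = D 0 i.
Proof. by apply: RRe_real; apply/mxOverP/hermitian_spectral_diag_real. Qed.

(** Diagonalisation is carried out over the complex numbers; the diagonal is real ([Dreal]), so
    taking real parts loses nothing. *)
Definition spectrum : seq R := [seq complex.Re (D 0 i) | i <- enum 'I_n].

Lemma char_poly_spectrum : char_poly A = \prod_(y <- spectrum) ('X - y%:P).
Proof.
apply: (map_poly_inj toC).
rewrite map_char_poly -/AC rmorph_prod /= big_map big_enum /=.
have -> : char_poly AC = char_poly (diag_mx D).
  rewrite ACE /char_poly /char_poly_mx.
  have Pu : P \in unitmx by apply: spectral_unit.
  have -> : 'X%:M - map_mx polyC (invmx P *m diag_mx D *m P) =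
    map_mx polyC (invmx P) *m ('X%:M - map_mx polyC (diag_mx D)) *m map_mx polyC P.
    rewrite mulmxBr mulmxBl !map_mxM; congr (_ - _).
    by rewrite mul_mx_scalar -scalemxAl -map_mxM mulVmx // map_mx1 scalemx1.
  rewrite !det_mulmx mulrAC -det_mulmx -map_mxM mulVmx // map_mx1 det1 mul1r //.
rewrite char_poly_trig ?diag_mx_is_trig //; apply: eq_bigr => i _.
by rewrite mxE eqxx mulr1n rmorphB /= map_polyX map_polyC /= Dreal.
Qed.

(** Two zero diagonal entries would give two independent rows of [P] in the kernel. *)
Lemma spectrum_count0 : (n - \rank A <= 1)%N -> (count_mem 0%R spectrum <= 1)%N.
Proof.
move=> rk; rewrite leqNgt; apply/negP => c2.
have [i [j [ij di dj]]] : exists i j, [/\ i != j, D 0 i = 0 & D 0 j = 0].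
  move: c2; rewrite /spectrum count_map -size_filter.
  have : uniq [seq x <- enum 'I_n | preim (fun i => complex.Re (D 0 i)) (pred1 0) x] by rewrite filter_uniq // enum_uniq.
  have : forall k, k \in [seq x <- enum 'I_n | preim (fun i => complex.Re (D 0 i)) (pred1 0) x] -> D 0 k = 0.
    by move=> k; rewrite mem_filter /= => /andP[/eqP d0 _]; rewrite -Dreal d0.
  case: (seq.filter _ _) => [|i [|j l]] h /= il c2.
  - by [].
  - by [].
  exists i, j; split.
  - by case/andP: il; rewrite inE negb_or => /andP[].
  - by apply: h; rewrite inE eqxx.
  - by apply: h; rewrite !inE eqxx orbT.
have Pu : P \in unitmx by apply: spectral_unit.
pose f (k : 'I_2) := if k == 0 then i else j.
pose E : 'M[R[i]]_(2, n) := rowsub f 1%:M.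
have PA : P *m AC = diag_mx D *m P by rewrite {1}ACE -mulmxA mulKVmx.
have EPA : E *m P *m AC = 0.
  rewrite -mulmxA PA mulmxA; suff -> : E *m diag_mx D = 0 by rewrite mul0mx.
  apply/matrixP => k l; rewrite mul_mx_diag !mxE /f.
  case: ifP => _; case: eqP => [<-|_]; by rewrite ?di ?dj ?mulr0 ?mul0r.
have Efree : row_free E.
  apply/row_freeP; exists E^T; apply/matrixP => k l; rewrite !mxE.
  rewrite (bigD1 (f k)) //= !mxE eqxx mul1r big1 ?addr0 => [|m /negPf mk]; last first.
    by rewrite !mxE eq_sym mk mul0r.
  have -> : (f l == f k) = (k == l).
    rewrite /f; case: k => [[|[|//]] hk]; case: l => [[|[|//]] hl] //=;
      rewrite ?eqxx ?(negPf ij) 1?eq_sym ?(negPf ij) //; exact/esym/eqP/val_inj.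
  by [].
have r2 : \rank (E *m P) = 2.
  by rewrite mxrankMfree ?row_free_unit //; apply/eqP.
have : (E *m P <= kermx AC)%MS by apply/sub_kermxP.
move=> /mxrankS; rewrite r2 mxrank_ker mxrank_map => h.
by have := leq_trans h rk.
Qed.

End RealSymmetric.

(** * The Laplacian of a connected graph *)

Section Laplacian.
Variables (R : realType) (V : finType) (G : sgraph V).
Local Notation L := (laplacian G R).

Lemma laplacian_sym : L^T = L.
Proof.
apply/matrixP => i j; rewrite !mxE adj_sym; congr (_ - _).
by have [->|ij] := eqVneq i j; rewrite ?eqxx // eq_sym (negPf ij).
Qed.

Lemma sum_enum_val (F : V -> R) : \sum_(j < #|V|) F (enum_val j) = \sum_(v : V) F v.
Proof. by rewrite [RHS](reindex _ (onW_bij _ (enum_val_bij V))). Qed.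

Lemma sum_adj (x : V) : \sum_(w : V) (adj G x w)%:R = (degree G x)%:R :> R.
Proof.
rewrite /degree cardsE -sum1_card natr_sum [RHS]big_mkcond /=.
by apply: eq_bigr => v _; rewrite -topredE /=; case: (adj G _ v).
Qed.

Lemma laplacian_eigen (v : 'rV[R]_#|V|) (r : R) (f := fun x => v 0 (enum_rank x)) :
  v *m L = r *: v -> forall x, \sum_(w : V) (adj G x w)%:R * (f w - f x) = - r * f x.
Proof.
move=> e x; have /rowP /(_ (enum_rank x)) := e; rewrite !mxE => {}e.
rewrite mulNr -e.
under eq_bigr do rewrite mulrBr.
rewrite sumrB -mulr_suml sum_adj -(sum_enum_val (fun w => (adj G x w)%:R * f w)).
under [in RHS]eq_bigr do rewrite !mxE mulrBr enum_rankK.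
rewrite sumrB [X in _ = - (X - _)](bigD1 (enum_rank x)) //= eqxx mulr1n enum_rankK.
rewrite [X in _ = - (_ + X - _)]big1 ?addr0 => [|i /negPf ix]; last first.
  by rewrite ix mulr0n mulr0.
rewrite opprB mulrC; congr (_ - _).
by apply: eq_bigr => i _; rewrite adj_sym mulrC /f enum_valK.
Qed.

(** The Dirichlet form, written over ordered pairs, hence the factor 2. It gives nonnegative
    eigenvalues, and for r = 0 that [f] is constant along edges. *)
Lemma energy (f : V -> R) (r : R) :
  (forall x, \sum_(w : V) (adj G x w)%:R * (f w - f x) = - r * f x) ->
  2 * (r * \sum_x f x ^+ 2) = \sum_x \sum_w (adj G x w)%:R * (f w - f x) ^+ 2.
Proof.
move=> e; pose S := \sum_x \sum_w (adj G x w)%:R * (f w - f x) * f x.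
have S1 : S = - (r * \sum_x f x ^+ 2).
  rewrite mulr_sumr -sumrN; apply: eq_bigr => x _; rewrite -mulr_suml e; ring.
have S2 : S = \sum_x \sum_w (adj G x w)%:R * (f x - f w) * f w.
  rewrite /S exchange_big /=; apply: eq_bigr => x _; apply: eq_bigr => w _.
  by rewrite adj_sym.
have -> : 2 * (r * \sum_x f x ^+ 2) = - (S + S) by rewrite S1; ring.
rewrite {2}S2 /S -big_split -sumrN; apply: eq_bigr => x _ /=.
rewrite -big_split -sumrN; apply: eq_bigr => w _ /=; ring.
Qed.

Lemma harmonic_const (f : V -> R) : connected_graph G ->
  (forall x, \sum_(w : V) (adj G x w)%:R * (f w - f x) = 0) -> forall x y, f x = f y.
Proof.
move=> [_ con] e x y.
have e0 z : \sum_(w : V) (adj G z w)%:R * (f w - f z) = - 0 * f z by rewrite e oppr0 mul0r.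
have := energy e0; rewrite mul0r mulr0 => /esym en.
have T0 u w : 0 <= (adj G u w)%:R * (f w - f u) ^+ 2 by rewrite mulr_ge0 ?sqr_ge0.
have eqe u w : adj G u w -> f u = f w.
  move=> uw; have /eqP := en; rewrite psumr_eq0; last by move=> ? _; rewrite sumr_ge0.
  move=> /allP /(_ u); rewrite mem_index_enum => /(_ isT) /=.
  rewrite psumr_eq0 // => /allP /(_ w); rewrite mem_index_enum uw mul1r => /(_ isT) /=.
  by rewrite sqrf_eq0 subr_eq0 => /eqP.
have cl : fingraph.closed (adj G) [pred z | f z == f x].
  by move=> u w uw; rewrite !inE (eqe u w uw).
have := closed_connect cl (con x y); rewrite !inE eqxx => /esym /eqP ->.
by [].
Qed.

Lemma laplacian_rank : connected_graph G -> (#|V| - \rank L <= 1)%N.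
Proof.
move=> con; rewrite -mxrank_ker.
apply: leq_trans (rank_leq_row (const_mx 1 : 'rV[R]_#|V|)); apply: mxrankS.
apply/row_subP => i; have : row i (kermx L) *m L = 0 by rewrite -row_mul mulmx_ker row0.
move: (row i (kermx L)) => v vL.
have e := @laplacian_eigen v 0 ltac:(by rewrite vL scale0r).
have [v0 _] := card_gt0P (proj1 con).
have e0 z : \sum_(w : V) (adj G z w)%:R * (v 0 (enum_rank w) - v 0 (enum_rank z)) = 0.
  by rewrite e oppr0 mul0r.
have h := harmonic_const con e0.
have -> : v = v 0 (enum_rank v0) *: const_mx 1.
  apply/rowP => j; rewrite !mxE mulr1 -{1}(enum_valK j); exact: h.
exact: scalemx_sub.
Qed.

Theorem alg_connectivity_eigen (mu := alg_connectivity R G) : connected_graph G -> (1 < #|V|)%N ->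
  0 < mu /\ exists2 f : V -> R, exists x, f x != 0 &
    forall x, \sum_(w : V) (adj G x w)%:R * (f w - f x) = - mu * f x.
Proof.
move=> con n2; pose s := spectrum L.
have pE : char_poly L = \prod_(y <- s) ('X - y%:P) := char_poly_spectrum laplacian_sym.
have pm := eigenvalues_perm pE; have so := eigenvalues_sorted L.
have sz : size (eigenvalues L) = #|V|.
  by rewrite (perm_size pm) size_map size_enum_ord.
have eigP r : root (char_poly L) r -> 0 <= r /\ exists2 f : V -> R, exists x, f x != 0 &
    forall x, \sum_(w : V) (adj G x w)%:R * (f w - f x) = - r * f x.
  rewrite -eigenvalue_root_char => /eigenvalueP[v vL v0].
  have e := laplacian_eigen vL.
  have [i vi] : exists i, v 0 i != 0 by apply/rV0Pn.
  split; last by exists (fun x => v 0 (enum_rank x)) => //; exists (enum_val i); rewrite enum_valK.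
  have en := energy e.
  have pos : 0 < \sum_x v 0 (enum_rank x) ^+ 2.
    rewrite (bigD1 (enum_val i)) //= ltr_wpDr //; first by rewrite sumr_ge0 // => x _; rewrite sqr_ge0.
    by rewrite enum_valK lt_neqAle sqr_ge0 andbT eq_sym sqrf_eq0.
  have : 0 <= 2 * (r * \sum_x v 0 (enum_rank x) ^+ 2).
    by rewrite en sumr_ge0 // => x _; rewrite sumr_ge0 // => w _; rewrite mulr_ge0 ?sqr_ge0.
  by rewrite pmulr_rge0 // pmulr_lge0.
have c0 : (count_mem 0%R (eigenvalues L) <= 1)%N.
  by rewrite (seq.permP pm); apply: spectrum_count0; [exact: laplacian_sym | exact: laplacian_rank].
have rootE y : y \in eigenvalues L -> root (char_poly L) y.
  by rewrite (perm_mem pm) pE root_prod_XsubC.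
have muin : mu \in eigenvalues L by rewrite /mu /alg_connectivity mem_nth // sz.
have [mu0 ef] := eigP _ (rootE _ muin).
split=> //; rewrite lt_neqAle mu0 andbT; apply/eqP => mu00.
move: c0 so muin sz mu00 rootE; rewrite /mu /alg_connectivity.
case: (eigenvalues L) => [|a [|b l]] //=; first by move=> _ _ _ h; rewrite -h in n2.
move=> c0 /andP[ab _] _ _ b0 rootE.
(* If the second eigenvalue vanished, the first one, between 0 and it, would vanish too, against the
   multiplicity bound [c0]. *)
have a0 : a = 0.
  apply/eqP; rewrite eq_le {1}b0 ab /=.
  by have [] := eigP a (rootE a ltac:(by rewrite inE eqxx)).
by move: c0; rewrite -b0 a0 eqxx.
Qed.

End Laplacian.

(** * Counting the blocks *)

Section Eigensequence.
Variables (R : realFieldType) (n : nat) (A : rel nat) (x : nat -> R) (mu : R).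
Hypothesis rk : ranked n A x.
Hypothesis conn : forall k, (0 < k < n)%N -> (0 < cutsize n A k)%N.
Hypothesis kirchx : forall z, (z < n)%N -> kirch n A x z = - mu * x z.
Hypothesis mu0 : 0 < mu.
Hypothesis nonzero : exists2 j, (j < n)%N & x j != 0.

Local Notation M := (negsum x).
Local Notation B := (x n.-1 - x 0%N).

Let n0 : (0 < n)%N. Proof. by case: nonzero => j jn _; apply: leq_ltn_trans jn. Qed.

(** No edge crosses the cut at [n], so the flux identity there is orthogonality to the constants. *)
Lemma negsum_n : M n = 0.
Proof.
have [Asym _ _ _] := rk.
have := flux_negsum Asym kirchx (leqnn n); rewrite /cutflux big_nat big1; last first.
  by move=> z _; rewrite /upsum big_geq.
by move/esym/eqP; rewrite mulf_eq0 gt_eqF //= => /eqP.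
Qed.

Lemma sum_x : \sum_(0 <= j < n) x j = 0.
Proof. by have /eqP := negsum_n; rewrite /negsum oppr_eq0 => /eqP. Qed.

Lemma x_first : x 0%N <= 0.
Proof.
rewrite leNgt; apply/negP => x0; have := sum_x; rewrite big_ltn // => e.
have : 0 <= \sum_(1 <= i < n) x i.
  by rewrite big_nat sumr_ge0 // => i _; apply: le_trans (ltW x0) (xle rk _).
by move: e x0; lra.
Qed.

Lemma x_last : 0 <= x n.-1.
Proof.
rewrite leNgt; apply/negP => x0; have := sum_x; rewrite -(prednK n0) big_nat_recr //= => e.
have : \sum_(0 <= i < n.-1) x i <= 0.
  rewrite big_nat sumr_le0 // => i /andP[_ i_n]; apply: le_trans (ltW x0); apply: (xle rk); exact: ltnW.
by move: e x0; lra.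
Qed.

Lemma x_bound j : (j < n)%N -> `|x j| <= B.
Proof.
move=> jn; have := x_first; have := x_last.
have := xle rk (leq0n j); have : x j <= x n.-1 by apply: (xle rk); clear -jn; lia.
by rewrite ler_norml => *; apply/andP; split; lra.
Qed.

Lemma range_bound i j : (i < n)%N -> (j < n)%N -> x j - x i <= B.
Proof.
move=> i_n jn; have := xle rk (leq0n i).
have : x j <= x n.-1 by apply: (xle rk); clear -jn; lia.
lra.
Qed.

Lemma range_gt0 : 0 < B.
Proof.
have [j jn xj] := nonzero; rewrite lt_neqAle.
by rewrite (le_trans _ (x_bound jn)) // andbT eq_sym; apply: contraNneq xj => B0;
  rewrite -normr_le0 -B0 x_bound.
Qed.

Lemma x_first_lt : x 0%N < 0.
Proof.
have := x_first; rewrite le_eqVlt => /orP[/eqP x0|//]; have := range_gt0; rewrite x0 subr0 => xn.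
have := sum_x; rewrite -(prednK n0) big_nat_recr //= => e.
have : 0 <= \sum_(0 <= i < n.-1) x i.
  by rewrite big_nat sumr_ge0 // => i _; rewrite -x0; apply: (xle rk).
by move: e xn; lra.
Qed.

Lemma abel m : \sum_(0 <= j < m.+1) x j ^+ 2 =
  \sum_(1 <= k < m.+1) M k * (x k - x k.-1) - M m.+1 * x m.
Proof.
elim: m => [|m IHm].
  by rewrite big_nat1 [in RHS]big_geq // MS M0; ring.
by rewrite big_nat_recr //= IHm [in RHS]big_nat_recr //= (MS x m.+1); ring.
Qed.

Lemma sum_sq : \sum_(0 <= j < n) x j ^+ 2 = tailsum n x 0.
Proof.
have := abel n.-1; rewrite (prednK n0) negsum_n mul0r subr0 => ->.
by [].
Qed.

Lemma sum_sq_diff : \sum_(0 <= j < n) (M j.+1 - M j) ^+ 2 = \sum_(0 <= j < n) x j ^+ 2.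
Proof. by apply: eq_bigr => j _; rewrite MS; ring. Qed.

(** Cauchy-Schwarz over the n steps. By connectedness the square of a step is at most the flux times
    the step, that is mu M(k) times the step, and these products sum to mu times the sum of squares.
    With n^2 mu bounded, B^2 is only a fraction 1 / n of that sum. *)
Lemma range_sq : B ^+ 2 <= n%:R * mu * \sum_(0 <= j < n) x j ^+ 2.
Proof.
have [Asym _ _ _] := rk.
have nR : 0 < n%:R :> R by rewrite ltr0n.
have Bs k : x k - x 0%N = \sum_(1 <= i < k.+1) (x i - x i.-1).
  elim: k => [|k IHk]; first by rewrite big_geq // subrr.
  by rewrite big_nat_recr //= -IHk; ring.
have Bsum : B = \sum_(1 <= k < n) (x k - x k.-1) by rewrite Bs (prednK n0).
have h1 : \sum_(1 <= k < n) (x k - x k.-1) ^+ 2 <= mu * \sum_(0 <= j < n) x j ^+ 2.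
  rewrite sum_sq /tailsum mulr_sumr [leLHS]big_nat [leRHS]big_nat; apply: ler_sum => k kr.
  have g0 : 0 <= x k - x k.-1 by rewrite subr_ge0 (xle rk) // leq_pred.
  rewrite mulrA -(flux_negsum Asym kirchx) //; last by clear -kr; lia.
  rewrite expr2 ler_wpM2r //; apply: le_trans (ecut_gap rk k).
  by rewrite ler_peMl // ler1n conn.
have h2 : 0 <= \sum_(1 <= k < n) (n%:R * (x k - x k.-1) - B) ^+ 2.
  by rewrite sumr_ge0 // => k _; rewrite sqr_ge0.
have e2 : \sum_(1 <= k < n) (n%:R * (x k - x k.-1) - B) ^+ 2 =
   n%:R ^+ 2 * (\sum_(1 <= k < n) (x k - x k.-1) ^+ 2) - 2 * n%:R * B * B + (n.-1)%:R * B ^+ 2.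
  transitivity (n%:R ^+ 2 * (\sum_(1 <= k < n) (x k - x k.-1) ^+ 2)
     - (2 * n%:R * B) * (\sum_(1 <= k < n) (x k - x k.-1)) + \sum_(1 <= k < n) B ^+ 2).
    by rewrite !mulr_sumr -sumrB -big_split /=; apply: eq_bigr => k _; ring.
  by rewrite -Bsum sumr_const_nat subn1 [n.-1%:R * _]mulr_natl.
have nn : (n.-1)%:R <= n%:R :> R by rewrite ler_nat leq_pred.
have h3 := ler_wpM2r (sqr_ge0 B) nn.
rewrite e2 in h2.
rewrite -(@ler_pM2l _ n%:R) //.
have h4 := ler_wpM2l (sqr_ge0 (n%:R : R)) h1.
move: h2 h3 h4; move: (\sum_(1 <= k < n) _) (\sum_(0 <= j < n) _) (n.-1%:R : R) B (n%:R : R) => S1 S2 N1 b N h2 h3 h4.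
move: h2 h3 h4; rewrite !expr2; lra.
Qed.

End Eigensequence.

(** * From the local steps to the number of blocks *)

Section Assembly.
Variables (R : realType) (m d tau S K1 : nat) (A : rel nat) (x : nat -> R).
Local Notation n := m.+2.
Local Notation nR := (n%:R : R).
Variables (mu c kap L eps : R) (typ : pred nat).
Hypothesis rk : ranked n A x.
Hypothesis conn : forall k, (0 < k < n)%N -> (0 < cutsize n A k)%N.
Hypothesis kirchx : forall z, (z < n)%N -> kirch n A x z = - mu * x z.
Hypothesis mu0 : 0 < mu.
Hypothesis nonzero : exists2 j, (j < n)%N & x j != 0.
Hypothesis c1 : 1 <= c.
Hypothesis kap0 : 0 < kap.
Hypothesis kap1 : kap <= 1.
Hypothesis tau1 : (tau <= 1)%N.
Hypothesis dS : (d.+2 <= S)%N.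
Hypothesis SK : (S + 3 <= K1)%N.
Hypothesis LS : S%:R + 1 <= L.
Hypothesis eps01 : 0 <= eps <= 1.
Hypothesis muc : nR ^+ 2 * mu <= c * pi ^+ 2 + eps.

(** [C_mu] bounds n^2 mu, [C_err] bounds [err] in units of n B^2, and by [range_sq] all remainders
    together amount to at most [C_rem] / n of the sum of squares. *)
Definition C_mu : R := 16 * c + 1.
Definition C_err : R := 4 * L ^+ 2 + 6 * L + 1.
Definition C_rem : R := (C_mu * C_err + K1%:R + 1) * C_mu.

Hypothesis n8 : (8 <= n)%N.
Hypothesis nC : 2 * C_rem <= nR.

Local Notation M := (negsum x).
Local Notation B := (x m.+1 - x 0%N).
Local Notation N := (node tau x).
Local Notation T := (scale x mu c B L).

Hypothesis step : forall b, (b + K1 <= n)%N ->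
  [\/ exists2 s, (0 < s <= S)%N & N (b + s)%N - N b <= T b * (s%:R - kap),
      [/\ typ b, typ (b + d.+1)%N, good A (b + tau).+1 ((b + tau).+1 + d.+1)%N
        & N (b + d.+1)%N - N b <= T b * d.+1%:R + mu * B]
    | [/\ ~~ typ b, typ (b + d.+2)%N, good A (b + tau).+2 ((b + tau).+2 + d.+1)%N
        & N (b + d.+2)%N - N b <= T b * d.+2%:R + mu * B]].

Lemma many_blocks : exists ks q,
  [/\ blocks A n d tau ks, (n <= d.+1 * size ks + S.+1 * q + K1.+1)%N &
      q%:R ^+ 3 <= C_count C_rem kap * (eps + nR^-1) * nR ^+ 3].
Proof.
have [_ _ _ xmono] := rk.
have Mn := negsum_n rk kirchx mu0.
have xB := x_bound rk kirchx mu0 nonzero; have xr := @range_bound _ _ _ _ rk.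
have B0 := range_gt0 rk kirchx mu0 nonzero; rewrite /= in xB xr B0.
have [sl [ks [so sn bl cnt F]]] := chain xmono Mn xB xr mu0 c1 (ltW kap0) tau1 dS SK LS step
   (leq0n n) (ltn0Sn _).
exists ks, (size sl); split=> //.
  by move: cnt; rewrite add0n; have := leq_b1 (~~ typ 0); clear; lia.
have hmu := mu0; have hc := c1; have hk := kap0; have hL := LS.
have L1 : 1 <= L by have : 0 <= S%:R :> R by []; move: hL; lra.
have n0 : 0 < nR by rewrite ltr0n.
have hnC := nC; have /andP[e0 e1] := eps01.
set Xs := \sum_(0 <= j < n) x j ^+ 2.
set Y := \sum_(0 <= k < n) M k ^+ 2 in F.
set Q := \sum_(s <- sl) M s ^+ 2 in F.
have Bs : B ^+ 2 <= nR * mu * Xs := range_sq rk conn kirchx mu0 nonzero.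
have XsE : Xs = tailsum n x 0 := sum_sq rk kirchx mu0 nonzero.
have M_ge : forall k, (k <= n)%N -> 0 <= M k by move=> k; exact: (M_ge0 xmono Mn).
have Mlip : forall k, (k <= n)%N -> M k <= k%:R * B.
  move=> k kn; have := @M_lip _ _ _ _ xB 0 k; rewrite add0n M0 subr0 => h.
  exact: le_trans (ler_norm _) (h kn).
have pi16 : pi ^+ 2 <= 16 :> R.
  have := pihalf_lt2 R; have := pi_gt0 R => p0 p4.
  have : 0 <= (4 - pi) * (4 + pi) :> R by rewrite mulr_ge0 ?subr_ge0 //; lra.
  lra.
have mun : nR ^+ 2 * mu <= C_mu.
  apply: le_trans muc _; rewrite /C_mu.
  have : 0 <= c * (16 - pi ^+ 2) by rewrite mulr_ge0 ?subr_ge0 //; lra.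
  lra.
have L0 : 0 <= L := le_trans ler01 L1.
have C_err_ge0 : 0 <= C_err by rewrite /C_err !addr_ge0 // !mulr_ge0 // exprn_ge0.
have C_mu_ge0 : 0 <= C_mu by rewrite /C_mu; lra.
have K0 : 0 <= K1%:R :> R by [].
have Cr0 : 0 <= C_mu * C_err + K1%:R + 1 by rewrite !addr_ge0 // mulr_ge0.
have C_rem_ge0 : 0 <= C_rem by rewrite /C_rem mulr_ge0.
have errs : \sum_(0 <= k < n) err x B L k <= nR ^+ 2 * (C_err * B ^+ 2).
  have -> : nR ^+ 2 * (C_err * B ^+ 2) = \sum_(0 <= k < n) (nR * (C_err * B ^+ 2)).
    by rewrite sumr_const_nat subn0 -[RHS]mulr_natl; ring.
  rewrite [leLHS]big_nat [leRHS]big_nat; apply: ler_sum => k /andP[_ kn].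
  have Mk : M k <= nR * B.
    apply: le_trans (Mlip k (ltnW kn)) _; rewrite ler_wpM2r ?(ltW B0) // ler_nat; exact: ltnW.
  have f1 : (4 * L + 1) * B * M k <= (4 * L + 1) * B * (nR * B).
    by rewrite ler_wpM2l // mulr_ge0 ?(ltW B0) // addr_ge0 // mulr_ge0.
  have n1 : 1 <= nR by rewrite ler1n.
  have f2 : (4 * L ^+ 2 + 2 * L) * B ^+ 2 <= nR * ((4 * L ^+ 2 + 2 * L) * B ^+ 2).
    by rewrite ler_peMl // mulr_ge0 ?sqr_ge0 // addr_ge0 // mulr_ge0 // exprn_ge0.
  rewrite /err; apply: le_trans (lerD f1 f2) _; rewrite /C_err.
  have -> : nR * ((4 * L ^+ 2 + 6 * L + 1) * B ^+ 2) =
     (4 * L + 1) * B * (nR * B) + nR * ((4 * L ^+ 2 + 2 * L) * B ^+ 2) by ring.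
  by [].
(* For [tau = 1] the averaged tail misses half of the first term, M(1) (x(1) - x(0)), which is at
   most B^2. *)
have tailb : Xs - B ^+ 2 <= tail2 n tau x 0.
  rewrite /tail2 add0n -XsE.
  suff : Xs - B ^+ 2 <= tailsum n x tau.
    by have := sqr_ge0 B; lra.
  have [->|t1] : tau = 0%N \/ tau = 1%N by clear -tau1; lia.
    by rewrite -XsE lerBlDr lerDl sqr_ge0.
  rewrite t1 XsE /tailsum big_ltn // lerBlDr addrC lerD2l /=.
  have g0 : 0 <= x 1%N - x 0%N by rewrite subr_ge0 xmono.
  rewrite expr2; apply: ler_pM => //; first exact: M_ge.
    by have := Mlip 1%N isT; rewrite mul1r.
  exact: xr.
have main : Xs <= mu / c * (Y - kap * Q) + (C_mu * C_err + K1%:R + 1) * B ^+ 2.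
  have h1 : mu * (\sum_(0 <= k < n) err x B L k) <= C_mu * (C_err * B ^+ 2).
    apply: le_trans (ler_wpM2l (ltW hmu) errs) _.
    have -> : mu * (nR ^+ 2 * (C_err * B ^+ 2)) = nR ^+ 2 * mu * (C_err * B ^+ 2) by ring.
    by rewrite ler_wpM2r // mulr_ge0 ?sqr_ge0.
  have h2 := le_trans tailb F.
  have -> : (C_mu * C_err + K1%:R + 1) * B ^+ 2 = C_mu * (C_err * B ^+ 2) + K1%:R * B * B + B ^+ 2 by ring.
  move: h1 h2; move: (mu * (\sum_(0 <= k < n) _)) (mu / c * (Y - kap * Q)) => a b.
  by move: (C_mu * (C_err * B ^+ 2)) (K1%:R * B * B) => e f; move: (B ^+ 2) => g; lra.
have B2 : B ^+ 2 <= C_mu / nR * Xs.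
  apply: le_trans Bs _; rewrite ler_wpM2r //; first by rewrite /Xs sumr_ge0 // => j _; rewrite sqr_ge0.
  by rewrite ler_pdivlMr // mulrAC -expr2.
have hX : (1 - C_rem / nR) * Xs <= mu / c * (Y - kap * Q).
  have h := ler_wpM2l Cr0 B2.
  have -> : (1 - C_rem / nR) * Xs = Xs - (C_mu * C_err + K1%:R + 1) * (C_mu / nR * Xs).
    by rewrite /C_rem; ring.
  by rewrite lerBlDr; apply: le_trans main _; rewrite lerD2l.
apply: (few_slack C_rem_ge0 kap0 kap1 n8 nC eps01 (M0 x) Mn (w := mu / c)) => //.
- exact: divr_ge0 (ltW hmu) (le_trans ler01 hc).
- rewrite mulrA ler_pdivrMr; last exact: lt_le_trans ltr01 hc.
  apply: le_trans muc _; have : 0 <= (c - 1) * eps by rewrite mulr_ge0 ?subr_ge0 //; lra.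
  lra.
- by apply/allP => s /sn /andP[].
- rewrite big_ltn // big_ltn // M0 expr0n add0r ltr_wpDr //.
    by rewrite sumr_ge0 // => k _; rewrite sqr_ge0.
  rewrite MS M0 sub0r exprn_even_gt0 //= oppr_eq0 lt_eqF //.
  exact: (x_first_lt rk kirchx mu0 nonzero).
- by rewrite sum_sq_diff.
Qed.

End Assembly.

(** * The diameter *)

Section DiameterUpper.
Local Open Scope nat_scope.
Variables (V : finType) (G : sgraph V).

Lemma walkP k x y : reflect (exists p : seq V, [/\ size p = k, path (adj G) x p & last x p = y])
  (walk G k x y).
Proof.
apply: (iffP existsP) => [[p /andP[pth /eqP lst]]|[p [sz pth lst]]].
  by exists p; rewrite size_tuple.
by move/eqP: sz => sz; exists (Tuple sz); rewrite /= pth lst eqxx.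
Qed.

Lemma walk_cat a b x y z : walk G a x y -> walk G b y z -> walk G (a + b) x z.
Proof.
move=> /walkP[p [<- pp lp]] /walkP[q [<- pq lq]]; apply/walkP; exists (p ++ q).
by rewrite size_cat cat_path pp lp pq last_cat lp lq.
Qed.

Lemma dist_walk x y : connected_graph G -> (dist G x y < #|V|) /\ walk G (dist G x y) x y.
Proof.
move=> [_ con]; have hp : has (fun k => walk G k x y) (iota 0 #|V|).
  have /connectP[p pth lst] := con x y; move: lst; case/shortenP: pth => q pq uq _ lst.
  apply/hasP; exists (size q); last by apply/walkP; exists q.
  by rewrite mem_iota; have := max_card (mem (x :: q)); rewrite (card_uniqP uq).
have := nth_find 0 hp; rewrite -/(dist G x y) has_find size_iota in hp *.
by rewrite nth_iota.
Qed.

Lemma dist_min x y k : walk G k x y -> dist G x y <= k.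
Proof.
move=> w; rewrite leqNgt; apply/negP => kd.
have kn : k < #|V|.
  apply: leq_trans kd _; rewrite /dist -[X in _ <= X](size_iota 0); exact: find_size.
by have := before_find 0 kd; rewrite nth_iota // w.
Qed.

(** The closed neighbourhoods of every third vertex on a shortest path are disjoint, since a common
    vertex would replace at least three steps by two; each has at least d + 1 vertices. *)
Lemma dist_bound d x y : connected_graph G -> (forall v, d <= degree G v) ->
  (dist G x y).+1 <= 3 * (#|V| %/ d.+1).
Proof.
move=> con deg; have [_ /walkP[p [sz pth lst]]] := dist_walk x y con.
set D := dist G x y in sz *; set t := D %/ 3.
pose w i := nth x (x :: p) (3 * i).
pose N i : {set V} := w i |: [set v | adj G (w i) v].
have splitw i j : i <= j -> j <= D -> walk G (j - i) (nth x (x :: p) i) (nth x (x :: p) j).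
  move=> ij jD; apply/walkP; exists (take (j - i) (drop i p)).
  have pd : path (adj G) (nth x (x :: p) i) (drop i p).
    case: i ij => [|i] ij; first by rewrite drop0.
    have ip : i < size p by rewrite sz; lia.
    move: pth; rewrite -{1}(cat_take_drop i.+1 p) cat_path => /andP[_].
    by rewrite (last_nth x) size_takel //= nth_take.
  split.
  - by rewrite size_takel // size_drop sz leq_sub2r.
  - by rewrite take_path.
  rewrite (last_nth x) size_takel; last by rewrite size_drop sz leq_sub2r.
  case ji : (j - i) => [|r] /=; first by congr nth; lia.
  by rewrite nth_take // nth_drop; have -> : j = (i + r).+1 by lia.
have close i v : v \in N i -> exists2 k, k <= 1 & walk G k (w i) v /\ walk G k v (w i).
  rewrite !inE => /orP[/eqP ->|wv]; [exists 0 | exists 1] => //.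
    by split; apply/walkP; exists [::].
  by split; apply/walkP; [exists [:: v] | exists [:: w i]]; rewrite /= andbT; split; rewrite // adj_sym.
have disj i j v : i < j -> j <= t -> v \in N i -> v \in N j -> False.
  move=> ij jt /close[a a1 [wa _]] /close[b b1 [_ wb]].
  have j3 : 3 * j <= D by rewrite /t in jt; lia.
  have i3 : 3 * i <= D by lia.
  have w1 := splitw 0 (3 * i) (leq0n _) i3; have w2 := splitw (3 * j) D j3 (leqnn _).
  have := walk_cat (walk_cat (walk_cat w1 wa) wb) w2.
  have -> : nth x (x :: p) D = y by rewrite -lst (last_nth x) sz.
  by move=> /dist_min; rewrite -/D; lia.
have cardN i : d.+1 <= #|N i|.
  rewrite cardsU1 inE adj_irr /= add1n ltnS.
  by have := deg (w i); rewrite /degree.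
have tot : \sum_(i < t.+1) #|N i| <= #|V|.
  have -> : \sum_(i < t.+1) #|N i| = \sum_(v : V) \sum_(i < t.+1) (v \in N i).
    rewrite exchange_big /=; apply: eq_bigr => i _; rewrite -sum1_card big_mkcond /=.
    by apply: eq_bigr => v _; case: (v \in N i).
  rewrite -sum1_card; apply: leq_sum => v _.
  have [/existsP[i vi]|/existsPn no] := boolP [exists i : 'I_t.+1, v \in N i]; last first.
    by rewrite big1 // => i _; rewrite (negPf (no i)).
  rewrite (bigD1 i) //= vi big1 // => j ji; apply/eqP; rewrite eqb0; apply/negP => vj.
  have [ij|ij|ij] := ltngtP i j.
  - exact: (disj i j v ij (ltn_ord j)).
  - exact: (disj j i v ij (ltn_ord i)).
  - by rewrite (val_inj ij) eqxx in ji.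
have : t.+1 * d.+1 <= #|V|.
  apply: leq_trans tot; rewrite -[X in X * _]card_ord -sum_nat_const; exact: leq_sum.
rewrite -leq_divRL //; rewrite /t; move: (#|V| %/ d.+1) => q; lia.
Qed.

Lemma diam_bound d : connected_graph G -> (forall v, d <= degree G v) ->
  (diam G).+1 <= 3 * (#|V| %/ d.+1).
Proof.
move=> con deg; have [v0 _] := card_gt0P (proj1 con).
have h x y := dist_bound x y con deg.
have [q qE] : exists q, 3 * (#|V| %/ d.+1) = q.+1.
  by exists (3 * (#|V| %/ d.+1)).-1; rewrite prednK //; have := h v0 v0; lia.
rewrite qE ltnS; apply/bigmax_leqP => x _; apply/bigmax_leqP => y _.
by have := h x y; rewrite qE.
Qed.

End DiameterUpper.

Definition step_at (R : realFieldType) (n d tau S : nat) (A : rel nat) (x : nat -> R)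
    (mu c kap B L : R) (typ : pred nat) (b : nat) : Prop :=
  let N := node tau x in let T := scale x mu c B L b in
  [\/ exists2 s, (0 < s <= S)%N & N (b + s)%N - N b <= T * (s%:R - kap),
      [/\ typ b, typ (b + d.+1)%N, good A (b + tau).+1 ((b + tau).+1 + d.+1)%N
        & N (b + d.+1)%N - N b <= T * d.+1%:R + mu * B]
    | [/\ ~~ typ b, typ (b + d.+2)%N, good A (b + tau).+2 ((b + tau).+2 + d.+1)%N
        & N (b + d.+2)%N - N b <= T * d.+2%:R + mu * B]].

(** * Normalising the flux *)

Section Rescale.
Variables (R : realFieldType) (n d : nat) (A : rel nat) (x : nat -> R) (mu c kap L : R).
Hypothesis rk : ranked n A x.
Hypothesis conn : forall k, (0 < k < n)%N -> (0 < cutsize n A k)%N.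
Hypothesis kirchx : forall z, (z < n)%N -> kirch n A x z = - mu * x z.
Hypothesis mu0 : 0 < mu.
Hypothesis nonzero : exists2 j, (j < n)%N & x j != 0.
Hypothesis c1 : 1 <= c.
Hypothesis kap0 : 0 < kap.
Hypothesis dL : (2 * d + 6)%:R <= L.
Hypothesis kapL : c <= kap * L.

Local Notation B := (x n.-1 - x 0%N).

Variable b : nat.
Hypothesis bn : (b + 2 * d + 6 < n)%N.
Local Notation T := (scale x mu c B L b).

Lemma scale_gt0 : 0 < T.
Proof.
have B0 := range_gt0 rk kirchx mu0 nonzero; have [_ _ _ xmono] := rk.
have M0 := M_ge0 xmono (negsum_n rk kirchx mu0) (k := b) ltac:(clear -bn; lia).
have L0 : 0 < L by apply: lt_le_trans dL; rewrite ltr0n addnS.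
rewrite /scale mulr_gt0 ?divr_gt0 //; first by have hc := c1; lra.
by rewrite /Mhat ltr_wpDl // mulr_gt0.
Qed.

Definition rescaled (j : nat) : R := x j / T.
Local Notation y := rescaled.

Lemma ranked_rescaled : ranked n A y.
Proof.
have [h1 h2 h3 xmono] := rk; split=> // i j ij.
by rewrite /rescaled ler_wpM2r ?invr_ge0 ?(ltW scale_gt0) // xmono.
Qed.

Lemma flux_rescaled k : (b < k <= b + 2 * d + 6)%N -> cutflux n A y k <= c.
Proof.
move=> kb; have -> : cutflux n A y k = cutflux n A x k / T.
  rewrite /cutflux mulr_suml; apply: eq_bigr => z _; rewrite /upsum mulr_suml.
  by apply: eq_bigr => j _; rewrite /rescaled; ring.
have [Asym _ _ xmono] := rk.
have hc := c1; have c0 : 0 < c by lra.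
rewrite ler_pdivrMr ?scale_gt0 // (flux_negsum Asym kirchx); last by clear -kb bn; lia.
rewrite /scale mulrA [c * _]mulrC divfK ?gt_eqF // ler_wpM2l ?(ltW mu0) // /Mhat.
have [t kE] : exists t, k = (b + t)%N by exists (k - b)%N; clear -kb; lia.
have tL : t%:R <= L by apply: le_trans dL; rewrite ler_nat; clear -kb kE; lia.
have := @M_lip _ _ _ _ (x_bound rk kirchx mu0 nonzero) b t ltac:(clear -kb kE bn; lia).
rewrite -kE ler_norml => /andP[_ h].
have := ler_wpM2r (ltW (range_gt0 rk kirchx mu0 nonzero)) tL; lra.
Qed.

Lemma kirch_rescaled z : (z < n)%N -> kirch n A y z <= mu * B / T.
Proof.
move=> zn; have -> : kirch n A y z = kirch n A x z / T.
  by rewrite /kirch mulr_suml; apply: eq_bigr => j _; rewrite /rescaled; ring.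
rewrite kirchx // ler_wpM2r ?invr_ge0 ?(ltW scale_gt0) // mulNr -mulrN ler_wpM2l ?(ltW mu0) //.
by have := x_bound rk kirchx mu0 nonzero zn; rewrite ler_norml => /andP[]; lra.
Qed.

(** T is at least (mu / c) L B, so [c <= kap * L] is exactly what keeps the drift below [kap]. *)
Lemma drift_le : 0 <= mu * B / T <= kap.
Proof.
have B0 := range_gt0 rk kirchx mu0 nonzero; have T0 := scale_gt0.
have mB : 0 < mu * B by rewrite mulr_gt0.
rewrite divr_ge0 ?(ltW mB) ?(ltW T0) //= ler_pdivrMr //.
have [_ _ _ xmono] := rk; have hc := c1; have c0 : 0 < c by lra.
have M0 := M_ge0 xmono (negsum_n rk kirchx mu0) (k := b) ltac:(clear -bn; lia).
have h : mu * B * c <= mu * B * (kap * L) by rewrite ler_wpM2l // ltW.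
have -> : kap * T = (mu * B * (kap * L) + mu * (kap * negsum x b)) / c.
  by rewrite /scale /Mhat; ring.
have m0 : 0 <= mu * (kap * negsum x b) by rewrite !mulr_ge0 // ltW.
by rewrite ler_pdivlMr //; lra.
Qed.

Lemma rescale_le (e f t : R) : e / T <= f / T + t -> e - f <= T * t.
Proof.
move=> h; have := ler_wpM2l (ltW scale_gt0) h.
rewrite mulrDr ![T * (_ / _)]mulrCA divff ?gt_eqF ?scale_gt0 // !mulr1; lra.
Qed.

Lemma step_min_degree S : (3 <= d)%N -> (forall z, (z < n)%N -> (d <= nbrs A 0 n z)%N) ->
  c = d%:R - 1 -> d%:R ^+ 2 * kap <= 1 / 8 -> (2 * d + 5 <= S)%N ->
  step_at n d 0 S A x mu c kap B L (fun b => cutsize n A b.+1 == 1%N) b.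
Proof.
move=> d3 deg cE kd dS.
have nodeE j : node 0 x j = x j by rewrite /node addn0; lra.
have mB : 0 <= mu * B by rewrite mulr_ge0 ?(ltW mu0) // ltW // (range_gt0 rk kirchx mu0 nonzero).
rewrite /step_at !nodeE addn0.
have fl k : (b < k <= b + 2 * d + 6)%N -> cutflux n A y k <= d%:R - 1.
  by rewrite -cE; exact: flux_rescaled.
have [[s sS h]|[e1 e2 g h]|[e1 e2 g h]] := local_D ranked_rescaled d3 deg conn kap0 kd dS bn fl.
- constructor 1; exists s => //; rewrite nodeE; apply: rescale_le.
  by move: h; rewrite /rescaled addrA.
- constructor 2; rewrite !(addnS, addSn) e1 e2; split=> //.
  have := @rescale_le (x (b + d).+1) (x b) d.+1%:R.
  rewrite -natr1; move: h; rewrite /rescaled -addrA => h /(_ h).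
  lra.
- constructor 3; rewrite !(addnS, addSn) e2; split=> //; first by apply/eqP.
  have := @rescale_le (x (b + d).+2) (x b) (d%:R + 2).
  move: h; rewrite /rescaled -addrA => h /(_ h).
  by rewrite -[d.+2]addn2 natrD; lra.
Qed.

Lemma step_regular S : (4 <= d)%N -> ~~ odd d -> (forall z, (z < n)%N -> nbrs A 0 n z = d) ->
  c = 2 * (d%:R - 2) -> d%:R ^+ 2 * kap <= 1 / 128 -> (2 * d + 5 <= S)%N ->
  step_at n d 1 S A x mu c kap B L (fun b => cutsize n A b.+2 == 2%N) b.
Proof.
move=> d4 dev deg cE kd dS.
have /andP[del0 delk] := drift_le.
have midE j : midpt y j = node 1 x j / T.
  by rewrite /midpt /node addn1 /rescaled; ring.
have Te : T * (mu * B / T) = mu * B by rewrite mulrC divfK ?gt_eqF ?scale_gt0.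
have cm : calm n A y d (mu * B / T) b (2 * d + 6).
  split; first by clear -bn; lia.
    by move=> k kb; rewrite -cE; apply: flux_rescaled; clear -kb; lia.
  by move=> z zb; apply: kirch_rescaled; clear -zb bn; lia.
rewrite /step_at addn1.
have [[s sS h]|[e1 e2 g h]|[e1 e2 g h]] :=
  local_E ranked_rescaled d4 deg dev conn del0 delk kd dS cm; move: h; rewrite !midE -!addrA => h.
- by constructor 1; exists s => //; apply: rescale_le.
- constructor 2; rewrite !(addnS, addSn) e1 e2; split=> //.
  by have := rescale_le h; have := Te; move: (mu * _ / T) => t; rewrite -natr1; lra.
- constructor 3; rewrite !(addnS, addSn) e2; split=> //; first by apply/eqP.
  by have := rescale_le h; have := Te; move: (mu * _ / T) => t; rewrite -[d.+2]addn2 natrD; lra.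
Qed.

End Rescale.

(** The term 1 / n in [eta] makes n times its cube root at least 1, so the additive constant of the
    count is absorbed as well. Bounding H by (H + 1)^3 avoids a cube root of H. *)
Lemma lower_of_count (R : realType) (d S K1 : nat) (H : R) (n k q D : nat) (eps : R) :
  (0 < n)%N -> 0 <= H -> 0 <= eps ->
  (n <= d.+1 * k + S.+1 * q + K1.+1)%N ->
  q%:R ^+ 3 <= H * (eps + n%:R^-1) * n%:R ^+ 3 -> (3 * k <= D)%N ->
  (3 * n)%:R / (d + 1)%:R
    - 3 * (S.+1%:R * (H + 1) + K1.+1%:R) * (eps + n%:R^-1) `^ (3%:R^-1) * n%:R <= D%:R.
Proof.
move=> n0 H0 e0 cnt q3 kD.
have nR : 0 < n%:R :> R by rewrite ltr0n.
set eta := eps + _ in q3 *; set t := eta `^ _.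
have eta0 : 0 < eta by rewrite /eta ltr_wpDl // invr_gt0.
have t3 : t ^+ 3 = eta by rewrite /t -powR_mulrn ?powR_ge0 // -powRrM mulVf ?powRr1 ?pnatr_eq0 // ltW.
have t0 : 0 <= t by rewrite powR_ge0.
have tn1 : 1 <= t * n%:R.
  rewrite -(@ler_pXn2r _ 3) ?nnegrE ?mulr_ge0 ?ler01 // expr1n exprMn t3.
  have n1 : 1 <= n%:R :> R by rewrite ler1n.
  apply: (@le_trans _ _ (n%:R^-1 * n%:R ^+ 3)); last first.
    by rewrite ler_wpM2r ?exprn_ge0 // /eta lerDr.
  by rewrite exprSr mulrCA mulVf ?gt_eqF // mulr1 expr_ge1 // ltW.
have qt : q%:R <= (H + 1) * (t * n%:R).
  rewrite -(@ler_pXn2r _ 3) ?nnegrE ?mulr_ge0 ?addr_ge0 //.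
  apply: le_trans q3 _; rewrite !exprMn t3 mulrA ler_wpM2r ?exprn_ge0 // ler_wpM2r ?(ltW eta0) //.
  have h := H0; rewrite !exprS expr0 mulr1.
  have : 0 <= H * H * H by rewrite !mulr_ge0.
  have : 0 <= H * H by rewrite !mulr_ge0.
  lra.
have d1 : 0 < (d + 1)%:R :> R by rewrite addn1 ltr0n.
have hn : n%:R <= d.+1%:R * k%:R + S.+1%:R * q%:R + K1.+1%:R :> R.
  by rewrite -!natrM -!natrD ler_nat.
have hD : 3 * k%:R <= D%:R :> R by rewrite -natrM ler_nat.
have S0 : 0 <= S.+1%:R :> R by []; have K0 : 0 <= K1.+1%:R :> R by [].
have h1 := ler_wpM2l S0 qt; have h2 := ler_wpM2l K0 tn1.
set E := S.+1%:R * (H + 1) + K1.+1%:R.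
have hE : n%:R <= d.+1%:R * k%:R + E * (t * n%:R).
  apply: le_trans hn _; rewrite -addrA lerD2l /E mulrDl -mulrA; apply: lerD => //.
  by rewrite -{1}[K1.+1%:R]mulr1.
have E0 : 0 <= E * (t * n%:R).
  by rewrite mulr_ge0 ?mulr_ge0 // /E addr_ge0 // mulr_ge0 // addr_ge0.
rewrite lerBlDr ler_pdivrMr // natrM addn1.
rewrite -[3 * E * t * n%:R]/(3 * E * t * n%:R) -!mulrA.
have k1 : 1 <= d.+1%:R :> R by rewrite ler1n.
have h3 := ler_wpM2r E0 k1; have h4 := ler_wpM2r (ler0n R d.+1) hD.
rewrite mulrDl; move: h3 h4 hE; rewrite mul1r.
by move: (E * (t * _)) => F; lra.
Qed.

Lemma lower_bound (R : realType) (d tau S K1 : nat) (c kap L : R) (Pdeg : nat -> Prop) :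
  (3 <= d)%N -> 1 <= c -> 0 < kap -> kap <= 1 -> (tau <= 1)%N -> (d.+2 <= S)%N ->
  (S + 3 <= K1)%N -> S%:R + 1 <= L ->
  (forall n A (x : nat -> R) mu,
    ranked n A x -> (forall k, (0 < k < n)%N -> (0 < cutsize n A k)%N) ->
    (forall z, (z < n)%N -> kirch n A x z = - mu * x z) -> 0 < mu ->
    (exists2 j, (j < n)%N & x j != 0) -> (forall z, (z < n)%N -> Pdeg (nbrs A 0 n z)) ->
    exists typ, forall b, (b + K1 <= n)%N ->
      step_at n d tau S A x mu c kap (x n.-1 - x 0%N) L typ b) ->
  exists (C : R) (n0 : nat), 0 < C /\
    forall (eps : R) (V : finType) (G : sgraph V),
      (n0 <= #|V|)%N -> 0 <= eps <= 1 -> connected_graph G -> (forall v, Pdeg (degree G v)) ->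
      #|V|%:R ^+ 2 * alg_connectivity R G <= c * pi ^+ 2 + eps ->
      (3 * #|V|)%:R / (d + 1)%:R - C * (eps + #|V|%:R^-1) `^ (3%:R^-1) * #|V|%:R <= (diam G)%:R.
Proof.
move=> d3 c1 kap0 kap1 tau1 dS SK LS step.
pose H := C_count (C_rem K1 c L) kap.
have Cr0 : 0 <= C_rem K1 c L.
  have S0 : 0 <= S%:R :> R by [].
  rewrite /C_rem /C_mu /C_err !(mulr_ge0, addr_ge0) ?exprn_ge0 //; lra.
have H0 : 0 <= H.
  rewrite /H; move: Cr0; move: (C_rem _ _ _) => Z Z0.
  have Z7 : 0 <= C_gap Z by rewrite /C_gap addr_ge0 // mulr_ge0 // addr_ge0.
  exact: addr_ge0 (mulr_ge0 (ler0n R 512) (mulr_ge0 Z7 (divr_ge0 (ler0n R 6) (ltW kap0))))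
    (ler0n R 216).
exists (3 * (S.+1%:R * (H + 1) + K1.+1%:R)); exists (8 + Num.bound (2 * C_rem K1 c L))%N.
split.
  by rewrite mulr_gt0 // ltr_wpDl ?ltr0n // !mulr_ge0 // addr_ge0.
move=> eps V G nn e01 con deg muc; have /andP[e0 _] := e01.
have n2 : (1 < #|V|)%N by clear -nn; lia.
have [mu0 [f [v fv] eig]] := alg_connectivity_eigen R con n2.
have nz : exists2 j, (j < #|V|)%N & rankval f v j != 0.
  have : v \in byval f by rewrite mem_byval.
  rewrite -index_mem size_byval // => vn; exists (index v (byval f)) => //.
  by rewrite rankvalE // nth_index ?mem_byval.
have rk := ranked_graph f v con; have rc := rank_conn f v con.
have rki := rank_kirch v eig.
have [typ st] := step _ _ _ _ rk rc rki mu0 nz ltac:(by move=> z zn; rewrite rank_degree).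
have dia ks : (tau < #|V|)%N -> _ := rank_diam (f := f) (v0 := v) con (ks := ks) d3 (b := tau).
move: dia rk rc rki nz st; move: (rankadj G f v) (rankval f v) => A x.
have [m mE] : exists m, #|V| = m.+2 by exists (#|V| - 2)%N; clear -n2; lia.
rewrite mE in nn muc *; move=> dia rk rc rki nz st.
have n8 : (8 <= m.+2)%N by clear -nn; lia.
have nC : 2 * C_rem K1 c L <= m.+2%:R.
  apply: le_trans (ltW (Num.Theory.archi_boundP _)) _; first by rewrite mulr_ge0.
  by rewrite ler_nat; clear -nn; lia.
have [ks [q [bl cnt q3]]] := many_blocks rk rc rki mu0 nz c1 kap0 kap1 tau1 dS SK LS e01 muc n8 nC st.
apply: lower_of_count cnt q3 _ => //; apply: dia bl; clear -tau1; lia.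
Qed.

Lemma lower_min_degree (R : realType) (d : nat) : (3 <= d)%N -> exists (C : R) (n0 : nat), 0 < C /\
  forall (eps : R) (V : finType) (G : sgraph V),
    (n0 <= #|V|)%N -> 0 <= eps <= 1 -> connected_graph G -> (forall v, (d <= degree G v)%N) ->
    #|V|%:R ^+ 2 * alg_connectivity R G <= (d%:R - 1) * pi ^+ 2 + eps ->
    (3 * #|V|)%:R / (d + 1)%:R - C * (eps + #|V|%:R^-1) `^ (3%:R^-1) * #|V|%:R <= (diam G)%:R.
Proof.
move=> d3; have d3R : 3 <= d%:R :> R by rewrite (ler_nat _ 3).
have d2 : 9 <= d%:R ^+ 2 :> R by rewrite -natrX (ler_nat _ 9); clear -d3; nia.
have dd : d%:R <= d%:R ^+ 2 :> R by rewrite -natrX ler_nat; clear -d3; nia.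
(* [kap] is the largest slack that [local_D] allows. [L] gives [kap * L = d], which is above c, and
   is at least 72 d, more than all window lengths. *)
pose kap : R := (8 * d%:R ^+ 2)^-1; pose L : R := 8 * d%:R ^+ 2 * d%:R.
have k0 : 0 < kap by rewrite invr_gt0; lra.
have kE : d%:R ^+ 2 * kap = 1 / 8 by rewrite /kap; field; lra.
have kL : kap * L = d%:R by rewrite /kap /L; field; lra.
have L3 : 72 * d%:R <= L by rewrite /L ler_wpM2r //; lra.
apply: (@lower_bound R d 0 (2 * d + 5) (2 * d + 8) (d%:R - 1) kap L (fun k => d <= k)%N) => //;
  try by clear -d3; lia.
- by lra.
- by rewrite /kap invf_le1; lra.
- by rewrite natrD natrM; lra.
move=> n A x mu rk conn kirchx mu0 nz deg.
exists (fun b => cutsize n A b.+1 == 1%N) => b bn.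
apply: step_min_degree => //; try lra; clear -bn; lia.
Qed.

Lemma lower_regular (R : realType) (d : nat) : (4 <= d)%N -> ~~ odd d ->
  exists (C : R) (n0 : nat), 0 < C /\
  forall (eps : R) (V : finType) (G : sgraph V),
    (n0 <= #|V|)%N -> 0 <= eps <= 1 -> connected_graph G -> (forall v, degree G v = d) ->
    #|V|%:R ^+ 2 * alg_connectivity R G <= 2 * (d%:R - 2) * pi ^+ 2 + eps ->
    (3 * #|V|)%:R / (d + 1)%:R - C * (eps + #|V|%:R^-1) `^ (3%:R^-1) * #|V|%:R <= (diam G)%:R.
Proof.
move=> d4 dev; have d4R : 4 <= d%:R :> R by rewrite (ler_nat _ 4).
have d2 : 16 <= d%:R ^+ 2 :> R by rewrite -natrX (ler_nat _ 16); clear -d4; nia.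
(* The largest slack that [local_E] allows; [L] gives [kap * L = 2 d], which is above c. *)
pose kap : R := (128 * d%:R ^+ 2)^-1; pose L : R := 256 * d%:R ^+ 2 * d%:R.
have k0 : 0 < kap by rewrite invr_gt0; lra.
have kE : d%:R ^+ 2 * kap = 1 / 128 by rewrite /kap; field; lra.
have kL : kap * L = 2 * d%:R by rewrite /kap /L; field; lra.
have L3 : 256 * d%:R <= L by rewrite /L ler_wpM2r //; lra.
apply: (@lower_bound R d 1 (2 * d + 5) (2 * d + 8) (2 * (d%:R - 2)) kap L (fun k => k = d)) => //;
  try by clear -d4; lia.
- by lra.
- by rewrite /kap invf_le1; lra.
- by rewrite natrD natrM; lra.
move=> n A x mu rk conn kirchx mu0 nz deg.
exists (fun b => cutsize n A b.+2 == 2%N) => b bn.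
apply: step_regular => //; try lra; clear -bn; lia.
Qed.

Theorem corollary1p3 (R : realType) (d : nat) (hd : (3 <= d)%N) :
  exists (C : R) (n0 : nat), 0 < C /\
    forall (n : nat) (eps : R) (V : finType) (G : sgraph V),
      (n0 <= n)%N -> 0 <= eps <= 1 ->
      (class_D G n d /\
         n%:R ^+ 2 * alg_connectivity R G <= (d%:R - 1) * pi ^+ 2 + eps) \/
      (class_R G n d /\
         n%:R ^+ 2 * alg_connectivity R G <= (c_ d)%:R * pi ^+ 2 + eps) ->
      (3 * n)%:R / (d + 1)%:R - C * (eps + n%:R^-1) `^ (3%:R^-1) * n%:R
        <= ((diam G)%:R : R) <=
      (3 * (n %/ (d + 1)))%:R - 1.
Proof.
have upper (V : finType) (G : sgraph V) : connected_graph G -> (forall v, d <= degree G v)%N ->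
    (diam G)%:R <= (3 * (#|V| %/ (d + 1)))%:R - 1 :> R.
  by move=> con deg; rewrite lerBrDr natr1 ler_nat addn1 diam_bound.
have [C1 [n1 [C1_gt0 low1]]] := lower_min_degree R hd.
(* For odd d both spectral hypotheses have the constant d - 1, and a regular graph is a special case
   of minimum degree d. *)
have [dodd|dev] := boolP (odd d).
  have cE : (c_ d)%:R = d%:R - 1 :> R by rewrite /c_ dodd -subn1 natrB //; clear -hd; lia.
  exists C1, n1; split=> // n eps V G nn e01 [[[nE con deg] h]|[[nE con deg] h]]; subst n.
    by apply/andP; split; [apply: low1|apply: upper].
  have deg' v : (d <= degree G v)%N by rewrite deg.
  by rewrite cE in h; apply/andP; split; [apply: low1|apply: upper].
have d4 : (4 <= d)%N by rewrite ltn_neqAle hd andbT; apply: contraNneq dev => <-.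
have cE : (c_ d)%:R = 2 * (d%:R - 2) :> R.
  by rewrite /c_ (negbTE dev) natrM natrB //; clear -hd; lia.
have [C2 [n2 [C2_gt0 low2]]] := lower_regular R d4 dev.
exists (C1 + C2), (n1 + n2)%N; split; first exact: addr_gt0.
have weaken C C' t (a b e : R) : C <= C' -> 0 <= t -> 0 <= b -> a - C * t * b <= e -> a - C' * t * b <= e.
  move=> CC t0 b0; apply: le_trans; rewrite lerD2l lerN2 ler_wpM2r // ler_wpM2r //.
move=> n eps V G nn e01 [[[nE con deg] h]|[[nE con deg] h]]; subst n; apply/andP; split.
- apply: (weaken C1); rewrite ?powR_ge0 ?lerDl ?(ltW C2_gt0) //.
  by apply: low1 => //; clear -nn; lia.
- exact: upper.
- apply: (weaken C2); rewrite ?powR_ge0 ?lerDr ?(ltW C1_gt0) //.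
  by rewrite cE in h; apply: low2 => //; clear -nn; lia.
- by apply: upper => // v; rewrite deg.
Qed.
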